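(* Let $1<p<\infty$. There exists a unique bounded strong solution $Y\in\mathcal W_p\left((-\infty,\ln k_1)\times(0,T]\right)$ of the call-side obstacle problem. Furthermore, $$\psi_1(x)\le Y(x,\tau)\le K_2-K_1,\qquad (x,\tau)\in(-\infty,\ln k_1]\times[0,T],$$ $$\partial_\tau Y\ge0,\qquad 0\le\partial_xY\le e^x\qquad\text{almost everywhere in }(-\infty,\ln k_1)\times(0,T].$$
   Context: Constants: $0<K_1<k_1<k_2<K_2$, $\sigma>0$, $r>0$, $q\ge0$, $T>0$. Put $\mathcal Lu:=\frac{\sigma^2}{2}\partial_{xx}u+\left(r-q-\frac{\sigma^2}{2}\right)\partial_xu-ru$ and $\psi_1(x):=(e^x-K_1)^++K_2-k_1$. Let $Q=(-\infty,\ln k_1)\times(0,T]$. $\mathcal W_p(Q)$ is the set of $u\in C((-\infty,\ln k_1]\times[0,T])$ such that, for all $R,\rho>0$, $u,\partial_xu,\partial_{xx}u,\partial_\tau u$ (weak derivatives) belong to $L^p$ of $\left(((-\infty,\ln k_1)\cap(-R,R))\times(0,T)\right)\setminus B_\rho(\ln K_1,0)$, where $B_\rho$ denotes an open disc of radius $\rho$. A strong solution of the call-side obstacle problem is a function $Y\in\mathcal W_p(Q)$ with $Y\ge\psi_1$ in $Q$, $\partial_\tau Y-\mathcal LY\ge0$ almost everywhere in $Q$, $\partial_\tau Y-\mathcal LY=0$ almost everywhere on $\{Y>\psi_1\}$, $Y(x,0)=\psi_1(x)$ for $x<\ln k_1$, and $Y(\ln k_1,\tau)=K_2-K_1$ for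 $\tau\in[0,T]$. *)

(* Defs.v *)
From HB Require Import structures.
From mathcomp Require Import all_boot all_order all_algebra.
From mathcomp Require Import all_classical all_reals all_analysis.
Set Implicit Arguments.
Unset Strict Implicit.
Unset Printing Implicit Defensive.
Import Order.TTheory GRing.Theory Num.Theory.
Import numFieldNormedType.Exports.
Local Open Scope classical_set_scope.
Local Open Scope ring_scope.

(* Points of the plane are pairs z = (x, tau), with z.1 = x and z.2 = tau. *)

Definition lebesgue2 (R : realType) :=
  ((@lebesgue_measure R) \x (@lebesgue_measure R))%E.
Arguments lebesgue2 : clear implicits.

Definition dir_x (R : realType) : R * R := (1, 0).
Definition dir_t (R : realType) : R * R := (0, 1).

Definition iter_derive (R : realType) (s : seq (R * R)) (phi : R * R -> R) :
  R * R -> R := foldr (fun v g => 'D_v g) phi s.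

Definition smooth (R : realType) (phi : R * R -> R) : Prop :=
  forall s : seq (R * R), continuous (iter_derive s phi) /\
    forall z v : R * R, derivable (iter_derive s phi) z v.

(* phi is in C_c^oo(Omega), extended by zero to the whole plane. *)
Definition test_function (R : realType) (Omega : set (R * R)) (phi : R * R -> R) :
  Prop :=
  [/\ smooth phi, compact (closure [set z | phi z != 0]) &
      closure [set z | phi z != 0] `<=` Omega].

Definition locally_integrable2 (R : realType) (Omega : set (R * R))
    (u : R * R -> R) : Prop :=
  [/\ measurable_fun Omega u, open Omega &
      forall K : set (R * R), compact K -> K `<=` Omega ->
        (lebesgue2 R).-integrable K (EFin \o u)].

(* w is a weak derivative of u on Omega, differentiating once along each of the
   directions listed in s. *)
Definition weak_derivative (R : realType) (Omega : set (R * R)) (s : seq (R * R))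
    (u w : R * R -> R) : Prop :=
  [/\ locally_integrable2 Omega u, locally_integrable2 Omega w &
      forall phi : R * R -> R, test_function Omega phi ->
        \int[lebesgue2 R]_(z in Omega) (u z * iter_derive s phi z) =
        (-1) ^+ size s * \int[lebesgue2 R]_(z in Omega) (w z * phi z)].

Definition Qset (R : realType) (k1 T : R) : set (R * R) :=
  [set z | z.1 < ln k1 /\ 0 < z.2 <= T].

Definition Qclosed (R : realType) (k1 T : R) : set (R * R) :=
  [set z | z.1 <= ln k1 /\ 0 <= z.2 <= T].

Definition Qopen (R : realType) (k1 T : R) : set (R * R) :=
  [set z | z.1 < ln k1 /\ 0 < z.2 < T].

Definition disc (R : realType) (c : R * R) (rho : R) : set (R * R) :=
  [set z | (z.1 - c.1) ^+ 2 + (z.2 - c.2) ^+ 2 < rho ^+ 2].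

Definition Qpunctured (R : realType) (K1 k1 T rad rho : R) : set (R * R) :=
  [set z | [/\ z.1 < ln k1, - rad < z.1 < rad & 0 < z.2 < T]]
    `\` disc (ln K1, 0) rho.

Definition in_Lp (R : realType) (p : R) (D : set (R * R)) (u : R * R -> R) :
  Prop := u \_ D \in Lfun (lebesgue2 R) p%:E.

(* Only the values of u on Qclosed k1 T are relevant, and ux, uxx, ut matter
   only up to null subsets of Qset k1 T. *)
Definition is_weak_dx (R : realType) (k1 T : R) (u ux : R * R -> R) : Prop :=
  weak_derivative (Qopen k1 T) [:: dir_x R] u ux.

Definition is_weak_dxx (R : realType) (k1 T : R) (u uxx : R * R -> R) : Prop :=
  weak_derivative (Qopen k1 T) [:: dir_x R; dir_x R] u uxx.

Definition is_weak_dt (R : realType) (k1 T : R) (u ut : R * R -> R) : Prop :=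
  weak_derivative (Qopen k1 T) [:: dir_t R] u ut.

Definition Wp_with (R : realType) (p K1 k1 T : R) (u ux uxx ut : R * R -> R) :
  Prop :=
  [/\ {within Qclosed k1 T, continuous u},
      is_weak_dx k1 T u ux, is_weak_dxx k1 T u uxx, is_weak_dt k1 T u ut &
      forall rad rho : R, 0 < rad -> 0 < rho ->
        [/\ in_Lp p (Qpunctured K1 k1 T rad rho) u,
            in_Lp p (Qpunctured K1 k1 T rad rho) ux,
            in_Lp p (Qpunctured K1 k1 T rad rho) uxx &
            in_Lp p (Qpunctured K1 k1 T rad rho) ut]].

Definition Lop (R : realType) (sigma r q : R) (u ux uxx : R * R -> R)
    (z : R * R) : R :=
  sigma ^+ 2 / 2 * uxx z + (r - q - sigma ^+ 2 / 2) * ux z - r * u z.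

Definition psi1 (R : realType) (K1 k1 K2 x : R) : R :=
  Num.max (expR x - K1) 0 + K2 - k1.

Definition strong_solution (R : realType) (p sigma r q K1 k1 K2 T : R)
    (Y : R * R -> R) : Prop :=
  exists Yx Yxx Yt : R * R -> R,
  [/\ Wp_with p K1 k1 T Y Yx Yxx Yt,
      forall z, Qset k1 T z -> psi1 K1 k1 K2 z.1 <= Y z,
      {ae lebesgue2 R, forall z, Qset k1 T z ->
        0 <= Yt z - Lop sigma r q Y Yx Yxx z},
      {ae lebesgue2 R, forall z, Qset k1 T z -> psi1 K1 k1 K2 z.1 < Y z ->
        Yt z - Lop sigma r q Y Yx Yxx z = 0} &
      (forall x, x < ln k1 -> Y (x, 0) = psi1 K1 k1 K2 x) /\
      (forall t, 0 <= t <= T -> Y (ln k1, t) = K2 - K1)].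

Definition bounded_strong_solution (R : realType)
    (p sigma r q K1 k1 K2 T : R) (Y : R * R -> R) : Prop :=
  strong_solution p sigma r q K1 k1 K2 T Y /\
  exists M : R, forall z, Qclosed k1 T z -> `|Y z| <= M.

(* Main.v *)
(** Replace the payoff by [min (psi1, K2 - K1)], defined on the whole line: the
    value function is then [K2 - K1] to the right of [ln k1], so the lateral
    boundary condition is automatic.  [Y] is a limit, by equicontinuity, of
    binomial-tree optimal stopping values with space step [h = 2^-N] and time
    step [k] such that [sigma^2 k = h^2].  The tree values are nondecreasing in
    time and their increments in [x] lie between [0] and those of [exp].  Central
    binomial estimates for the kink at [ln K1] bound, uniformly in [N] and away
    from [(ln K1, 0)], the time increments, hence, by the recursion, the second
    differences in [x]; doubling the step keeps the latter bounds.  In the limit,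
    the difference quotients of [Y] converge almost everywhere to bounded weak
    derivatives.  The discrete (in)equations, tested against smooth functions,
    give the variational (in)equalities in the sense of distributions, hence
    almost everywhere.

    For uniqueness, on [{Y1 > Y2}] one has [Y1 > psi1], so [w = Y1 - Y2] is there
    a weak subsolution.  If [w] were positive somewhere, a mollification of [w]
    minus a small multiple of [1 + x^2 + L t] would have a positive maximum,
    where the equation is violated since [r > 0]. *)

Require Import Defs.
From HB Require Import structures.
From mathcomp Require Import all_boot all_order all_algebra.
From mathcomp Require Import all_classical all_reals all_analysis.
From mathcomp Require Import measurable_realfun ring lra zify.
Import Order.TTheory GRing.Theory Num.Theory.
Import numFieldNormedType.Exports.
Local Open Scope classical_set_scope.
Local Open Scope ring_scope.
Set Implicit Arguments.
Unset Strict Implicit.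

(** * Binomial coefficients and binomial trees *)

(** The obstruction is the convex kink of the initial datum at [ln K1]: a first step may gain O(h)
    there instead of O(k), and the time derivative is only controlled like t^(-1/2). By comparison,
    the gain at step n is at most O(k) plus O(h) times the probability that the walk, after n steps,
    straddles [ln K1]. That probability is at most (n+1)^(-1/2), and O(h/d) when the walk must
    travel a distance d; since h^2 = sigma^2 k, either bound makes the gain O(k) away from
    [(ln K1, 0)]. Summing the first one alone gives a modulus of order t^(1/2) up to that point,
    which is what equicontinuity requires. Truncation creates another kink, concave, at [ln k1]; it
    only lowers the gains, and the lower bound on second differences is claimed only to its left.
    Doubling is needed because the tree controls second differences at its own step, whereas the
    limit is examined at a fixed step. As the derivatives are bounded on each punctured bounded set,
    all exponents p are treated at once. Monotonicity in time also yields the equation off the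
    contact set: a node above the obstacle stays above it, so its next value is the continuation
    value. *)

Lemma leq_bin_half n j : ('C(n, j) <= 'C(n, n./2))%N.
Proof.
have up i : (i < n./2)%N -> ('C(n, i) <= 'C(n, i.+1))%N.
  move=> hi; rewrite -(leq_pmul2l (ltn0Sn i)) mul_bin_left leq_mul2r.
  by apply/orP; right; lia.
have mono i m : (i + m <= n./2)%N -> ('C(n, i) <= 'C(n, i + m))%N.
  elim: m => [|m IH] him; first by rewrite addn0.
  by rewrite (leq_trans (IH _))//; [lia|rewrite addnS up//; lia].
have low i : (i <= n./2)%N -> ('C(n, i) <= 'C(n, n./2))%N.
  by move=> hi; have := mono i (n./2 - i)%N; rewrite subnKC// leqnn => /(_ isT).
have [|hj] := leqP j n./2; first exact: low.
have [jn|nj] := leqP j n; last by rewrite bin_small.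
rewrite -bin_sub//; apply: low; lia.
Qed.

(** The ratio of consecutive left sides is 4 (2m+1)(2m+3) / (m+1)^2, at most 16 because (2m+1)(2m+3)
    <= (2m+2)^2. *)
Lemma central_bin_sqr m : ('C(m.*2, m) ^ 2 * m.*2.+1 <= 16 ^ m)%N.
Proof.
elim: m => [|m IH]; first by rewrite bin0.
have E : (m.+1 * 'C(m.+1.*2, m.+1) = 2 * m.*2.+1 * 'C(m.*2, m))%N.
  have h1 := mul_bin_diag m.*2.+2 m.
  have h2 := mul_bin_down m.*2.+1 m.
  have e : (m.*2.+1 - m = m.+1)%N by lia.
  move: h1 h2; rewrite doubleS e /= => h1 h2.
  rewrite -h1; apply/eqP; rewrite -(eqn_pmul2l (ltn0Sn m)); apply/eqP.
  rewrite mulnCA -h2 -!muln2; ring.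
rewrite -(@leq_pmul2l (m.+1 ^ 2)); last by rewrite expn_gt0.
rewrite [X in (X <= _)%N]mulnA -[X in (X * _ <= _)%N]expnMn E [(16 ^ _)%N]expnS.
set a := 'C(_, _) in IH *; set w := (16 ^ m)%N in IH *.
have -> : ((2 * m.*2.+1 * a) ^ 2 * m.+1.*2.+1 =
          (a ^ 2 * m.*2.+1) * (4 * m.*2.+1 * m.+1.*2.+1))%N by ring.
apply: (leq_trans (leq_mul IH (leqnn _))).
rewrite [leqRHS]mulnA [leqRHS]mulnC leq_mul2l; apply/orP; right.
by rewrite -!muln2; lia.
Qed.

(** In probabilistic form: no atom of a symmetric binomial law of size n exceeds (n+1)^(-1/2). An
    odd row reduces to the next row, whose central coefficient is twice its middle one. *)
Lemma bin_sqr n j : ('C(n, j) ^ 2 * n.+1 <= 4 ^ n)%N.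
Proof.
apply: (@leq_trans ('C(n, n./2) ^ 2 * n.+1)).
  by rewrite leq_mul2r leq_sqr leq_bin_half orbT.
have E4 m : (4 ^ m.*2 = 16 ^ m)%N by rewrite -mul2n expnM.
case: (boolP (odd n)) => on; last first.
  have -> : n = n./2.*2 by lia.
  by rewrite doubleK E4 central_bin_sqr.
have {on}-> : n = n./2.*2.+1 by lia.
set m := n./2; have -> : (m.*2.+1)./2 = m by lia.
have := central_bin_sqr m.+1.
have -> : ('C(m.+1.*2, m.+1) = 2 * 'C(m.*2.+1, m))%N.
  have e : (m.*2.+1 - m.+1 = m)%N by lia.
  have := @bin_sub m.*2.+1 m.+1; rewrite e => h.
  by rewrite doubleS [LHS]binS -h; lia.
rewrite [(4 ^ _)%N]expnS E4 [(16 ^ _)%N]expnS expnMn.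
move: (16 ^ m)%N ('C(_, _) ^ 2)%N => w c; rewrite -!muln2; nia.
Qed.

(** Beyond the middle the coefficients decrease, so [j - n./2] copies of ['C(n, j)] fit under the
    row sum 2^n. This first-order tail bound is all that the estimates far from the kink call
    for. *)
Lemma bin_far_up n j : (n <= j.*2)%N ->
  ('C(n, j) * (j.*2 - n) <= 2 * 2 ^ n)%N.
Proof.
move=> nj; have [jn|jn] := ltnP n j; first by rewrite bin_small.
have down i : (n <= i.*2)%N -> ('C(n, i.+1) <= 'C(n, i))%N.
  move=> hi; rewrite -(leq_pmul2l (ltn0Sn i)) mul_bin_left leq_mul2r.
  by apply/orP; right; lia.
have mono m i : (n <= i.*2)%N -> ('C(n, i + m) <= 'C(n, i))%N.
  elim: m => [|m IH] hi; first by rewrite addn0.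
  rewrite addnS (leq_trans (down _ _)) ?IH//; lia.
suff : ('C(n, j) * (j - n./2) <= 2 ^ n)%N by nia.
have -> : (2 ^ n = \sum_(i < n.+1) 'C(n, i))%N.
  rewrite -[2%N]/(1 + 1)%N expnDn; apply: eq_bigr => i _.
  by rewrite !exp1n !muln1.
rewrite -(big_mkord predT (fun i => 'C(n, i))).
rewrite (@big_cat_nat _ _ _ n./2.+1)//=; last by lia.
rewrite (@big_cat_nat _ _ _ j.+1 n./2.+1)//=; last by lia.
apply: leq_trans (leq_addl _ _); apply: leq_trans (leq_addr _ _).
have -> : ('C(n, j) * (j - n./2) = \sum_(n./2.+1 <= i < j.+1) 'C(n, j))%N.
  by rewrite sum_nat_const_nat subSS mulnC.
rewrite !big_nat; apply: leq_sum => i /andP[i1 i2].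
have -> : j = (i + (j - i))%N by lia.
by apply: mono; lia.
Qed.

(** * The tree recursion and the hitting kernel of its walk *)

Section binomial_tree.
Context {R : realType}.
Implicit Types (u v g : R -> R) (x y z : R) (n m : nat).

(** One discounted step with drift [b * k] and jumps [h], [- h] of probability 1/2. It acts on
    functions on the whole line, so the drift does not call for a moving lattice. *)
Definition tree_step (r b k h : R) u x : R :=
  expR (- (r * k)) * ((u (x + b * k + h) + u (x + b * k - h)) / 2).

Fixpoint tree_value (r b k h : R) g n : R -> R :=
  if n is m.+1 then
    fun x => Num.max (g x) (tree_step r b k h (tree_value r b k h g m) x)
  else g.

(** The undiscounted probability that the walk started at [x] sits, after [n] steps, at a point
    whose two successors lie strictly on either side of [l]. *)
Fixpoint walk_kernel (b k h l : R) n : R -> R :=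
  if n is m.+1 then fun x => (walk_kernel b k h l m (x + b * k + h) +
    walk_kernel b k h l m (x + b * k - h)) / 2
  else fun x => (`|x + b * k - l| < h)%R%:R.

(** Endpoints of the walk are spaced by [2 * h] and the target is an open interval of that length,
    so at most one endpoint falls in it and the kernel reduces to a single binomial weight. *)
Lemma walk_kernel_le (b k h l : R) n x : 0 < h -> walk_kernel b k h l n x <= 0 \/
  exists j, `|x + b * k *+ n.+1 + (j%:R *+ 2 - n%:R) * h - l| < h /\
    walk_kernel b k h l n x <= 'C(n, j)%:R / 2 ^+ n.
Proof.
move=> h0; elim: n x => [|n IH] x.
  rewrite /=; case: ltP => hx; [right; exists 0%N|by left].
  by rewrite mulr1n mulr0n mul0rn subrr mul0r addr0 bin0 expr0 divr1; split.
set w := walk_kernel _ _ _ _.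
have P2 : 0 < (2 : R) ^+ n by rewrite exprn_gt0.
have ws : w n.+1 x = (w n (x + b * k + h) + w n (x + b * k - h)) / 2 by [].
have bge j : 0 <= ('C(n, j)%:R / 2 ^+ n : R) by rewrite divr_ge0// ltW.
have bS j : ('C(n.+1, j.+1)%:R / 2 ^+ n.+1 : R) =
    ('C(n, j)%:R / 2 ^+ n + 'C(n, j.+1)%:R / 2 ^+ n) / 2.
  by rewrite binS natrD exprS; field; rewrite gt_eqF.
have bS' j : ('C(n, j)%:R / 2 ^+ n) / 2 <= ('C(n.+1, j)%:R / 2 ^+ n.+1 : R).
  case: j => [|j]; first by rewrite !bin0 exprS invfM; lra.
  by have := bge j; have := bge j.+1; rewrite bS; lra.
have shift (s : R) (j i : nat) : s = (i%:R *+ 2 - n.+1%:R - (j%:R *+ 2 - n%:R)) * h ->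
    x + b * k + s + b * k *+ n.+1 + (j%:R *+ 2 - n%:R) * h - l =
    x + b * k *+ n.+2 + (i%:R *+ 2 - n.+1%:R) * h - l.
  by move=> ->; rewrite [b * k *+ n.+2]mulrS; ring.
have up j : x + b * k + h + b * k *+ n.+1 + (j%:R *+ 2 - n%:R) * h - l =
    x + b * k *+ n.+2 + (j.+1%:R *+ 2 - n.+1%:R) * h - l.
  by apply: shift; rewrite -!natr1; ring.
have dn j : x + b * k - h + b * k *+ n.+1 + (j%:R *+ 2 - n%:R) * h - l =
    x + b * k *+ n.+2 + (j%:R *+ 2 - n.+1%:R) * h - l.
  by apply: shift; rewrite -!natr1; ring.
have [h1|[j [j1 h1]]] := IH (x + b * k + h);
have [h2|[i [i1 h2]]] := IH (x + b * k - h).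
- by left; rewrite ws; rewrite -/w in h1 h2; lra.
- right; exists i; rewrite -dn; split=> //.
  by have := bS' i; rewrite ws; rewrite -/w in h1 h2; lra.
- right; exists j.+1; rewrite -up; split=> //.
  by have := bge j.+1; rewrite ws bS; rewrite -/w in h1 h2; lra.
- right; exists j.+1; rewrite -up; split=> //.
  (* Both branches reach the target: their endpoints are less than [2 * h] apart, hence equal, and
     Pascal's rule adds the two weights. *)
  suff ij : i = j.+1 by rewrite ws bS -ij; rewrite -/w in h1 h2; lra.
  move: i1 j1; rewrite up dn !ltr_norml => /andP[a1 a2] /andP[a3 a4].
  have : (j.+1%:R - i%:R) * h < 1 * h by lra.
  have : (i%:R - j.+1%:R) * h < 1 * h by lra.
  rewrite !ltr_pM2r// !ltrBlDr -!(natrD R 1%N) !ltr_nat; lia.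
Qed.

Lemma walk_kernel_sqrt (b k h l : R) n x : 0 < h ->
  walk_kernel b k h l n x <= (Num.sqrt n.+1%:R)^-1.
Proof.
move=> h0; have s0 : 0 < Num.sqrt (n.+1%:R : R) by rewrite sqrtr_gt0.
have [H|[j [_ H]]] := walk_kernel_le b k l n x h0.
  by rewrite (le_trans H)// invr_ge0 ltW.
rewrite (le_trans H)// ler_pdivrMr ?exprn_gt0// ler_pdivlMl//.
rewrite -(@ler_pXn2r _ 2) ?nnegrE ?mulr_ge0 ?exprn_ge0 ?(ltW s0)//.
rewrite exprMn sqr_sqrtr// -exprM mulnC exprM -[2 ^+ 2]/(2 * 2) -natrM.
by rewrite -!natrX -natrM ler_nat mulnC bin_sqr.
Qed.

(** To reach the target the walk must be displaced by [|2j - n| * h >= d], and the tail bound makes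
    the weight of such a [j] at most [2 / |2j - n|]. The lower tail follows by the symmetry between
    [j] and [n - j]. *)
Lemma walk_kernel_far (b k h l d : R) n x : 0 < h -> 0 < d ->
  d + h <= `|x + b * k *+ n.+1 - l| -> walk_kernel b k h l n x <= 2 * h / d.
Proof.
move=> h0 d0 hd.
have [H|[j [hj H]]] := walk_kernel_le b k l n x h0.
  by rewrite (le_trans H)// divr_ge0// ?mulr_ge0// ltW.
rewrite (le_trans H)// ler_pdivrMr ?exprn_gt0// mulrAC ler_pdivlMr//.
have dj : d <= `|j%:R *+ 2 - n%:R| * h.
  rewrite -[X in _ * X](gtr0_norm h0) -normrM.
  set a := x + _ in hd hj; set c := _ * h in hj *.
  have : `|a - l| <= `|a + c - l| + `|c|.
    by rewrite (_ : a - l = a + c - l - c) ?ler_normB//; ring.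
  by move: hd hj; lra.
have bnd : ('C(n, j)%:R * `|j%:R *+ 2 - n%:R| : R) <= 2 * 2 ^+ n.
  have [nj|nj] := leqP n j.*2.
    rewrite -mulrnA muln2 -natrB//.
    by rewrite ger0_norm// -natrX -!natrM ler_nat; exact: bin_far_up.
  have [jn|jn] := leqP j n; last by rewrite bin_small// mul0r mulr_ge0// exprn_ge0.
  rewrite distrC -mulrnA muln2 -natrB; last exact: ltnW.
  rewrite ger0_norm// -natrX -!natrM ler_nat -bin_sub//.
  have := @bin_far_up n (n - j); rewrite doubleB; have -> : (n.*2 - j.*2 - n = n - j.*2)%N by lia.
  by apply; lia.
apply: (le_trans (ler_wpM2l _ dj)) => //.
by rewrite mulrA [leRHS]mulrAC ler_wpM2r// ltW.
Qed.

Section value.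
Context (r b k h : R) (g : R -> R).
Context (k0 : 0 <= k) (r0 : 0 <= r).
Let A := tree_step r b k h.
Let u := tree_value r b k h g.
Let D := expR (- (r * k)).

Let D0 : 0 < D. Proof. exact: expR_gt0. Qed.
Let D1 : D <= 1.
Proof. by rewrite -expR0 ler_expR oppr_le0 mulr_ge0. Qed.

Let Aeq v x : A v x = D * ((v (x + b * k + h) + v (x + b * k - h)) / 2).
Proof. by []. Qed.

Lemma tree_step_le v w x : (forall y, v y <= w y) -> A v x <= A w x.
Proof.
move=> vw; rewrite !Aeq ler_pM2l// ler_pM2r ?invr_gt0//.
by rewrite lerD.
Qed.

Lemma tree_stepB v w x : A (fun y => v y - w y) x = A v x - A w x.
Proof. by rewrite !Aeq; field. Qed.

Lemma tree_step_cst_le (c : R) x : 0 <= c -> A (fun=> c) x <= c.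
Proof. by move=> c0; rewrite Aeq (_ : (c + c) / 2 = c) ?ler_piMl//; field. Qed.

Lemma tree_stepS n x : u n.+1 x = Num.max (g x) (A (u n) x). Proof. by []. Qed.

Lemma tree_obstacle_le n x : g x <= u n x.
Proof. by case: n => [|n]//; rewrite tree_stepS le_max lexx. Qed.

Lemma tree_step_le_value n x : A (u n) x <= u n.+1 x.
Proof. by rewrite tree_stepS le_max lexx orbT. Qed.

Lemma tree_le_bound M : 0 <= M -> (forall x, g x <= M) -> forall n x, u n x <= M.
Proof.
move=> M0 gM; elim=> [|n IH] x; first exact: gM.
rewrite tree_stepS ge_max gM/=.
exact: le_trans (tree_step_le _ IH) (tree_step_cst_le _ M0).
Qed.

Lemma tree_nondecreasing n x : u n x <= u n.+1 x.
Proof.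
elim: n x => [|n IH] x; first exact: tree_obstacle_le.
rewrite (tree_stepS n) ge_max tree_obstacle_le/=.
by rewrite (le_trans _ (tree_step_le_value _ _))// tree_step_le.
Qed.

Lemma tree_homo x : {homo u ^~ x : n m / (n <= m)%N >-> n <= m}.
Proof. by apply: homo_leq => // [? ? ?|n]; [exact: le_trans|exact: tree_nondecreasing]. Qed.

(* A majorant of the increments of [g] of the form [f y - f x] is inherited by
   the tree as soon as [f] is a supersolution. *)
Lemma tree_increment_le (f : R -> R) : {homo f : x y / x <= y} ->
  {homo g : x y / x <= y} ->
  (forall x y, x <= y -> A f y - A f x <= f y - f x) ->
  (forall x y, x <= y -> g y - g x <= f y - f x) ->
  forall n x y, x <= y -> 0 <= u n y - u n x <= f y - f x.
Proof.
move=> ndf ndg Af gf; elim=> [|n IH] x y xy.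
  by rewrite gf// subr_ge0 ndg.
have HA : 0 <= A (u n) y - A (u n) x <= f y - f x.
  have e1 : x + b * k + h <= y + b * k + h by lra.
  have e2 : x + b * k - h <= y + b * k - h by lra.
  have /andP[a1 a2] := IH _ _ e1; have /andP[a3 a4] := IH _ _ e2.
  apply/andP; split.
    by rewrite subr_ge0 !Aeq ler_pM2l//; lra.
  apply: le_trans (Af _ _ xy).
  rewrite -subr_ge0 !Aeq; set lhs := (X in 0 <= X).
  have -> : lhs = D * ((f (y + b * k + h) - f (x + b * k + h) - (u n (y + b * k + h) - u n (x + b * k + h)) +
    (f (y + b * k - h) - f (x + b * k - h) - (u n (y + b * k - h) - u n (x + b * k - h)))) / 2).
    by rewrite /lhs; field.
  by rewrite mulr_ge0// ?(ltW D0)//; lra.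
have := ndg _ _ xy; have := gf _ _ xy; move: HA => /andP[].
rewrite !tree_stepS; move: (A (u n) y) (A (u n) x) => Ay Ax a1 a2 a3 a4.
by apply/andP; split; case: (leP (g y) Ay) => ?; case: (leP (g x) Ax) => ?; lra.
Qed.

(** The increments in [n] form a subsolution of the walk, since the maximum is nonexpansive and the
    discount at most 1, while [walk_kernel] solves the undiscounted recursion exactly. A bound on
    the first step is therefore transported. *)
Lemma tree_diff_le (C E l : R) : 0 <= C -> 0 <= E ->
  (forall x, A g x - g x <= C + E * walk_kernel b k h l 0 x) ->
  forall n x, u n.+1 x - u n x <= C + E * walk_kernel b k h l n x.
Proof.
move=> C0 E0 H0.
have w0 n x : 0 <= walk_kernel b k h l n x.
  elim: n x => [|n IH] x /=; first by rewrite ler0n.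
  by rewrite divr_ge0// addr_ge0.
elim=> [|n IH] x.
  have -> : u 1 x = Num.max (g x) (A g x) by [].
  have -> : u 0 x = g x by [].
  move: (H0 x) (mulr_ge0 E0 (w0 0 x)); move: (A g x) (E * _) => a e h1 h2.
  by case: (leP (g x) a) => ?; lra.
have HA : A (u n.+1) x - A (u n) x <= C + E * walk_kernel b k h l n.+1 x.
  rewrite -tree_stepB Aeq /=.
  have a1 := IH (x + b * k + h); have a2 := IH (x + b * k - h).
  have b1 := w0 n (x + b * k + h); have b2 := w0 n (x + b * k - h).
  set w1 := walk_kernel _ _ _ _ _ _ in a1 b1 *.
  set w2 := walk_kernel _ _ _ _ _ _ in a2 b2 *.
  apply: (@le_trans _ _ (D * (C + E * ((w1 + w2) / 2)))).
    by rewrite ler_pM2l//; move: w1 w2 a1 a2 {b1 b2} => w1 w2; lra.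
  rewrite ler_piMl// addr_ge0// mulr_ge0// divr_ge0// addr_ge0//.
rewrite (tree_stepS n.+1) (tree_stepS n).
move: HA (mulr_ge0 E0 (w0 n.+1 x)).
move: (A (u n.+1) x) (A (u n) x) (E * _) => a1 a2 e h1 h2.
by case: (leP (g x) a1) => ?; case: (leP (g x) a2) => ?; lra.
Qed.

(* With the increments of [u] in [x] controlled, the step [x + b k] and the
   discount only cost O(k). *)
Lemma tree_second_diff_up (L M : R) : 0 <= M -> (forall x, 0 <= g x <= M) ->
  (forall n x y, `|u n x - u n y| <= L * `|x - y|) ->
  forall n x, u n (x + h) - 2 * u n x + u n (x - h) <=
  2 * (u n.+1 (x - b * k) - u n (x - b * k)) +
    2 * (expR (r * k) - 1) * M + 2 * L * `|b * k|.
Proof.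
move=> M0 gM lip n x.
have DE : expR (r * k) * D = 1 by rewrite -expRD subrr expR0.
have E1 : 1 <= expR (r * k) by rewrite -expR0 ler_expR mulr_ge0.
have := tree_step_le_value n (x - b * k); rewrite Aeq !subrK => H.
have uM : u n.+1 (x - b * k) <= M by apply: tree_le_bound => // y; case/andP: (gM y).
have H1 : (u n (x + h) + u n (x - h)) / 2 <= expR (r * k) * u n.+1 (x - b * k).
  by rewrite -[leLHS]mul1r -[X in X * _]DE -mulrA ler_pM2l ?expR_gt0.
have H2 : (expR (r * k) - 1) * u n.+1 (x - b * k) <= (expR (r * k) - 1) * M.
  by rewrite ler_wpM2l// subr_ge0.
have e : x - b * k - x = - (b * k) by ring.
have := lip n (x - b * k) x; rewrite e normrN ler_norml => /andP[a1 a2].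
by lra.
Qed.

(** Compare [u n] with [u n.+1] at [x - b * k], by monotonicity in [n]. If the continuation value
    attains the maximum there, it bounds [u n] by the mean of the neighbours. If the obstacle does,
    [u n] touches [g] and inherits its midpoint convexity. Moving from [x - b * k] to [x] costs
    O(k). *)
Lemma tree_second_diff_lo (L xb : R) : 0 <= L -> (forall x, 0 <= g x) ->
  (forall n x y, `|u n x - u n y| <= L * `|x - y|) ->
  (forall x, x + h <= xb -> 2 * g x <= g (x + h) + g (x - h)) ->
  forall n x, x + h <= xb ->
  - (4 * L * `|b * k|) <= u n (x + h) - 2 * u n x + u n (x - h).
Proof.
move=> L0 gp lip cvx n x xh.
have DE : expR (r * k) * D = 1 by rewrite -expRD subrr expR0.
have E1 : 1 <= expR (r * k) by rewrite -expR0 ler_expR mulr_ge0.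
have e : x - b * k - x = - (b * k) by ring.
have := lip n (x - b * k) x; rewrite e normrN ler_norml => /andP[a1 a2].
have := lip 0%N (x - b * k) x; rewrite e normrN ler_norml => /andP[b1 b2].
have Lb : 0 <= L * `|b * k| by rewrite mulr_ge0.
have ug m y : 0 <= u m y by exact: le_trans (gp y) (tree_obstacle_le m y).
have := tree_nondecreasing n (x - b * k).
rewrite tree_stepS Aeq !subrK; set s := (_ + _) / 2.
have s0 : 0 <= s by rewrite divr_ge0// addr_ge0.
have Ds : D * s <= s by rewrite ler_piMl.
case: (leP (g (x - b * k)) (D * s)) => H nd; first by move: (le_trans nd Ds); rewrite /s; clear -a1 a2 Lb; lra.
have o1 := tree_obstacle_le n (x + h); have o2 := tree_obstacle_le n (x - h).
have o3 := cvx x xh.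
have g0 y : u 0 y = g y by [].
by move: b1 b2; rewrite !g0; clear -a1 a2 Lb o1 o2 o3 H nd; lra.
Qed.

End value.
End binomial_tree.

(** * The truncated obstacle and its scheme *)

Lemma MVT_global {R : realType} (f df : R -> R) (a b : R) : a <= b ->
  (forall x : R, is_derive x 1 f (df x)) ->
  exists2 c, a <= c <= b & f b - f a = df c * (b - a).
Proof.
move=> ab dfP; have [|c cab ->] := @MVT_segment R f df a b ab (fun x _ => dfP x).
- apply: continuous_subspaceT => x.
  by apply: differentiable_continuous; apply/derivable1_diffP; have [] := dfP x.
- by exists c => //; move: cab; rewrite in_itv.
Qed.

(** The function [expR (h - h^2/2) + expR (- h - h^2/2)] equals 2 at 0 and decreases for [h >= 0],
    because [expR h * (1 - h) <= expR (- h) * (1 + h)]. *)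
Lemma cosh_le_exp_sqr {R : realType} (h : R) : 0 <= h -> h <= 1 ->
  (expR h + expR (- h)) / 2 <= expR (h ^+ 2 / 2).
Proof.
move=> h0 h1.
have s_ge0 (x : R) : 0 <= x -> expR x * (1 - x) <= expR (- x) * (1 + x).
  move=> x0.
  have D (y : R) : is_derive y 1 (fun x => expR (- x) * (1 + x) - expR x * (1 - x))
      (y * (expR y - expR (- y))).
    by apply: is_derive_eq; rewrite /GRing.scale /=; ring.
  have [c /andP[c0 _] E] := MVT_global x0 D.
  have : 0 <= c * (expR c - expR (- c)) * (x - 0).
    by rewrite !mulr_ge0// subr_ge0 ?ler_expR; lra.
  by rewrite -E oppr0 expR0; lra.
have D (y : R) : is_derive y 1 (fun x => expR (x - x ^+ 2 / 2) + expR (- x - x ^+ 2 / 2))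
    ((expR y * (1 - y) - expR (- y) * (1 + y)) * expR (- (y ^+ 2 / 2))).
  by apply: is_derive_eq; rewrite !expRD /GRing.scale /=; field.
have [c /andP[c0 _] E] := MVT_global h0 D.
have : (expR c * (1 - c) - expR (- c) * (1 + c)) * expR (- (c ^+ 2 / 2)) * (h - 0) <= 0.
  rewrite subr0 mulr_le0_ge0// mulr_le0_ge0 ?expR_ge0//.
  by rewrite subr_le0 s_ge0.
rewrite -E expr0n /= mul0r !subr0 oppr0 expR0 !expRD expRN.
rewrite -mulrDl subr_le0 ler_pdivrMr ?expR_gt0//; lra.
Qed.

Definition obstacle {R : realType} (K1 k1 K2 x : R) : R :=
  Num.min (psi1 K1 k1 K2 x) (K2 - K1).

Section obstacle_theory.
Context {R : realType} (K1 k1 k2 K2 : R).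
Context (hK1 : 0 < K1) (hK1k1 : K1 < k1) (hk1k2 : k1 < k2) (hk2K2 : k2 < K2).
Implicit Types x y : R.
Let g := obstacle K1 k1 K2.

Local Ltac params := move: (hK1) (hK1k1) (hk1k2) (hk2K2) => ? ? ? ?.

Let k1_gt0 : 0 < k1. Proof. by params; lra. Qed.

Lemma obstacle_lb x : K2 - k1 <= g x.
Proof.
params.
rewrite /g /obstacle /psi1; case: (leP (expR x - K1) 0) => ?;
  by rewrite le_min; apply/andP; split; lra.
Qed.

Lemma obstacle_ge0 x : 0 <= g x.
Proof.
params. by have := obstacle_lb x; lra. Qed.

Lemma obstacle_ub x : g x <= K2 - K1.
Proof. by rewrite /g /obstacle ge_min lexx orbT. Qed.

Lemma obstacle_right x : ln k1 <= x -> g x = K2 - K1.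
Proof.
params.
move=> kx; have : k1 <= expR x by rewrite -[leLHS]lnK ?posrE// ler_expR.
by move=> ?; rewrite /g /obstacle /psi1; case: (leP (expR x - K1) 0) => ?;
  rewrite minEle; case: (leP (_ + K2 - k1)); lra.
Qed.

Lemma obstacle_left x : x <= ln k1 -> g x = psi1 K1 k1 K2 x.
Proof.
params.
move=> kx; have : expR x <= k1 by rewrite -[leRHS]lnK ?posrE// ler_expR.
by move=> ?; rewrite /g /obstacle /psi1; case: (leP (expR x - K1) 0) => ?;
  rewrite minEle; case: (leP (_ + K2 - k1)); lra.
Qed.

Lemma obstacle_increment x y : x <= y -> 0 <= g y - g x <= expR y - expR x.
Proof.
params.
rewrite -ler_expR /g /obstacle /psi1 => xy.
have mc (c d : R) : (Num.min c d = c /\ c <= d) \/ (Num.min c d = d /\ d <= c).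
  by case: (leP c d) => [|/ltW] ?; [left|right].
have : 0 <= Num.max (expR y - K1) 0 - Num.max (expR x - K1) 0 <= expR y - expR x.
  by apply/andP; split; case: (leP (expR x - K1) 0) => ?;
    case: (leP (expR y - K1) 0) => ?; lra.
move: (Num.max (expR y - K1) 0) (Num.max (expR x - K1) 0) => my mx /andP[? ?].
by apply/andP; split; have [[-> ?]|[-> ?]] := mc (my + K2 - k1) (K2 - K1);
  have [[-> ?]|[-> ?]] := mc (mx + K2 - k1) (K2 - K1); lra.
Qed.

Lemma obstacle_midconvex (h x : R) : 0 <= h -> x + h <= ln k1 ->
  2 * g x <= g (x + h) + g (x - h).
Proof.
params.
move=> h0 xh; rewrite !obstacle_left; [|lra..].
have ec : 2 * expR x <= expR (x + h) + expR (x - h).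
  have e : expR x * expR (- h) * expR h = expR x by rewrite -mulrA -expRD addNr expR0 mulr1.
  have := sqr_ge0 (expR h - 1); have := expR_gt0 x; have := expR_gt0 (- h) => a1 a2 a3.
  have := mulr_ge0 (mulr_ge0 (ltW a2) (ltW a1)) a3.
  rewrite !expRD; set a := expR x in e *; set c := expR h in e *.
  set d := expR (- h) in e *.
  have -> : a * d * (c - 1) ^+ 2 = a * d * c * c - 2 * (a * d * c) + a * d by ring.
  by rewrite e; lra.
rewrite /psi1; case: (leP (expR x - K1) 0) => ?;
  by case: (leP (expR (x + h) - K1) 0) => ?; case: (leP (expR (x - h) - K1) 0) => ?; lra.
Qed.

(** Increments of [expR] have slope at most [k1] up to [ln k1], and [f] is constant from there on;
    hence one global Lipschitz constant. *)
Lemma increment_lip (f : R -> R) : (forall x, ln k1 <= x -> f x = K2 - K1) ->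
  (forall x y, x <= y -> 0 <= f y - f x <= expR y - expR x) ->
  forall x y, `|f x - f y| <= k1 * `|x - y|.
Proof.
move=> fr fi.
have H x y : x <= y -> y <= ln k1 -> f y - f x <= k1 * (y - x).
  move=> xy yk; have /andP[_ h] := fi _ _ xy; apply: (le_trans h).
  have ey : expR y <= k1 by rewrite -[leRHS]lnK ?posrE// ler_expR.
  have e1 : expR y * (1 + (x - y)) <= expR x.
    rewrite [leRHS](_ : _ = expR y * expR (x - y)); last by rewrite -expRD addrC subrK.
    by rewrite ler_pM2l ?expR_gt0// expR_ge1Dx.
  have : expR y * (y - x) <= k1 * (y - x) by rewrite ler_wpM2r// subr_ge0.
  by move: e1; lra.
have K x y : x <= y -> 0 <= f y - f x <= k1 * (y - x).
  move=> xy; have /andP[-> _] := fi _ _ xy; rewrite /=.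
  have [yk|ky] := leP y (ln k1); first exact: H.
  rewrite (fr y) ?(ltW ky)//; have [xk|kx] := leP x (ln k1).
    rewrite -(fr (ln k1))//; apply: (le_trans (H _ _ xk (lexx _))).
    by rewrite ler_wpM2l ?(ltW k1_gt0)//; lra.
  by rewrite (fr x) ?(ltW kx)// subrr mulr_ge0 ?(ltW k1_gt0)//; lra.
move=> x y; have [xy|/ltW xy] := leP x y.
  rewrite distrC (distrC x) (ger0_norm (x := y - x)) ?subr_ge0//.
  by have /andP[a b] := K _ _ xy; rewrite ger0_norm.
rewrite (ger0_norm (x := x - y)) ?subr_ge0//.
by have /andP[a b] := K _ _ xy; rewrite ger0_norm.
Qed.

Context (sigma r q : R) (hsigma : 0 < sigma) (hr : 0 < r) (hq : 0 <= q).
Let b := r - q - sigma ^+ 2 / 2.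

(** With this drift and [sigma^2 * k = h^2] the factor is at most [expR (- (q * k))]. So [0 <= q]
    makes [expR] a supersolution of the tree, and a majorant of increments in [x]. *)
Lemma tree_step_exp (h : R) : 0 <= h -> h <= 1 ->
  exists2 al : R, 0 <= al <= 1 & forall x : R, tree_step r b (h ^+ 2 / sigma ^+ 2) h (@expR R) x = al * expR x.
Proof.
move=> h0 h1; set k := _ / _.
exists (expR (- (r * k)) * expR (b * k) * ((expR h + expR (- h)) / 2)); last first.
  by move=> y; rewrite /tree_step !expRD; ring.
rewrite !mulr_ge0 ?expR_ge0 ?divr_ge0 ?addr_ge0 ?expR_ge0//=.
have c := cosh_le_exp_sqr h0 h1.
apply: (le_trans (ler_wpM2l _ c)); first by rewrite mulr_ge0 ?expR_ge0.
rewrite -!expRD -[leRHS]expR0 ler_expR.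
have -> : - (r * k) + b * k + h ^+ 2 / 2 = - (q * k).
  by rewrite /b /k; field; rewrite gt_eqF.
by rewrite oppr_le0 mulr_ge0// divr_ge0// exprn_ge0// ltW.
Qed.

(** Left of the kink [g] sits at its minimum and a step cannot gain. Right of it [g] lies below
    [expR] plus a constant, and a step gains at most the discount on that constant, of order [k].
    Only when the successors straddle [ln K1] can the gain be of order [h]. *)
Lemma obstacle_step (h : R) (k := h ^+ 2 / sigma ^+ 2) x : 0 < h -> h <= 1 ->
  tree_step r b k h g x - g x <= r * `|K2 - k1 - K1| * k +
    k1 * (`|b| / sigma ^+ 2 + 1) * h * walk_kernel b k h (ln K1) 0 x.
Proof.
params.
move=> h0 h1.
have s2 : 0 < sigma ^+ 2 by rewrite exprn_gt0.
have kk : 0 <= k by exact: divr_ge0 (exprn_ge0 _ (ltW h0)) (ltW s2).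
have rk : 0 <= r * k := mulr_ge0 (ltW hr) kk.
have [al /andP[al0 al1] Ae] := tree_step_exp (ltW h0) h1.
have := Ae x; rewrite /tree_step /= -/k.
set D := expR _; have D0 : 0 < D by exact: expR_gt0.
have D1 : D <= 1 by rewrite /D -expR0 ler_expR oppr_le0.
have Dk : 1 - r * k <= D by exact: expR_ge1Dx.
set xp := x + b * k + h; set xm := x + b * k - h => AE.
have M0 : 0 <= K2 - K1 by lra.
have c0 : 0 <= r * `|K2 - k1 - K1| * k
  by exact: mulr_ge0 (mulr_ge0 (ltW hr) (normr_ge0 _)) kk.
have c0' : 0 <= k1 * (`|b| / sigma ^+ 2 + 1) * h.
  by rewrite mulr_ge0 ?(ltW h0)// mulr_ge0 ?(ltW k1_gt0)// addr_ge0// divr_ge0// ltW.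
have w0 : 0 <= (`|x + b * k - ln K1| < h)%R%:R :> R by rewrite ler0n.
have gp : 0 <= g xp by exact: obstacle_ge0.
have gm : 0 <= g xm by exact: obstacle_ge0.
have gx : 0 <= g x by exact: obstacle_ge0.
have Dle (s : R) : 0 <= s -> D * s <= s by move=> s0; rewrite ler_piMl.
case: ltP => hx; last first.
  rewrite mulr0 addr0.
  have [xl|lx] := leP (x + b * k) (ln K1).
  - rewrite ler0_norm in hx; last by rewrite subr_le0.
    have gl (y : R) : y <= ln K1 -> g y = K2 - k1.
      move=> yl; have : expR y <= K1 by rewrite -[leRHS]lnK ?posrE// ler_expR.
      rewrite obstacle_left; last first.
        by rewrite (le_trans yl)// ler_ln ?posrE// ltW.
      by rewrite /psi1; case: (leP (expR y - K1) 0); lra.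
    have [e1 e2] : xm <= ln K1 /\ xp <= ln K1 by rewrite /xp /xm; split; lra.
    rewrite (gl _ e1) (gl _ e2).
    have := obstacle_lb x; have := Dle (K2 - k1); rewrite -/g.
    have -> : (K2 - k1 + (K2 - k1)) / 2 = K2 - k1 by field.
    by lra.
  - rewrite gtr0_norm in hx; last by rewrite subr_gt0.
    have gE (y : R) : ln K1 <= y -> g y <= expR y + (K2 - k1 - K1).
      move=> yl; have : K1 <= expR y by rewrite -[leLHS]lnK ?posrE// ler_expR.
      by rewrite /g /obstacle /psi1 ge_min; case: (leP (expR y - K1) 0) => ? ?;
        apply/orP; left; lra.
    have gxE : Num.min (expR x + (K2 - k1 - K1)) (K2 - K1) <= g x.
      rewrite /g /obstacle /psi1 le_min !ge_min lexx orbT andbT.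
      by case: (leP (expR x - K1) 0) => ?; apply/orP; left; lra.
    have [e1 e2] : ln K1 <= xm /\ ln K1 <= xp by rewrite /xp /xm; split; lra.
    have := gE _ e1; have := gE _ e2; have := obstacle_ub xp; have := obstacle_ub xm.
    rewrite -/g => u1 u2 u3 u4.
    have B1 : D * ((g xp + g xm) / 2) <= K2 - K1.
      by apply: (le_trans (Dle _ _)); lra.
    have B2 : D * ((g xp + g xm) / 2) <= expR x + D * (K2 - k1 - K1).
      have : D * ((g xp + g xm) / 2) <= D * ((expR xp + expR xm) / 2 + (K2 - k1 - K1)).
        by rewrite ler_pM2l//; lra.
      by rewrite mulrDr AE; have := ler_piMl (expR_ge0 x) al1; lra.
    (* The constant may be negative; discounting then raises it, by at most [r * k] times its
       absolute value. *)
    have B3 : D * (K2 - k1 - K1) <= (K2 - k1 - K1) + r * `|K2 - k1 - K1| * k.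
      have [cn|cp] := leP (K2 - k1 - K1) 0; last first.
        by have := Dle _ (ltW cp); lra.
      rewrite ler0_norm//.
      have : (1 - D) * - (K2 - k1 - K1) <= r * k * - (K2 - k1 - K1).
        by rewrite ler_wpM2r//; lra.
      by lra.
    move: gxE; case: (leP (expR x + (K2 - k1 - K1)) (K2 - K1)) => _ gxE.
      by clear -gxE B2 B3; lra.
    by clear -gxE B1 c0; lra.
(* Straddling case: both successors are within [|b| * k + h] of [x], and [k <= h / sigma^2] because
   [h <= 1]. *)
rewrite mulr1; apply: (le_trans _ (y := k1 * (`|b| / sigma ^+ 2 + 1) * h)); last by lra.
have lip y : `|g y - g x| <= k1 * `|y - x|.
  by apply: increment_lip => //; [exact: obstacle_right|exact: obstacle_increment].
have B y : `|y - x| <= `|b| * k + h -> g y <= g x + k1 * (`|b| * k + h).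
  move=> hy; have := lip y; rewrite ler_norml => /andP[_ l1].
  by have := ler_wpM2l (ltW k1_gt0) hy; lra.
have nb : `|b * k| = `|b| * k by rewrite normrM (ger0_norm kk).
have Bp : g xp <= g x + k1 * (`|b| * k + h).
  apply: B; rewrite /xp -nb; have -> : x + b * k + h - x = b * k + h by ring.
  by apply: (le_trans (ler_normD _ _)); rewrite (gtr0_norm h0).
have Bm : g xm <= g x + k1 * (`|b| * k + h).
  apply: B; rewrite /xm -nb; have -> : x + b * k - h - x = b * k - h by ring.
  by apply: (le_trans (ler_normB _ _)); rewrite (gtr0_norm h0).
have kh : k <= h / sigma ^+ 2.
  by rewrite /k ler_pM2r ?invr_gt0// expr2 ler_piMl// ltW.
have : k1 * (`|b| * k + h) <= k1 * (`|b| / sigma ^+ 2 + 1) * h.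
  rewrite -mulrA ler_pM2l// mulrDl mul1r lerD2r mulrAC -mulrA ler_wpM2l//.
have := Dle ((g xp + g xm) / 2); lra.
Qed.

End obstacle_theory.

(** A second difference of step [2 * y] is the sum, with weights 1, 2, 1, of those of step [y]
    centred at [x + y], [x], [x - y]. The weights add up to 4, so the constant in front of the
    squared step is unchanged. *)
Lemma second_diff_doubling {R : realType} (f : R -> R) (C h : R) (i : nat) (x : R) :
  0 <= h ->
  (forall y, `|y - x| <= 2 ^+ i * h - h ->
    f (y + h) - 2 * f y + f (y - h) <= C * h ^+ 2) ->
  f (x + 2 ^+ i * h) - 2 * f x + f (x - 2 ^+ i * h) <= C * (2 ^+ i * h) ^+ 2.
Proof.
move=> h0; elim: i x => [|i IH] x H.
  by rewrite expr0 mul1r; apply: H; rewrite subrr normr0 expr0 mul1r subrr.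
set y := 2 ^+ i * h in IH; rewrite exprS -!mulrA -/y.
have y0 : 0 <= y by rewrite mulr_ge0// exprn_ge0.
have B s : `|s| <= 1 -> f (x + s * y + y) - 2 * f (x + s * y) + f (x + s * y - y) <= C * y ^+ 2.
  move=> s1; apply: IH => z hz; apply: H.
  rewrite exprS -mulrA -/y (_ : z - x = (z - (x + s * y)) + s * y); last by ring.
  apply: (le_trans (ler_normD _ _)); rewrite normrM (ger0_norm y0).
  have : `|s| * y <= 1 * y by rewrite ler_wpM2r.
  by move: hz; lra.
have := B 0; have := B 1; have := B (-1); rewrite normrN normr1 normr0 lexx ler01.
move=> /(_ isT) b1 /(_ isT) b2 /(_ isT) b3; move: b1 b2 b3.
rewrite !mulN1r !mul1r !mul0r !addr0 !subrK !addrK.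
rewrite (_ : x + y + y = x + 2 * y); last by ring.
rewrite (_ : x - y - y = x - 2 * y); last by ring.
by lra.
Qed.

(** * Estimates for the scheme, uniform in the step *)

Section scheme.
Context {R : realType} (K1 k1 k2 K2 sigma r q : R).
Context (hK1 : 0 < K1) (hK1k1 : K1 < k1) (hk1k2 : k1 < k2) (hk2K2 : k2 < K2).
Context (hsigma : 0 < sigma) (hr : 0 < r) (hq : 0 <= q).
Let g := obstacle K1 k1 K2.
Let b := r - q - sigma ^+ 2 / 2.
Let M := K2 - K1.
Let l := ln K1.

(** Dyadic, so that a fixed coarse step is a power of two times each finer one, as doubling
    requires. *)
Definition step_x N : R := (2 ^+ N)^-1.
Definition step_t N : R := step_x N ^+ 2 / sigma ^+ 2.
Let h := step_x.
Let k := step_t.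
Let u N := tree_value r b (k N) (h N) g.

Let s2 : 0 < sigma ^+ 2. Proof. by rewrite exprn_gt0. Qed.
Let h0 N : 0 < h N. Proof. by rewrite invr_gt0 exprn_gt0. Qed.
Lemma step_x_le1 N : step_x N <= 1.
Proof. by rewrite invf_le1 ?exprn_gt0// exprn_ege1// ler1n. Qed.
Lemma step_x_scale i N : (i <= N)%N -> step_x i = 2 ^+ (N - i) * step_x N.
Proof.
move=> iN; have E : (2 : R) ^+ N = 2 ^+ (N - i) * 2 ^+ i by rewrite -exprD subnK.
by rewrite /step_x E invfM mulrA mulfV ?mul1r// expf_neq0// pnatr_eq0.
Qed.
Lemma step_t_gt0 N : 0 < step_t N.
Proof. by rewrite divr_gt0// exprn_gt0// h0. Qed.
Let k0 N : 0 < k N. Proof. exact: step_t_gt0. Qed.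
Let kp N : 0 <= k N. Proof. exact: ltW. Qed.
Let rp : 0 <= r. Proof. exact: ltW. Qed.
Let M0 : 0 <= M.
Proof. by rewrite /M; move: (hK1k1) (hk1k2) (hk2K2) => *; lra. Qed.
Let k1p : 0 <= k1.
Proof. by move: (hK1) (hK1k1) => *; lra. Qed.
Let hk N : h N ^+ 2 = sigma ^+ 2 * k N.
Proof. by rewrite /k /step_t mulrC divfK// gt_eqF. Qed.
Let kle N : k N <= (sigma ^+ 2)^-1.
Proof.
by rewrite /k /step_t ler_piMl ?invr_ge0 ?(ltW s2)// exprn_ile1 ?step_x_le1// ltW// h0.
Qed.

Let u_lb N n x : g x <= u N n x. Proof. exact: tree_obstacle_le. Qed.
Let u_ub N n x : u N n x <= M.
Proof. by apply: tree_le_bound => // y; exact: obstacle_ub. Qed.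
Let u_homo N x : {homo (u N) ^~ x : n m / (n <= m)%N >-> n <= m}.
Proof. exact: tree_homo. Qed.

Let u_incr N n x y : x <= y -> 0 <= u N n y - u N n x <= expR y - expR x.
Proof.
apply: tree_increment_le => //.
- by move=> a c ac; rewrite ler_expR.
- by move=> a c /(obstacle_increment hK1 hK1k1 hk1k2 hk2K2)/andP[]; rewrite subr_ge0.
- move=> a c ac; have [al /andP[a0 a1] E] :=
    tree_step_exp r hsigma hq (ltW (h0 N)) (step_x_le1 N).
  rewrite !E -mulrBr ler_piMl// subr_ge0 ler_expR//.
- by move=> a c /(obstacle_increment hK1 hK1k1 hk1k2 hk2K2)/andP[].
Qed.

Let u_right N n x : ln k1 <= x -> u N n x = M.
Proof.
move=> kx; apply/eqP; rewrite eq_le u_ub/=.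
by have := u_lb N n x; rewrite /g (obstacle_right hK1 hK1k1 hk1k2 hk2K2 kx).
Qed.

Let u_lip N n x y : `|u N n x - u N n y| <= k1 * `|x - y|.
Proof.
exact: (increment_lip hK1 hK1k1 hk1k2 hk2K2 (@u_right N n) (u_incr N n)).
Qed.

Let C1 := r * `|K2 - k1 - K1|.
Let C2 := k1 * (`|b| / sigma ^+ 2 + 1).
Let C10 : 0 <= C1. Proof. by rewrite mulr_ge0. Qed.
Let C20 : 0 <= C2.
Proof. by rewrite mulr_ge0// addr_ge0// divr_ge0// ltW. Qed.

Let diff_kernel N n x : u N n.+1 x - u N n x <=
  C1 * k N + C2 * h N * walk_kernel b (k N) (h N) l n x.
Proof.
apply: tree_diff_le => //.
- by rewrite mulr_ge0.
- by rewrite mulr_ge0// ltW// h0.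
- by move=> y; exact: (obstacle_step hK1 hK1k1 hk1k2 hk2K2 hsigma hr hq y (h0 N) (step_x_le1 N)).
Qed.

Let diff_sqrt N n x : u N n.+1 x - u N n x <=
  C1 * k N + C2 * h N / Num.sqrt n.+1%:R.
Proof.
apply: (le_trans (diff_kernel N n x)); rewrite lerD2l.
by rewrite ler_wpM2l ?walk_kernel_sqrt// mulr_ge0// ltW// h0.
Qed.

(** Telescopes the sum of the bounds (n+1)^(-1/2) on the increments. *)
Let sqrt_step n : (Num.sqrt (n.+1%:R : R))^-1 <= 2 * (Num.sqrt n.+1%:R - Num.sqrt n%:R).
Proof.
set a := Num.sqrt _; set c := Num.sqrt _.
have a0 : 0 < a by rewrite sqrtr_gt0.
have c0 : 0 <= c by rewrite sqrtr_ge0.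
have E : a ^+ 2 - c ^+ 2 = 1 by rewrite !sqr_sqrtr// -natr1 addrAC subrr add0r.
have ca : c <= a by rewrite ler_sqrt// ler_nat.
rewrite -(ler_pM2l a0) mulfV ?gt_eqF//.
have := sqr_ge0 (a - c); nra.
Qed.

Let diff_sum N n m x : u N (n + m) x - u N n x <=
  C1 * (m%:R * k N) + 2 * C2 * h N * (Num.sqrt (n + m)%:R - Num.sqrt n%:R).
Proof.
elim: m => [|m IH]; first by rewrite addn0 !subrr mul0r !mulr0 addr0.
have A : C2 * h N / Num.sqrt (n + m).+1%:R <= C2 * h N * (2 * (Num.sqrt (n + m).+1%:R - Num.sqrt (n + m)%:R)).
  by rewrite ler_wpM2l ?sqrt_step// mulr_ge0// ltW// h0.
have := diff_sqrt N (n + m) x; rewrite addnS -[m.+1%:R]natr1.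
by move: A IH; lra.
Qed.

Let hsqrt N : h N = sigma * Num.sqrt (k N).
Proof.
rewrite -[LHS](gtr0_norm (h0 N)) -sqrtr_sqr hk sqrtrM ?sqrtr_sqr ?gtr0_norm//.
exact: ltW.
Qed.

(** Here [h * sqrt m = sigma * sqrt (m * k)], and the square root is subadditive. The bound is valid
    up to the kink and supplies the equicontinuity in time. *)
Let scheme_modulus N n m x : u N (n + m) x - u N n x <=
  (C1 + 2 * C2 * sigma) * (m%:R * k N + Num.sqrt (m%:R * k N)).
Proof.
apply: (le_trans (diff_sum N n m x)).
have sub : Num.sqrt (n + m)%:R - Num.sqrt n%:R <= Num.sqrt m%:R :> R.
  rewrite lerBlDr -[leRHS]ger0_norm ?addr_ge0 ?sqrtr_ge0// -[leRHS]sqrtr_sqr.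
  rewrite ler_wsqrtr// sqrrD !sqr_sqrtr ?ler0n// natrD.
  by have := mulr_ge0 (sqrtr_ge0 (m%:R : R)) (sqrtr_ge0 (n%:R : R)); lra.
have e : h N * Num.sqrt m%:R = sigma * Num.sqrt (m%:R * k N).
  by rewrite hsqrt [in RHS]sqrtrM ?ler0n//; ring.
have S : 0 <= Num.sqrt (m%:R * k N) by rewrite sqrtr_ge0.
have mk : 0 <= m%:R * k N by rewrite mulr_ge0.
have H : 2 * C2 * h N * (Num.sqrt (n + m)%:R - Num.sqrt n%:R) <= 2 * C2 * (sigma * Num.sqrt (m%:R * k N)).
  rewrite -e -[X in X <= _]mulrA; apply: ler_wpM2l; first by rewrite mulr_ge0.
  by apply: ler_wpM2l => //; exact: ltW.
have H2 : 0 <= C1 * Num.sqrt (m%:R * k N) := mulr_ge0 C10 S.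
have H3 : 0 <= 2 * C2 * sigma * (m%:R * k N)
  by exact: mulr_ge0 (mulr_ge0 (mulr_ge0 (ler0n _ _) C20) (ltW hsigma)) mk.
by lra.
Qed.

(* Away from the kink [(l, 0)] either the elapsed time is bounded below, or the
   walk has to travel a macroscopic distance to reach [l]. *)
Let scheme_local_lip (rho : R) : 0 < rho -> exists2 C : R, 0 <= C &
  exists N0, forall N n x, (N0 <= N)%N -> rho <= `|x - l| \/ rho <= n%:R * k N ->
    u N n.+1 x - u N n x <= C * k N.
Proof.
move=> r0.
(* Once the elapsed time is at least [e], an increment of order [h / sqrt (n+1)] is of order [k],
   because [h = sigma * sqrt k]. *)
have sq N n (e : R) : 0 < e -> e <= n.+1%:R * k N ->
    h N / Num.sqrt n.+1%:R <= sigma / Num.sqrt e * k N.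
  move=> e0 he.
  have s0 : 0 < Num.sqrt (n.+1%:R : R) by rewrite sqrtr_gt0.
  have se : 0 < Num.sqrt e by rewrite sqrtr_gt0.
  rewrite ler_pdivrMr// hsqrt.
  set t := Num.sqrt (k N); set s := Num.sqrt n.+1%:R in s0 *.
  have -> : k N = t * t by rewrite -expr2 sqr_sqrtr.
  rewrite (_ : _ / _ * _ * _ = sigma * t * (t * s / Num.sqrt e)); last first.
    by field; rewrite gt_eqF.
  rewrite ler_peMr ?mulr_ge0 ?sqrtr_ge0 ?(ltW hsigma)// ler_pdivlMr// mul1r.
  by rewrite /t /s -sqrtrM// ler_wsqrtr// mulrC.
(* Up to time [e] the drift moves the walk by at most [rho / 2]. *)
pose e := rho / (2 * (`|b| + 1)).
have b1 : 0 < `|b| + 1 by rewrite ltr_wpDl.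
have e0 : 0 < e by rewrite /e divr_gt0// mulr_gt0.
(* Three regimes: [P] for elapsed time at least [rho], [Q] for time at least [e], and [S] for a walk
   that must travel [rho / 4], where [h * (2 * h / (rho / 4)) = S * k]. *)
pose Q := sigma / Num.sqrt e; pose P := sigma / Num.sqrt rho; pose S := 8 * sigma ^+ 2 / rho.
have Q0 : 0 <= Q by rewrite divr_ge0 ?sqrtr_ge0 ?(ltW hsigma).
have P0 : 0 <= P by rewrite divr_ge0 ?sqrtr_ge0 ?(ltW hsigma).
have S0 : 0 <= S by rewrite divr_ge0 ?mulr_ge0 ?(ltW s2)// ltW.
exists (C1 + C2 * (Q + P + S)); first by exact: addr_ge0 C10 (mulr_ge0 C20 (addr_ge0 (addr_ge0 Q0 P0) S0)).
have [N0 hN0] : exists N0, forall N, (N0 <= N)%N -> h N <= rho / 4.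
  exists (Num.truncn (4 / rho)) => N hN.
  have p2 : 0 < (2 : R) ^+ N by rewrite exprn_gt0.
  rewrite /h /step_x -[leRHS]invrK lef_pV2 ?posrE ?invr_gt0 ?divr_gt0//.
  rewrite invf_div; apply: (le_trans (ltW (truncnS_gt _))).
  rewrite -natrX ler_nat; apply: (leq_trans (_ : _ <= N.+1)%N) => //.
  exact: ltn_expl.
exists N0 => N n x hN H.
suff K : C2 * h N * walk_kernel b (k N) (h N) l n x <= C2 * ((Q + P + S) * k N).
  by have := diff_kernel N n x; move: K; lra.
rewrite -mulrA ler_wpM2l//.
have ws (c : R) : 0 < c -> c <= n.+1%:R * k N ->
   h N * walk_kernel b (k N) (h N) l n x <= sigma / Num.sqrt c * k N.
  move=> c0 hc; apply: (le_trans _ (sq _ _ _ c0 hc)).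
  by rewrite ler_wpM2l ?walk_kernel_sqrt// ltW// h0.
have Pk : 0 <= P * k N := mulr_ge0 P0 (kp N).
have Qk : 0 <= Q * k N := mulr_ge0 Q0 (kp N).
have Sk : 0 <= S * k N := mulr_ge0 S0 (kp N).
case: H => H; last first.
  have : h N * walk_kernel b (k N) (h N) l n x <= P * k N.
    by apply: ws => //; apply: (le_trans H); rewrite ler_wpM2r ?ler_nat.
  by lra.
have [He|He] := leP e (n.+1%:R * k N).
  by have := ws _ e0 He; rewrite -/Q; lra.
have far : rho / 4 + h N <= `|x + b * k N *+ n.+1 - l|.
  have be : `|b * k N *+ n.+1| <= rho / 2.
    rewrite -mulr_natr normrM (normrM b) (gtr0_norm (k0 N)) normr_nat -mulrA (mulrC (k N)).
    have : `|b| * (n.+1%:R * k N) <= (`|b| + 1) * e.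
      by apply: ler_pM => //; [exact: mulr_ge0|rewrite lerDl|exact: ltW].
    have -> : (`|b| + 1) * e = rho / 2 by rewrite /e; field; rewrite gt_eqF.
    by [].
  have := hN0 _ hN.
  have : `|x - l| <= `|x + b * k N *+ n.+1 - l| + `|b * k N *+ n.+1|.
    by rewrite (_ : x - l = x + b * k N *+ n.+1 - l - b * k N *+ n.+1) ?ler_normB//; ring.
  by lra.
have r4 : 0 < rho / 4 by rewrite divr_gt0.
have := walk_kernel_far (h0 N) r4 far.
move=> /(ler_wpM2l (ltW (h0 N))).
have -> : h N * (2 * h N / (rho / 4)) = S * k N.
  have -> : h N * (2 * h N / (rho / 4)) = 8 * h N ^+ 2 / rho by field; rewrite gt_eqF.
  by rewrite hk /S; field; rewrite gt_eqF.
by lra.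
Qed.

(** Constant in time between grid points. As [Num.truncn] sends negative numbers to 0, the function
    equals the obstacle for all [t <= 0] and lives on the whole plane, where translations are
    unrestricted. *)
Definition tree_fun N (z : R * R) : R :=
  tree_value r b (k N) (h N) g (Num.truncn (z.2 / k N)) z.1.
Let V := tree_fun.
Let nb N t := Num.truncn (t / k N).
Let VE N x t : V N (x, t) = u N (nb N t) x. Proof. by []. Qed.

Let nb_le N t t' : t <= t' -> (nb N t <= nb N t')%N.
Proof. by move=> tt; apply: le_truncn; rewrite ler_pM2r// invr_gt0. Qed.

Let nb_diff N t t' : t <= t' -> (nb N t' - nb N t)%:R * k N <= t' - t + k N.
Proof.
move=> tt; rewrite natrB ?nb_le// mulrBl.
have U s : 0 <= s -> (nb N s)%:R * k N <= s.
  by move=> s0; rewrite -ler_pdivlMr// truncn_le divr_ge0.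
have L s : s < (nb N s)%:R * k N + k N.
  by have := truncnS_gt (s / k N); rewrite ltr_pdivrMr// -natr1 mulrDl mul1r.
have Z s : s < 0 -> (nb N s)%:R * k N = 0.
  move=> s0; rewrite (_ : nb N s = 0%N) ?mul0r//; apply/eqP; rewrite -leqn0.
  by rewrite -[leqRHS](truncn0 R) le_truncn// pmulr_lle0 ?invr_gt0// ltW.
have := L t; have [/Z->|/U] := ltP t' 0.
  have : 0 <= (nb N t)%:R * k N by rewrite mulr_ge0.
  have := k0 N; lra.
lra.
Qed.

Lemma tree_fun_bounds N z : g z.1 <= V N z <= M.
Proof. by case: z => x t; rewrite VE u_lb u_ub. Qed.

Lemma tree_fun_init N x t : t <= 0 -> V N (x, t) = g x.
Proof.
move=> t0; rewrite VE (_ : nb N t = 0%N)//; apply/eqP; rewrite -leqn0.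
by rewrite -[leqRHS](truncn0 R) le_truncn// pmulr_lle0 ?invr_gt0.
Qed.

Lemma tree_fun_homo_t N x t t' : t <= t' -> V N (x, t) <= V N (x, t').
Proof. by move=> tt; rewrite !VE; apply: u_homo; exact: nb_le. Qed.

Lemma tree_fun_incr_x N x y t : x <= y ->
  0 <= V N (y, t) - V N (x, t) <= expR y - expR x.
Proof. by move=> xy; rewrite !VE u_incr. Qed.

Lemma tree_fun_lip_x N x y t : `|V N (x, t) - V N (y, t)| <= k1 * `|x - y|.
Proof. by rewrite !VE u_lip. Qed.

Lemma tree_fun_modulus : exists2 C : R, 0 <= C & forall N x t t', t <= t' ->
  V N (x, t') - V N (x, t) <= C * (t' - t + k N + Num.sqrt (t' - t + k N)).
Proof.
exists (C1 + 2 * C2 * sigma).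
  exact: addr_ge0 C10 (mulr_ge0 (mulr_ge0 (ler0n _ _) C20) (ltW hsigma)).
move=> N x t t' tt; rewrite !VE -(subnKC (nb_le N tt)).
apply: (le_trans (scheme_modulus _ _ _ _)).
rewrite ler_wpM2l//.
  exact: addr_ge0 C10 (mulr_ge0 (mulr_ge0 (ler0n _ _) C20) (ltW hsigma)).
have H := nb_diff N tt.
by apply: lerD => //; rewrite ler_wsqrtr.
Qed.

Let step_t_small (e : R) : 0 < e -> exists N0, forall N, (N0 <= N)%N -> k N <= e /\ h N <= e.
Proof.
move=> e0; pose c := Num.min e (e * sigma ^+ 2).
have c0 : 0 < c by rewrite lt_min e0 mulr_gt0.
exists (Num.truncn (c^-1)) => N hN.
have hc : h N <= c.
  have p2 : 0 < (2 : R) ^+ N by rewrite exprn_gt0.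
  rewrite /h /step_x -[leRHS]invrK lef_pV2 ?posrE ?invr_gt0//.
  apply: (le_trans (ltW (truncnS_gt _))).
  rewrite -natrX ler_nat; apply: (leq_trans (_ : _ <= N.+1)%N) => //.
  exact: ltn_expl.
split; last by rewrite (le_trans hc)// /c ge_min lexx.
rewrite /k /step_t ler_pdivrMr//; apply: (le_trans (_ : _ <= h N)).
  by rewrite expr2 ler_piMl ?step_x_le1// ltW// h0.
by rewrite (le_trans hc)// /c ge_min lexx orbT.
Qed.

Let local_lip (rho : R) : 0 < rho -> exists2 C : R, 0 <= C &
  exists N0, forall N, (N0 <= N)%N -> forall x n, rho <= `|x - l| \/ rho <= n%:R * k N ->
    forall m, u N (n + m) x - u N n x <= C * (m%:R * k N).
Proof.
move=> r0; have [C C0 [N0 H]] := scheme_local_lip r0.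
exists C => //; exists N0 => N hN x n hx; elim=> [|m IH].
  by rewrite addn0 subrr mul0r mulr0.
have := H N (n + m)%N x hN; rewrite -addnS.
have -> : m.+1%:R = m%:R + 1 :> R by rewrite natr1.
suff hx' : rho <= `|x - l| \/ rho <= (n + m)%:R * k N.
  by move=> /(_ hx'); move: IH; lra.
case: hx => hx; [by left|right]; apply: (le_trans hx).
by rewrite ler_wpM2r// ler_nat leq_addr.
Qed.

Lemma tree_fun_local_lip (rho : R) : 0 < rho -> exists2 C : R, 0 <= C &
  exists N0, forall N, (N0 <= N)%N -> forall x t t', rho <= `|x - l| \/ rho <= t ->
    t <= t' -> V N (x, t') - V N (x, t) <= C * (t' - t + k N).
Proof.
(* Truncating [t] to the grid loses less than [k N], for which half of [rho] is kept in reserve. *)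
move=> r0; have r2 : 0 < rho / 2 by rewrite divr_gt0.
have [C C0 [N0 H]] := local_lip r2; have [N1 H1] := step_t_small r2.
exists C => //; exists (maxn N0 N1) => N; rewrite geq_max => /andP[h1 h2] x t t' hx tt.
rewrite !VE -(subnKC (nb_le N tt)).
apply: (le_trans (H _ h1 _ _ _ _)).
  case: hx => hx; first by left; lra.
  right; have [kr _] := H1 _ h2.
  by have := truncnS_gt (t / k N); rewrite ltr_pdivrMr// -natr1 mulrDl mul1r -/(nb N t); lra.
by rewrite ler_wpM2l// nb_diff.
Qed.

Lemma tree_fun_second_diff_lo : exists2 C : R, 0 <= C & forall N i x t, (i <= N)%N ->
  x + h i <= ln k1 ->
  - (C * h i ^+ 2) <= V N (x + h i, t) - 2 * V N (x, t) + V N (x - h i, t).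
Proof.
exists (4 * k1 * `|b| / sigma ^+ 2).
  by rewrite divr_ge0 ?(ltW s2)// mulr_ge0// mulr_ge0.
move=> N i x t iN xi; rewrite lerNl !VE.
have e := step_x_scale iN; rewrite -/h in e.
rewrite e in xi *.
(* Doubling propagates upper bounds, so it is applied to the opposite function. The condition
   [x + h i <= ln k1] keeps every fine stencil where the obstacle is convex. *)
have := @second_diff_doubling R (fun y => - u N (nb N t) y) (4 * k1 * `|b| / sigma ^+ 2)
  (h N) (N - i) x (ltW (h0 N)).
move=> P; apply: (le_trans _ (P _)); first by lra.
move=> y; rewrite ler_norml => /andP[_ hy].
have yh : y + h N <= ln k1 by lra.
have cvx z : z + h N <= ln k1 -> 2 * g z <= g (z + h N) + g (z - h N).
  by move=> zh; apply: (obstacle_midconvex hK1 hK1k1 hk1k2 hk2K2 (ltW (h0 N)) zh).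
have gp z : 0 <= g z := obstacle_ge0 hK1 hK1k1 hk1k2 hk2K2 z.
have := tree_second_diff_lo (kp N) rp k1p gp (u_lip N) cvx (nb N t) yh.
rewrite -/(u N) hk normrM (ger0_norm (kp N)).
have -> : 4 * k1 * `|b| / sigma ^+ 2 * (sigma ^+ 2 * k N) = 4 * k1 * (`|b| * k N).
  by field; rewrite gt_eqF.
by lra.
Qed.

Lemma tree_fun_second_diff_up (rho : R) : 0 < rho -> exists2 C : R, 0 <= C &
  exists N0, forall N, (N0 <= N)%N -> forall i x t, (i <= N)%N ->
  (forall y, `|y - x| <= h i -> rho <= `|y - l|) \/ rho <= t ->
  V N (x + h i, t) - 2 * V N (x, t) + V N (x - h i, t) <= C * h i ^+ 2.
Proof.
move=> r0; have r2 : 0 < rho / 2 by rewrite divr_gt0.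
have [C C0 [N0 H]] := scheme_local_lip r2.
have eb0 : 0 < rho / 2 / (`|b| + 1) by rewrite divr_gt0// ltr_wpDl.
have [N1 H1] := step_t_small r2; have [N2 H2] := step_t_small eb0.
(* Comes from [expR (r * k) - 1 <= r * k * expR (r * k)] and [k <= 1 / sigma^2]: [E * k] bounds the
   effect of the discount. *)
pose E := expR (r / sigma ^+ 2) * r.
have E0 : 0 <= E by rewrite mulr_ge0 ?expR_ge0.
pose D := 2 * C + 2 * E * M + 2 * k1 * `|b|.
have D0 : 0 <= D.
  by exact: addr_ge0 (addr_ge0 (mulr_ge0 (ler0n _ _) C0) (mulr_ge0 (mulr_ge0 (ler0n _ _) E0) M0))
    (mulr_ge0 (mulr_ge0 (ler0n _ _) k1p) (normr_ge0 _)).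
exists (D / sigma ^+ 2); first by rewrite divr_ge0// ltW.
exists (maxn N0 (maxn N1 N2)) => N; rewrite !geq_max => /and3P[n0 n1 n2] i x t iN hx.
rewrite !VE.
have e := step_x_scale iN; rewrite -/h in e.
rewrite e in hx *; apply: second_diff_doubling (ltW (h0 N)) _ => y hy.
have gM z : 0 <= g z <= M.
  by rewrite (obstacle_ge0 hK1 hK1k1 hk1k2 hk2K2 z) (obstacle_ub K1 k1 K2 z).
have := tree_second_diff_up (kp N) rp M0 gM (u_lip N) (nb N t) y.
rewrite -/(u N) hk (normrM b) (ger0_norm (kp N)).
(* The time increment is evaluated at [y - b * k N], so half of [rho] must absorb the drift. *)
have bk : `|b * k N| <= rho / 2.
  have [kb _] := H2 _ n2; rewrite (normrM b) (ger0_norm (kp N)).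
  have b1 : 0 < `|b| + 1 by rewrite ltr_wpDl.
  rewrite ler_pdivlMr// in kb; have := kp N; move: kb; rewrite mulrC mulrDl mul1r; lra.
have : u N (nb N t).+1 (y - b * k N) - u N (nb N t) (y - b * k N) <= C * k N.
  apply: H n0 _; case: hx => hx; [left|right].
    have := hx y; have := h0 N => hp H3.
    have {}H3 : rho <= `|y - l| by apply: H3; lra.
    have : `|y - l| <= `|y - b * k N - l| + `|b * k N|.
      by rewrite (_ : y - l = y - b * k N - l + b * k N) ?ler_normD//; ring.
    lra.
  have [kr _] := H1 _ n1.
  by have := truncnS_gt (t / k N); rewrite ltr_pdivrMr// -natr1 mulrDl mul1r -/(nb N t); lra.
have ek : expR (r * k N) - 1 <= E * k N.
  have rk0 : 0 <= r * k N by exact: mulr_ge0.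
  have e1 : expR (r * k N) * (1 - r * k N) <= 1.
    have := expR_ge1Dx (- (r * k N)) => h1.
    have := ler_wpM2l (expR_ge0 (r * k N)) h1; rewrite -expRD subrr expR0; lra.
  have e2 : expR (r * k N) <= expR (r / sigma ^+ 2) by rewrite ler_expR ler_wpM2l.
  have : expR (r * k N) * (r * k N) <= expR (r / sigma ^+ 2) * (r * k N) by rewrite ler_wpM2r.
  by rewrite /E; lra.
have : (expR (r * k N) - 1) * M <= E * k N * M by rewrite ler_wpM2r.
have -> : D / sigma ^+ 2 * (sigma ^+ 2 * k N) = D * k N by field; rewrite gt_eqF.
by rewrite /D; lra.
Qed.

Let nbS N t : 0 <= t -> nb N (t + k N) = (nb N t).+1.
Proof.
move=> t0; rewrite /nb; apply: truncn_def; rewrite mulrDl mulfV ?gt_eqF//.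
have /andP[a c] := truncn_itv (divr_ge0 t0 (kp N)).
by rewrite -!natr1 lerD2r a/= ltrD2r; move: c; rewrite -natr1.
Qed.

Lemma tree_fun_step_le N x t : 0 <= t ->
  (V N (x + b * k N + h N, t) + V N (x + b * k N - h N, t)) / 2 <=
  expR (r * k N) * V N (x, t + k N).
Proof.
move=> t0; have DE : expR (r * k N) * expR (- (r * k N)) = 1.
  by rewrite -expRD subrr expR0.
rewrite !VE nbS// -[leLHS]mul1r -[X in X * _]DE -mulrA ler_pM2l ?expR_gt0//.
exact: tree_step_le_value.
Qed.

(** Values increase in time, so lying above the obstacle at [t] forces the same at [t + k N], where
    the recursion takes its maximum; that maximum is then the continuation value. *)
Lemma tree_fun_step_eq N x t : 0 <= t -> g x < V N (x, t) ->
  expR (r * k N) * V N (x, t + k N) =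
  (V N (x + b * k N + h N, t) + V N (x + b * k N - h N, t)) / 2.
Proof.
move=> t0; rewrite !VE nbS// => gu.
have := u_homo N x (leqnSn (nb N t)); rewrite -/(nb N t) => nd.
have := lt_le_trans gu nd; rewrite /u tree_stepS -/(u N).
rewrite lt_max ltxx /= => /ltW/max_idPr ->.
by rewrite /tree_step mulrA -expRD subrr expR0 mul1r.
Qed.

End scheme.

(** * The limit value function *)

Lemma ultra_fmap (T U : Type) (f : T -> U) (F : set_system T) :
  UltraFilter F -> UltraFilter (fmap f F).
Proof.
move=> UF; have PF := @ultra_proper _ _ UF.
split=> [|G PG FG]; first exact: fmap_proper_filter.
apply/seteqP; split=> // A GA.
have [//|FnA] := in_ultra_setVsetC (f @^-1` A) UF.
have GnA : G (~` A) by exact: FG.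
by have [x []] := filter_ex (filterI GA GnA).
Qed.

(** A form of Arzela-Ascoli for functions equicontinuous only for large indices, as the tree
    functions jump in time. An ultrafilter finer than [\oo] yields all pointwise limits at once;
    convergence along it is uniform on compact squares, and [s m] is picked for the square of radius
    [m]. *)
Lemma equicontinuous_extraction {R : realType} (F : nat -> R * R -> R) (a M : R) :
  (forall N z, a <= F N z <= M) ->
  (forall (z : R * R) (e : R), 0 < e -> exists (A : set (R * R)) N0, nbhs z A /\
    forall z' N, A z' -> (N0 <= N)%N -> `|F N z' - F N z| < e) ->
  exists Y (s : nat -> nat), (forall m, (m <= s m)%N) /\
    forall (m : nat) (z : R * R), `|z.1| <= m%:R -> `|z.2| <= m%:R ->
      `|F (s m) z - Y z| <= m.+1%:R^-1.
Proof.
move=> Fb Feq; have [U [UU ooU]] := @ultraFilterLemma nat \oo _.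
have PU := @ultra_proper _ _ UU.
have cvgU (z : R * R) : exists y : R, F ^~ z @ U --> y.
  have := @segment_compact R a M; rewrite compact_ultra => /(_ _ (ultra_fmap (F ^~ z) UU)).
  move=> [|y [_ Hy]]; last by exists y.
  by apply: (@filterE _ U) => N /=; rewrite in_itv; exact: Fb.
have [Y HY] := choice cvgU.
have HYe (z : R * R) (e : R) : 0 < e -> U [set N | `|F N z - Y z| < e].
  by move=> e0; have /cvgrPdistC_lt/(_ e e0) := HY z.
have Yeq (z : R * R) (e : R) : 0 < e -> exists (A : set (R * R)) N0, nbhs z A /\
    (forall z' N, A z' -> (N0 <= N)%N -> `|F N z' - F N z| < e) /\
    (forall z', A z' -> `|Y z' - Y z| < e *+ 3).
  move=> e0; have [A [N0 [zA H]]] := Feq z e e0; exists A, N0; split=> //; split=> // z' Az'.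
  have : U [set N | (N0 <= N)%N] by apply: ooU; exists N0.
  move=> /(filterI (filterI (HYe z e e0) (HYe z' e e0)))/filter_ex[N [[h1 h2] h3]].
  have h4 := H _ _ Az' h3; rewrite /= distrC in h2.
  rewrite (_ : Y z' - Y z = (Y z' - F N z') + (F N z' - F N z) + (F N z - Y z)); last by ring.
  rewrite -mulr_natr; have := ler_normD (Y z' - F N z' + (F N z' - F N z)) (F N z - Y z).
  by have := ler_normD (Y z' - F N z') (F N z' - F N z); move: h1 h2 h4 => /=; lra.
have ex m : exists N, (m <= N)%N /\ forall z : R * R, `|z.1| <= m%:R -> `|z.2| <= m%:R ->
    `|F N z - Y z| <= m.+1%:R^-1.
  pose K : set (R * R) := `[- m%:R, m%:R] `*` `[- m%:R, m%:R].
  have cK : compact K by apply: compact_setX; exact: segment_compact.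
  have FU : Filter U by exact: filter_filter.
  have m0 : 0 < (m.+1%:R : R)^-1 / 5 by rewrite divr_gt0// invr_gt0.
  pose P N (z : R * R) := `|F N z - Y z| <= m.+1%:R^-1.
  have cov : U [set N | K `<=` P N].
    apply: (iffLR (compact_near_coveringP K) cK _ U P FU) => z _.
    have [A [N0 [zA [H1 H2]]]] := Yeq z _ m0.
    exists (A, [set N | (N0 <= N)%N] `&` [set N | `|F N z - Y z| < (m.+1%:R : R)^-1 / 5]).
      by split=> //=; apply: filterI; [apply: ooU; exists N0|exact: HYe].
    move=> [z' N] /= [Az' [hN hz]].
    have h1 := H1 _ _ Az' hN; have h2 := H2 _ Az'; rewrite distrC -[_ *+ 3]mulr_natr in h2.
    rewrite /P (_ : F N z' - Y z' = (F N z' - F N z) + (F N z - Y z) + (Y z - Y z')); last by ring.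
    apply: (le_trans (ler_normD _ _)); apply: (le_trans (lerD (ler_normD _ _) (lexx _))).
    move: h1 h2 hz; move: (`|F N z' - _|) (`|F N z - _|) (`|Y z - _|) (_^-1) => a1 a2 a3 e.
    by lra.
  have mU : U [set N | (m <= N)%N] by apply: ooU; exists m.
  have [N [hN H]] := filter_ex (filterI mU cov).
  exists N; split=> // z z1 z2; by apply: H; split; rewrite /= in_itv/= -ler_norml.
have [s Hs] := choice ex.
by exists Y, s; split=> m; have [] := Hs m.
Qed.

Lemma le_cvgn {R : realType} (u v : nat -> R) (a c : R) m0 :
  u @ \oo --> a -> v @ \oo --> c -> (forall m, (m0 <= m)%N -> u m <= v m) -> a <= c.
Proof.
move=> ua vc uv; apply: (ler_cvg_to ua vc).
by exists m0.
Qed.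

Lemma cvgn_ge {R : realType} (u : nat -> R) (a c : R) m0 :
  u @ \oo --> a -> (forall m, (m0 <= m)%N -> c <= u m) -> c <= a.
Proof. by move=> ua H; apply: (@le_cvgn R (cst c) u _ _ m0) => //; exact: cvg_cst. Qed.

Lemma cvgn_le {R : realType} (u : nat -> R) (a c : R) m0 :
  u @ \oo --> a -> (forall m, (m0 <= m)%N -> u m <= c) -> a <= c.
Proof. by move=> ua H; apply: (@le_cvgn R u (cst c) _ _ m0) => //; exact: cvg_cst. Qed.

Section value_function.
Context {R : realType} (K1 k1 k2 K2 sigma r q : R).
Context (hK1 : 0 < K1) (hK1k1 : K1 < k1) (hk1k2 : k1 < k2) (hk2K2 : k2 < K2).
Context (hsigma : 0 < sigma) (hr : 0 < r) (hq : 0 <= q).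
Let g := obstacle K1 k1 K2.
Let M := K2 - K1.
Let l := ln K1.
Let h := @step_x R.
Let k := step_t sigma.
Let V := tree_fun K1 k1 K2 sigma r q.

Lemma step_x_cvg0 : h @ \oo --> 0.
Proof.
have -> : h = fun N => 1 * 2^-1 ^+ N :> R.
  by apply/funext => N; rewrite mul1r exprVn.
apply: (@cvg_geometric R 1 2^-1); rewrite ger0_norm ?invr_ge0// invf_lt1//; lra.
Qed.

Lemma step_t_cvg0 : k @ \oo --> 0.
Proof.
rewrite -[0](mul0r ((sigma ^+ 2)^-1)) -[X in X * _](mul0r 0).
by apply: cvgMl; apply: cvgM; exact: step_x_cvg0.
Qed.

Let Veq (z : R * R) (e : R) : 0 < e -> exists (A : set (R * R)) N0, nbhs z A /\
  forall z' N, A z' -> (N0 <= N)%N -> `|V N z' - V N z| < e.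
Proof.
move=> e0; have [C C0 H] := tree_fun_modulus hK1 hK1k1 hk1k2 hk2K2 hsigma hr hq.
pose C' := C + 1; have C'0 : 0 < C' by rewrite ltr_pwDr.
(* Makes both [d] and its square root at most [e / 8 / C']. *)
pose d := Num.min (e / 8 / C') ((e / 8 / C') ^+ 2).
have d0 : 0 < d by rewrite lt_min exprn_gt0 ?divr_gt0.
have kk1 : 0 < k1 by move: (hK1) (hK1k1) => *; lra.
have [N0 _ HN] : \forall N \near \oo, `|k N| <= d / 2.
  by have /cvgr0Pnorm_le/(_ (d / 2)) := step_t_cvg0; apply; rewrite divr_gt0.
pose dx := e / 4 / k1; have dx0 : 0 < dx by rewrite !divr_gt0.
exists (ball z.1 dx `*` ball z.2 (d / 2)), N0; split.
  exists (ball z.1 dx, ball z.2 (d / 2)) => //.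
  by split; apply: nbhsx_ballx; rewrite ?divr_gt0.
move=> [x' t'] N [/= hx ht] hN; case: z hx ht => x t /= hx ht.
have kN := HN _ hN; rewrite ger0_norm in kN; last by rewrite ltW// step_t_gt0.
have mod (s s' : R) : s <= s' -> s' - s <= d / 2 -> `|V N (x', s') - V N (x', s)| <= e / 4.
  move=> ss sd; rewrite ger0_norm ?subr_ge0; last exact: tree_fun_homo_t.
  apply: (le_trans (H _ _ _ _ ss)); rewrite -/k.
  have a1 : s' - s + k N <= d by lra.
  have a2 : s' - s + k N <= e / 8 / C' by rewrite (le_trans a1)// /d ge_min lexx.
  have a3 : Num.sqrt (s' - s + k N) <= e / 8 / C'.
    rewrite -[leRHS]ger0_norm ?divr_ge0 ?(ltW e0) ?(ltW C'0)// -sqrtr_sqr ler_wsqrtr//.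
    by rewrite (le_trans a1)// /d ge_min lexx orbT.
  have : C * (s' - s + k N + Num.sqrt (s' - s + k N)) <= C' * (e / 8 / C' + e / 8 / C').
    apply: ler_pM => //; last exact: lerD.
    - by rewrite addr_ge0 ?sqrtr_ge0// addr_ge0 ?subr_ge0// ltW// step_t_gt0.
    - by rewrite lerDl.
  move/le_trans; apply; rewrite mulrDr !(mulrC C') !divfK ?gt_eqF//; lra.
have T : `|V N (x', t') - V N (x', t)| <= e / 4.
  move: ht; rewrite /ball/= ltr_norml => /andP[h1 h2].
  have [tt|/ltW tt] := leP t t'; first by apply: mod => //; lra.
  by rewrite distrC; apply: mod => //; lra.
have X : `|V N (x', t) - V N (x, t)| <= e / 4.
  apply: (le_trans (tree_fun_lip_x hK1 hK1k1 hk1k2 hk2K2 hsigma hr hq N x' x t)).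
  rewrite mulrC -ler_pdivlMr// distrC; exact: ltW.
rewrite (_ : V N (x', t') - V N (x, t) = (V N (x', t') - V N (x', t)) + (V N (x', t) - V N (x, t))); last by ring.
apply: (le_lt_trans (ler_normD _ _)).
by move: T X; move: `|_| `|_| => a1 a2; lra.
Qed.

Lemma value_function_exists : exists Y (s : nat -> nat),
  [/\ (forall m, (m <= s m)%N),
      (forall (m : nat) (z : R * R), `|z.1| <= m%:R -> `|z.2| <= m%:R ->
         `|V (s m) z - Y z| <= m.+1%:R^-1) &
      continuous Y].
Proof.
have [|Y [s [sm H]]] := @equicontinuous_extraction R V 0 M _ Veq.
  move=> N z; have /andP[a ->] := tree_fun_bounds q hK1k1 hk1k2 hk2K2 hsigma hr N z.
  by rewrite andbT (le_trans (obstacle_ge0 hK1 hK1k1 hk1k2 hk2K2 _) a).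
have cv (z : R * R) : V (s m) z @[m --> \oo] --> Y z.
  pose m0 := (Num.truncn `|z.1|).+1; pose m1 := (Num.truncn `|z.2|).+1.
  apply/cvgrPdist_le => e e0.
  exists (maxn (maxn m0 m1) (Num.truncn e^-1).+1) => // m /=; rewrite !geq_max => /andP[/andP[h0 h1] h2].
  rewrite distrC; apply: (le_trans (H m z _ _)).
  - by apply: (le_trans (ltW (truncnS_gt _))); rewrite ler_nat.
  - by apply: (le_trans (ltW (truncnS_gt _))); rewrite ler_nat.
  - rewrite -[leRHS]invrK lef_pV2 ?posrE ?invr_gt0//.
    by apply: (le_trans (ltW (truncnS_gt _))); rewrite ler_nat ltnW.
exists Y, s; split=> // z; apply/cvgrPdist_le => e e0.
have [A [N0 [zA HA]]] := Veq z e0.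
apply: filterS zA => z' Az'; rewrite distrC.
apply: (@le_cvgn R (fun m => `|V (s m) z' - V (s m) z|) (cst e) _ _ N0).
- by apply: cvg_norm; apply: cvgB; exact: cv.
- exact: cvg_cst.
- by move=> m hm; apply/ltW/HA => //; exact: leq_trans hm (sm m).
Qed.

Section limit.
Context (Y : R * R -> R) (s : nat -> nat).
Context (sm : forall m, (m <= s m)%N).
Context (sY : forall (m : nat) (z : R * R), `|z.1| <= m%:R -> `|z.2| <= m%:R ->
         `|V (s m) z - Y z| <= m.+1%:R^-1).

Lemma value_cvg (z : R * R) : V (s m) z @[m --> \oo] --> Y z.
Proof.
pose m0 := (Num.truncn `|z.1|).+1; pose m1 := (Num.truncn `|z.2|).+1.
apply/cvgrPdist_le => e e0.
exists (maxn (maxn m0 m1) (Num.truncn e^-1).+1) => // m /=; rewrite !geq_max => /andP[/andP[h0 h1] h2].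
rewrite distrC; apply: (le_trans (sY (m:=m) _ _)).
- by apply: (le_trans (ltW (truncnS_gt _))); rewrite ler_nat.
- by apply: (le_trans (ltW (truncnS_gt _))); rewrite ler_nat.
- rewrite -[leRHS]invrK lef_pV2 ?posrE ?invr_gt0//.
  by apply: (le_trans (ltW (truncnS_gt _))); rewrite ler_nat ltnW.
Qed.

Arguments value_cvg : clear implicits.

Lemma value_bounds (z : R * R) : g z.1 <= Y z <= M.
Proof.
apply/andP; split.
- apply: (cvgn_ge (m0:=0%N) (value_cvg z)) => m _.
  by have /andP[] := tree_fun_bounds q hK1k1 hk1k2 hk2K2 hsigma hr (s m) z.
- apply: (cvgn_le (m0:=0%N) (value_cvg z)) => m _.
  by have /andP[] := tree_fun_bounds q hK1k1 hk1k2 hk2K2 hsigma hr (s m) z.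
Qed.

Lemma value_init x t : t <= 0 -> Y (x, t) = g x.
Proof.
move=> t0; have := value_cvg (x, t).
under eq_fun do rewrite /V (tree_fun_init K1 k1 K2 r q hsigma _ x t0).
by move=> /cvg_lim <- //; rewrite lim_cst.
Qed.

Lemma value_homo_t x t t' : t <= t' -> Y (x, t) <= Y (x, t').
Proof.
move=> tt; apply: (le_cvgn (m0:=0%N) (value_cvg _) (value_cvg _)) => m _.
exact: tree_fun_homo_t.
Qed.

Lemma value_incr_x x y t : x <= y -> 0 <= Y (y, t) - Y (x, t) <= expR y - expR x.
Proof.
move=> xy; have c : V (s m) (y, t) - V (s m) (x, t) @[m --> \oo] --> Y (y, t) - Y (x, t).
  by apply: cvgB; exact: value_cvg.
have T m := tree_fun_incr_x r hK1 hK1k1 hk1k2 hk2K2 hsigma hq (s m) t xy.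
apply/andP; split.
- by apply: (cvgn_ge (m0:=0%N) c) => m _; have /andP[] := T m.
- by apply: (cvgn_le (m0:=0%N) c) => m _; have /andP[] := T m.
Qed.

Lemma value_lip_x x y t : `|Y (x, t) - Y (y, t)| <= k1 * `|x - y|.
Proof.
apply: (@le_cvgn R (fun m => `|V (s m) (x, t) - V (s m) (y, t)|) (cst (k1 * `|x - y|)) _ _ 0%N).
- by apply: cvg_norm; apply: cvgB; exact: value_cvg.
- exact: cvg_cst.
- move=> m _.
  exact: (tree_fun_lip_x hK1 hK1k1 hk1k2 hk2K2 hsigma hr hq (s m) x y t).
Qed.

Lemma value_local_lip (rho : R) : 0 < rho -> exists2 C : R, 0 <= C &
  forall x t t', rho <= `|x - l| \/ rho <= t -> t <= t' ->
    Y (x, t') - Y (x, t) <= C * (t' - t).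
Proof.
move=> r0; have [C C0 [N0 H]] := tree_fun_local_lip hK1 hK1k1 hk1k2 hk2K2 hsigma hr hq r0.
exists C => // x t t' hx tt.
apply: (@le_cvgn R (fun m => V (s m) (x, t') - V (s m) (x, t)) (fun m => C * (t' - t + k (s m))) _ _ N0).
- by apply: cvgB; exact: value_cvg.
- rewrite -[X in C * X]addr0; apply: cvgMr; apply: cvgD; first exact: cvg_cst.
  apply: cvg_comp step_t_cvg0; apply/cvgnyPge => A.
  by exists A => // m /= Am; exact: leq_trans Am (sm m).
- by move=> m hm; apply: H => //; exact: leq_trans hm (sm m).
Qed.

Let second_cvg (x y t : R) : V (s m) (x + y, t) - 2 * V (s m) (x, t) + V (s m) (x - y, t) @[m --> \oo] -->
  Y (x + y, t) - 2 * Y (x, t) + Y (x - y, t).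
Proof.
by apply: cvgD; [apply: cvgB; [|apply: cvgMr]|]; exact: value_cvg.
Qed.

Arguments second_cvg : clear implicits.

Lemma value_second_diff_lo : exists2 C : R, 0 <= C & forall i x t,
  x + h i <= ln k1 ->
  - (C * h i ^+ 2) <= Y (x + h i, t) - 2 * Y (x, t) + Y (x - h i, t).
Proof.
have [C C0 H] := tree_fun_second_diff_lo hK1 hK1k1 hk1k2 hk2K2 hsigma hr hq.
exists C => // i x t xi.
apply: (cvgn_ge (m0:=i) (second_cvg x (h i) t)) => m im.
by apply: H => //; exact: leq_trans im (sm m).
Qed.

Lemma value_second_diff_up (rho : R) : 0 < rho -> exists2 C : R, 0 <= C &
  forall i x t,
  (forall y, `|y - x| <= h i -> rho <= `|y - l|) \/ rho <= t ->
  Y (x + h i, t) - 2 * Y (x, t) + Y (x - h i, t) <= C * h i ^+ 2.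
Proof.
move=> r0; have [C C0 [N0 H]] := tree_fun_second_diff_up hK1 hK1k1 hk1k2 hk2K2 hsigma hr hq r0.
exists C => // i x t hx.
apply: (cvgn_le (m0:=maxn i N0) (second_cvg x (h i) t)) => m.
rewrite geq_max => /andP[im nm].
by apply: H => //; [exact: leq_trans nm (sm m)|exact: leq_trans im (sm m)].
Qed.

End limit.
End value_function.

(** * Lebesgue measure, test functions and weak derivatives in the plane *)

Local Notation plane R := (measurableTypeR R * measurableTypeR R)%type.

(** The push-forward under the translation agrees with Lebesgue measure on half-open intervals,
    hence everywhere by uniqueness. *)
Lemma lebesgue_measure_shift {R : realType} (c : R) (A : set R) : measurable A ->
  lebesgue_measure ((fun x : R => x + c) @^-1` A) = lebesgue_measure A.
Proof.
move=> mA; have mf : measurable_fun [set: R] (fun x : R => x + c).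
  by apply: continuous_measurable_fun => x; apply: cvgD; [exact: cvg_id|exact: cvg_cst].
pose mu := @measure_function_pushforward__canonical__measure_function_Measure _ _
  (measurableTypeR R) (measurableTypeR R) R (@lebesgue_measure R) (fun x : R => x + c) mf.
suff H : forall X, ocitv X -> lebesgue_measure X = mu X.
  symmetry; exact (@lebesgue_measure_unique R mu H A mA).
move=> X [[a b] _ <-].
rewrite /mu /= /pushforward.
have -> : (fun x : R => x + c) @^-1` `]a, b]%classic = `]a - c, b - c]%classic.
  by apply/seteqP; split=> x /=; rewrite !in_itv/= ltrBlDr lerBrDr.
rewrite !lebesgue_measure_itv/= !lte_fin ltrD2r; case: ifPn => // _.
by rewrite -!EFinB; congr EFin; ring.
Qed.

Lemma lebesgue2_shift {R : realType} (c : R * R) (A : set (R * R)) : measurable A ->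
  lebesgue2 R ((fun z : R * R => z + c) @^-1` A) = lebesgue2 R A.
Proof.
move=> mA.
have ms (a : R) : measurable_fun [set: R] (fun x : R => x + a).
  by apply: continuous_measurable_fun => x; apply: cvgD; [exact: cvg_id|exact: cvg_cst].
have mf : measurable_fun [set: R * R] (fun z : R * R => z + c).
  apply: measurable_fun_pair => /=.
    exact: (measurableT_comp (ms c.1) measurable_fst).
  exact: (measurableT_comp (ms c.2) measurable_snd).
pose mu := @measure_function_pushforward__canonical__measure_function_Measure _ _
  (plane R) (plane R)
  R (lebesgue2 R) (fun z : R * R => z + c) mf.
suff H : forall X Y : set (measurableTypeR R), measurable X -> measurable Y ->
    mu (X `*` Y) = (lebesgue_measure X * lebesgue_measure Y)%E.
  by symmetry; exact (@product_measure_unique _ _ _ _ R lebesgue_measure lebesgue_measure mu H A mA).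
move=> X Y mX mY.
rewrite /mu /= /pushforward.
have -> : (fun z : R * R => z + c) @^-1` (X `*` Y) =
    ((fun x : R => x + c.1) @^-1` X) `*` ((fun x : R => x + c.2) @^-1` Y).
  by apply/seteqP; split=> -[x y].
have mp (a : R) (B : set (measurableTypeR R)) : measurable B ->
    measurable ((fun x : R => x + a) @^-1` B : set (measurableTypeR R)).
  by move=> mB; have := ms a measurableT B mB; rewrite setTI.
rewrite /lebesgue2 product_measure1E; [|exact: mp..].
by congr (_ * _)%E; exact: lebesgue_measure_shift.
Qed.

Lemma integral_shift2 {R : realType} (c : R * R) (f : R * R -> R) :
  measurable_fun setT f -> (lebesgue2 R).-integrable setT (EFin \o f) ->
  \int[lebesgue2 R]_z f (z + c) = \int[lebesgue2 R]_z f z.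
Proof.
move=> mf intf; rewrite /Rintegral; congr fine.
have ms (a : R) : measurable_fun [set: R] (fun x : R => x + a).
  by apply: continuous_measurable_fun => x; apply: cvgD; [exact: cvg_id|exact: cvg_cst].
have mS : measurable_fun [set: R * R] (fun z : R * R => z + c).
  apply: measurable_fun_pair => /=.
    exact: (measurableT_comp (ms c.1) measurable_fst).
  exact: (measurableT_comp (ms c.2) measurable_snd).
have mE : measurable_fun [set: plane R] (fun z : plane R => (f z)%:E) by exact/measurable_EFinP.
pose mu := @measure_function_pushforward__canonical__measure_function_Measure _ _
  (plane R) (plane R)
  R (lebesgue2 R) (fun z : R * R => z + c) mS.
have E (g : plane R -> \bar R) : measurable_fun [set: plane R] g -> (forall z, 0 <= g z)%E ->
    (\int[lebesgue2 R]_z g ((z : R * R) + c)%R = \int[lebesgue2 R]_z g z)%E.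
  move=> mg g0.
  have <- : (\int[mu]_z g z = \int[lebesgue2 R]_z g ((z : R * R) + c)%R)%E.
    by rewrite ge0_integral_pushforward.
  by apply: eq_measure_integral => B mB _; first [exact (lebesgue2_shift c mB)|exact (esym (lebesgue2_shift c mB))].
rewrite integralE [RHS]integralE; congr (_ - _)%E.
  under eq_integral do rewrite (funepos_comp (fun z : R * R => (f z)%:E) (fun z => z + c)%R).
  exact (E _ (measurable_funepos mE) (funepos_ge0 _)).
under eq_integral do rewrite (funeneg_comp (fun z : R * R => (f z)%:E) (fun z => z + c)%R).
exact (E _ (measurable_funeneg mE) (funeneg_ge0 _)).
Qed.

Definition csquare {R : realType} (c : R * R) (e : R) : set (R * R) :=
  [set z | `|z.1 - c.1| <= e /\ `|z.2 - c.2| <= e].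

Lemma open_square {R : realType} (U : set (R * R)) (z : R * R) : open U -> U z ->
  exists2 e : R, 0 < e & csquare z e `<=` U.
Proof.
move=> oU Uz; have : nbhs z U by exact: open_nbhs_nbhs.
move=> /nbhs_ballP[e /= e0 eU]; exists (e / 2); first by rewrite divr_gt0.
move=> z' [h1 h2]; apply: eU; split; rewrite /ball/= distrC.
- by rewrite (le_lt_trans h1)// ltr_pdivrMr// ltr_pMr// ltr1n.
- by rewrite (le_lt_trans h2)// ltr_pdivrMr// ltr_pMr// ltr1n.
Qed.

(** A countable family of which every open set is a union. It makes open sets measurable for the
    product structure and localises statements that hold almost everywhere. *)
Definition rat_square {R : realType} (i : (rat * rat) * nat) : set (R * R) :=
  csquare (ratr i.1.1, ratr i.1.2) (i.2.+1%:R^-1).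

Lemma open_rat_square {R : realType} (U : set (R * R)) (z : R * R) : open U -> U z ->
  exists2 i, rat_square i `<=` U & rat_square i z.
Proof.
move=> oU Uz; have [e e0 H] := open_square oU Uz.
pose n := Num.truncn (2 / e).
have n0 : 0 < n.+1%:R^-1 :> R by rewrite invr_gt0.
have ne : n.+1%:R^-1 <= e / 2 :> R.
  rewrite -[leRHS]invrK lef_pV2 ?posrE ?invr_gt0 ?divr_gt0// invf_div.
  exact/ltW/truncnS_gt.
have R1 (x : R) : exists p : rat, `|x - ratr p| <= n.+1%:R^-1.
  have [|p] := @rat_in_itvoo R x (x + n.+1%:R^-1); first by rewrite ltrDl.
  rewrite in_itv/= => /andP[p1 p2]; exists p; rewrite ler0_norm ?subr_le0 ?(ltW p1)//.
  by rewrite opprB lerBlDr addrC ltW.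
have [p hp] := R1 z.1; have [q hq] := R1 z.2.
exists ((p, q), n) => // z' [/= h1 h2]; apply: H; split.
- rewrite (_ : z'.1 - z.1 = (z'.1 - ratr p) - (z.1 - ratr p)); last by ring.
  by apply: (le_trans (ler_normB _ _)); move: h1 hp ne; move: `|_| `|_| _^-1 => a b d; lra.
- rewrite (_ : z'.2 - z.2 = (z'.2 - ratr q) - (z.2 - ratr q)); last by ring.
  by apply: (le_trans (ler_normB _ _)); move: h2 hq ne; move: `|_| `|_| _^-1 => a b d; lra.
Qed.

Lemma measurable_csquare {R : realType} (c : R * R) (e : R) : measurable (csquare c e).
Proof.
have -> : csquare c e = `[c.1 - e, c.1 + e] `*` `[c.2 - e, c.2 + e].
  by apply/seteqP; split=> -[x t] /=; rewrite /csquare/= !in_itv/= !ler_norml;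
    move=> [/andP[a1 a2] /andP[a3 a4]]; split; apply/andP; split; lra.
exact: measurableX.
Qed.

Lemma countable_rat_square_index : countable [set: (rat * rat) * nat].
Proof. exact: countableP. Qed.

Lemma open_measurable2 {R : realType} (U : set (R * R)) : open U -> measurable U.
Proof.
move=> oU; pose F i := if pselect (rat_square i `<=` U) is left _ then @rat_square R i else set0.
have -> : U = \bigcup_i F i.
  apply/seteqP; split=> z.
    by move=> /(open_rat_square oU)[i iU iz]; exists i => //; rewrite /F; case: pselect.
  by move=> [i _]; rewrite /F; case: pselect => // iU; exact: iU.
apply: countable_bigcupT_measurable; first exact: countable_rat_square_index.
by move=> i; rewrite /F; case: pselect => // _; exact: measurable_csquare.
Qed.

Lemma continuous_measurable2 {R : realType} (f : R * R -> R) :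
  continuous f -> measurable_fun setT f.
Proof.
move=> cf; apply: (measurability _ (RGenOpens.measurableE R)) => // _ [_ [a [b ->] <-]].
by rewrite setTI; apply: open_measurable2; apply: open_comp => // x _; exact: cf.
Qed.

Lemma ae2S {R : realType} (P Q : R * R -> Prop) : (forall z, P z -> Q z) ->
  {ae lebesgue2 R, forall z, P z} -> {ae lebesgue2 R, forall z, Q z}.
Proof. by move=> PQ; apply: negligibleS => z /= nQ /PQ. Qed.

Lemma ae2_and {R : realType} (P Q : R * R -> Prop) :
  {ae lebesgue2 R, forall z, P z} -> {ae lebesgue2 R, forall z, Q z} ->
  {ae lebesgue2 R, forall z, P z /\ Q z}.
Proof.
move=> hP hQ; apply: negligibleS (negligibleU hP hQ) => z /= h.
by have [Pz|] := pselect (P z); [right => Qz; exact: h|left].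
Qed.

Lemma ae_open_rat {R : realType} (U : set (R * R)) (P : R * R -> Prop) : open U ->
  (forall i, rat_square i `<=` U -> {ae lebesgue2 R, forall z, rat_square i z -> P z}) ->
  {ae lebesgue2 R, forall z, U z -> P z}.
Proof.
move=> oU H.
have /countable_bijP[B /ppcard_eqP[f]] := countable_rat_square_index.
have : {ae lebesgue2 R, forall z, forall n, B n ->
    rat_square (f^-1%FUN n) `<=` U -> rat_square (f^-1%FUN n) z -> P z}.
  apply: ae_foralln => n.
  have [Bn|Bn] := pselect (B n); last by apply: aeW => z /Bn.
  have [iU|iU] := pselect (@rat_square R (f^-1%FUN n) `<=` U); last by apply: aeW.
  by apply: ae2S (H _ iU) => z hz _ _.
apply: ae2S => z hz Uz; have [i iU iz] := open_rat_square oU Uz.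
have e : f^-1%FUN (f i) = i by rewrite funK// inE.
by apply: (hz (f i)); rewrite ?e//; exact: funS.
Qed.

(** * Bounded functions with bounded support *)

Section bounded_support.
Context {R : realType}.
Implicit Types (f : R * R -> R) (z : R * R).

Lemma lebesgue2_csquare_lty (c : R * R) (e : R) : (lebesgue2 R (csquare c e) < +oo)%E.
Proof.
have -> : csquare c e = `[c.1 - e, c.1 + e] `*` `[c.2 - e, c.2 + e].
  by apply/seteqP; split=> -[x t] /=; rewrite /csquare/= !in_itv/= !ler_norml;
    move=> [/andP[a1 a2] /andP[a3 a4]]; split; apply/andP; split; lra.
rewrite /lebesgue2 product_measure1E//.
have fin (a b : R) : (lebesgue_measure (`[a, b]%classic : set R) < +oo)%E.
  by rewrite lebesgue_measure_itv/=; case: ifPn => // _; rewrite -EFinB ltry.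
apply: lte_mul_pinfty; [exact: measure_ge0| |exact: fin].
by rewrite ge0_fin_numE; [exact: fin|exact: measure_ge0].
Qed.

Lemma bounded_integrable2 f (C : R) (c : R * R) (m : R) : measurable_fun setT f ->
  (forall z, `|f z| <= C) -> (forall z, ~ csquare c m z -> f z = 0) ->
  (lebesgue2 R).-integrable setT (fun z => (f z)%:E).
Proof.
move=> mf fC f0; have mK : measurable (csquare c m : set (plane R)) by exact: measurable_csquare.
have : (lebesgue2 R).-integrable (csquare c m) (EFin \o f).
  apply: measurable_bounded_integrable => //; first exact: lebesgue2_csquare_lty.
    exact: measurable_funTS.
  exists C; split; first exact: num_real.
  by move=> x Cx z _; exact: le_trans (fC z) (ltW Cx).
move/(iffLR (integrable_mkcond _ mK)); congr (_.-integrable _ _).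
apply/funext => z; rewrite patchE; case: ifPn => //; rewrite notin_setE => hz.
by rewrite /= f0.
Qed.

Lemma dominated_cvg2 (f_ : nat -> R * R -> R) f (C : R) (c : R * R) (m : R) :
  (forall n, measurable_fun setT (f_ n)) -> measurable_fun setT f ->
  (forall n z, `|f_ n z| <= C) -> (forall n z, ~ csquare c m z -> f_ n z = 0) ->
  {ae lebesgue2 R, forall z, f_ ^~ z @ \oo --> f z} ->
  \int[lebesgue2 R]_z f_ n z @[n --> \oo] --> \int[lebesgue2 R]_z f z.
Proof.
move=> mf_ mf fC f0 fcvg.
have mK : measurable (csquare c m : set (plane R)) by exact: measurable_csquare.
pose g z : R := C * \1_(csquare c m) z.
have mg : measurable_fun setT g by apply: measurable_funM => //; exact: measurable_indic.
have ig : (lebesgue2 R).-integrable setT (fun z => (g z)%:E).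
  apply: (@bounded_integrable2 g `|C| c m) => // z; rewrite /g indicE.
    by case: (_ \in _); rewrite ?mulr1 ?mulr0 ?normr0.
  by move=> hz; rewrite memNset// mulr0.
have C0 : 0 <= C by rewrite (le_trans _ (fC 0%N (0, 0))).
have h1 n : measurable_fun [set: plane R] (fun z : plane R => (f_ n z)%:E).
  by apply/measurable_EFinP; exact: mf_.
have h2 : measurable_fun [set: plane R] (fun z : plane R => (f z)%:E).
  exact/measurable_EFinP.
have h3 : {ae lebesgue2 R, forall z : plane R, [set: plane R] z ->
    (f_ n z)%:E @[n --> \oo] --> (f z)%:E}.
  by apply: ae2S fcvg => z hz _; apply: cvg_EFin => //; exact: nearW.
have h4 : {ae lebesgue2 R, forall (z : plane R) n, [set: plane R] z ->
    (`|(f_ n z)%:E| <= (g z)%:E)%E}.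
  apply: aeW => z n _; rewrite /= lee_fin /g indicE.
  have [/mem_set ->|hz] := pselect (csquare c m z); first by rewrite mulr1 fC.
  by rewrite memNset// mulr0 f0// normr0.
have [intf _ cv] := dominated_convergence measurableT h1 h2 h3 ig h4.
have int_f : (\int[lebesgue2 R]_z (f z)%:E \is a fin_num)%E.
  by apply: integrable_fin_num.
apply: fine_cvg; rewrite fineK//; exact: cv.
Qed.

End bounded_support.

(** * Test functions and their Taylor bounds *)

Section test_functions.
Context {R : realType}.
Implicit Types (phi : R * R -> R) (z v : R * R) (Omega : set (R * R)).

Lemma MVT_any (f df : R -> R) (a b : R) : (forall x : R, is_derive x 1 f (df x)) ->
  exists2 c, `|c - a| <= `|b - a| & f b - f a = df c * (b - a).
Proof.
move=> fd; have [ab|/ltW ba] := leP a b.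
  have [c /andP[ac cb] E] := MVT_global ab fd; exists c => //.
  by rewrite !ger0_norm ?subr_ge0// lerD2r.
have [c /andP[bc ca] E] := MVT_global ba fd; exists c.
  by rewrite !ler0_norm ?subr_le0// lerN2 lerD2r.
by rewrite -[LHS]opprB E; ring.
Qed.

(** The mean value theorem is applied to [f2], then to the first-order and zeroth-order remainders;
    the factor 1/6 is given up. *)
Lemma taylor2_bound (f f1 f2 f3 : R -> R) (C s : R) :
  (forall x : R, is_derive x 1 f (f1 x)) -> (forall x : R, is_derive x 1 f1 (f2 x)) ->
  (forall x : R, is_derive x 1 f2 (f3 x)) -> (forall x, `|f3 x| <= C) ->
  `|f s - f 0 - s * f1 0 - s ^+ 2 / 2 * f2 0| <= C * `|s| ^+ 3.
Proof.
move=> d1 d2 d3 fC.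
have C0 : 0 <= C by exact: le_trans (fC 0).
pose r2 x := f2 x - f2 0; pose r1 x := f1 x - f1 0 - x * f2 0.
pose r0 x := f x - f 0 - x * f1 0 - x ^+ 2 / 2 * f2 0.
have e1 (x : R) : is_derive x 1 r1 (r2 x).
  by have h2 := d2 x; apply: is_derive_eq; rewrite /r2 /GRing.scale /=; ring.
have e0 (x : R) : is_derive x 1 r0 (r1 x).
  by have h1 := d1 x; apply: is_derive_eq; rewrite /r1 /GRing.scale /=; field.
have b2 x : `|r2 x| <= C * `|x|.
  have [c _ E] := MVT_any 0 x d3; rewrite /r2 E subr0 normrM.
  by rewrite ler_wpM2r.
have b1 x : `|r1 x| <= C * `|x| ^+ 2.
  have [c hc E] := MVT_any 0 x e1; move: E hc; rewrite {2}/r1 mul0r subrr !subr0 => -> hc.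
  by rewrite normrM expr2 mulrA ler_wpM2r// (le_trans (b2 c))// ler_wpM2l.
have [c hc E] := MVT_any 0 s e0; move: E hc; rewrite {1 2}/r0 !mul0r expr0n/= !mul0r !subr0 subrr => E hc.
move: E; rewrite subr0 => ->; rewrite normrM exprS mulrCA mulrC.
by rewrite ler_wpM2l// (le_trans (b1 c))// ler_wpM2l// lerXn2r// nnegrE.
Qed.

(** A function that vanishes near a point has vanishing derivatives there, so supports do not
    grow. *)
Lemma test_iter_derive Omega phi (s : seq (R * R)) : test_function Omega phi ->
  test_function Omega (iter_derive s phi).
Proof.
move=> [sm cK KO]; elim: s => [//|v s [IHs IHc IHO]].
have E (s1 s2 : seq (R * R)) (f : R * R -> R) : iter_derive (s1 ++ s2) f = iter_derive s1 (iter_derive s2 f).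
  by rewrite /iter_derive foldr_cat.
have sub : closure [set z | iter_derive (v :: s) phi z != 0] `<=`
    closure [set z | iter_derive s phi z != 0].
  rewrite [X in _ `<=` X](iffLR (closure_id _) (@closed_closure _ _)).
  apply: closure_subset => z /= hz.
  apply: contrapT => nz; move/eqP: hz; apply.
  have nearz : \near z, iter_derive s phi z = cst 0 z.
    have : nbhs z (~` closure [set z | iter_derive s phi z != 0]).
      by apply: open_nbhs_nbhs; split=> //; apply: closed_openC; exact: closed_closure.
    apply: filterS => y ny; apply: contrapT => /eqP h; apply: ny.
    exact: subset_closure.
  by rewrite (near_eq_derive _ nearz) derive_cst.
split.
- move=> s'; have := sm (s' ++ v :: s); rewrite E; exact.
- apply: (subclosed_compact _ IHc) => //; exact: closed_closure.
- exact: subset_trans IHO.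
Qed.

Lemma test_bounded Omega phi : test_function Omega phi -> exists2 C : R, 0 <= C &
  forall z, `|phi z| <= C.
Proof.
move=> [sm cK KO]; have [c _] := sm [::].
have : compact (phi @` closure [set z | phi z != 0]).
  by apply: continuous_compact => //; apply: continuous_subspaceT; exact: c.
move/compact_bounded => [M [Mr HM]].
exists (`|M| + 1) => [|z]; first by rewrite addr_ge0.
have [->|hz] := eqVneq (phi z) 0; first by rewrite normr0 addr_ge0.
apply: HM; first by rewrite (le_lt_trans (ler_norm _))// ltrDl.
by exists z => //; exact: subset_closure.
Qed.

Lemma compact_csquare (K : set (R * R)) : compact K -> exists2 m : R, 0 < m & K `<=` csquare (0, 0) m.
Proof.
move=> /compact_bounded[M [Mr HM]]; exists (`|M| + 1); first by rewrite ltr_wpDl.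
move=> z Kz; have := HM (`|M| + 1) _ z Kz.
rewrite (le_lt_trans (ler_norm _)) ?ltrDl// => /(_ isT).
by rewrite /= prod_normE /= ge_max => /andP[h1 h2]; split; rewrite /= subr0.
Qed.

Lemma test_support Omega phi : test_function Omega phi -> exists2 m : R, 0 < m &
  forall z, ~ csquare (0, 0) m z -> phi z = 0.
Proof.
move=> [_ cK _]; have [m m0 Km] := compact_csquare cK; exists m => // z hz.
by apply: contrapT => /eqP h; apply/hz/Km; exact: subset_closure.
Qed.

Lemma test_out Omega phi z : test_function Omega phi -> ~ Omega z -> phi z = 0.
Proof.
move=> [_ _ KO] Oz; apply: contrapT => /eqP h; apply/Oz/KO; exact: subset_closure.
Qed.

Lemma test_continuous Omega phi : test_function Omega phi -> continuous phi.
Proof. by move=> [sm _ _]; have [] := sm [::]. Qed.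

Lemma is_derive_line (f : R * R -> R) z v (s : R) : derivable f (z + s *: v) v ->
  is_derive s 1 (fun s => f (z + s *: v)) ('D_v f (z + s *: v)).
Proof.
move=> df; have E : (fun h : R => h^-1 *: (f (z + (h *: 1 + s) *: v) - f (z + s *: v))) =
    (fun h : R => h^-1 *: (f (h *: v + (z + s *: v)) - f (z + s *: v))).
  apply/funext => h; congr (_ *: (f _ - _)).
  have -> : h *: 1 = h :> R by rewrite /GRing.scale /= mulr1.
  by rewrite scalerDl addrCA.
split.
- by rewrite /derivable /= E.
- by rewrite /derive /= E.
Qed.

Lemma test_is_derive Omega phi z v (s : R) : test_function Omega phi ->
  is_derive s 1 (fun s => phi (z + s *: v)) ('D_v phi (z + s *: v)).
Proof. by move=> [sm _ _]; apply: is_derive_line; have [_] := sm [::]; exact. Qed.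

Lemma test_taylor1 Omega phi v : test_function Omega phi -> exists2 C : R, 0 <= C &
  forall z (s : R), `|phi (z + s *: v) - phi z| <= C * `|s|.
Proof.
move=> tphi; have [C C0 HC] := test_bounded (test_iter_derive [:: v] tphi).
exists C => // z s.
have d (x : R) := test_is_derive z v x tphi.
have [c _] := MVT_any 0 s d; rewrite scale0r addr0 subr0 => ->.
by rewrite normrM ler_wpM2r// HC.
Qed.

Lemma test_taylor2 Omega phi v : test_function Omega phi -> exists2 C : R, 0 <= C &
  forall z (s : R), `|phi (z + s *: v) - phi z - s * 'D_v phi z
    - s ^+ 2 / 2 * 'D_v ('D_v phi) z| <= C * `|s| ^+ 3.
Proof.
move=> t0; have t1 := test_iter_derive [:: v] t0; have t2 := test_iter_derive [:: v; v] t0.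
have [C C0 HC] := test_bounded (test_iter_derive [:: v; v; v] t0).
exists C => // z s.
have := @taylor2_bound _ _ _ _ C s (fun x => test_is_derive z v x t0)
  (fun x => test_is_derive z v x t1) (fun x => test_is_derive z v x t2) (fun x => HC _).
by rewrite !scale0r !addr0.
Qed.

Lemma test_quotient_cvg Omega phi v (s_ : nat -> R) z : test_function Omega phi ->
  (forall n, s_ n != 0) -> s_ @ \oo --> 0 ->
  (phi (z + s_ n *: v) - phi z) / s_ n @[n --> \oo] --> 'D_v phi z.
Proof.
move=> t0 sn s0; have [C C0 HC] := test_taylor1 v (test_iter_derive [:: v] t0).
apply/cvgrPdist_le => e e0.
have : \forall n \near \oo, C * `|s_ n| <= e.
  have : C * `|s_ n| @[n --> \oo] --> 0.
    by rewrite -[0](mulr0 C) -(@normr0 _ R); apply: cvgMr; exact: cvg_norm.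
  by move=> /cvgr0Pnorm_le/(_ e e0); apply: filterS => n; exact/le_trans/ler_norm.
apply: filterS => n hn; rewrite distrC.
have [c hc] := MVT_any 0 (s_ n) (fun x => test_is_derive z v x t0).
rewrite scale0r addr0 subr0 => ->; rewrite mulfK//.
apply: (le_trans (HC z c)); apply: le_trans hn; rewrite ler_wpM2l//.
by move: hc; rewrite !subr0.
Qed.

End test_functions.

(** * Weak derivatives as limits of difference quotients *)

Section weak_calculus.
Context {R : realType}.
Implicit Types (phi u g : R * R -> R) (z v c : R * R) (Omega : set (R * R)).

Lemma measurable_shift2 u c : measurable_fun setT u ->
  measurable_fun setT (fun z : R * R => u (z + c)).
Proof.
move=> mu.
have ms (a : R) : measurable_fun [set: R] (fun x : R => x + a).
  by apply: continuous_measurable_fun => x; apply: cvgD; [exact: cvg_id|exact: cvg_cst].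
have mS : measurable_fun [set: R * R] (fun z : R * R => z + c).
  apply: measurable_fun_pair => /=.
    exact: (measurableT_comp (ms c.1) measurable_fst).
  exact: (measurableT_comp (ms c.2) measurable_snd).
exact: (measurableT_comp mu mS).
Qed.

Lemma measurable_test Omega phi : test_function Omega phi -> measurable_fun setT phi.
Proof. by move=> t0; apply: continuous_measurable2; exact: test_continuous t0. Qed.

Lemma Rintegral_test Omega phi (w : R * R -> R) : test_function Omega phi ->
  \int[lebesgue2 R]_(z in Omega) (w z * phi z) = \int[lebesgue2 R]_z (w z * phi z).
Proof.
move=> t0; rewrite Rintegral_mkcond; apply: eq_Rintegral => z _.
rewrite patchE; case: ifPn => //; rewrite notin_setE => Oz.
by rewrite (test_out t0 Oz) mulr0.
Qed.

Lemma test_shift_support phi (m : R) c (S : R) : (forall z, ~ csquare (0, 0) m z -> phi z = 0) ->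
  `|c.1| <= S -> `|c.2| <= S ->
  forall z, ~ csquare (0, 0) (m + S) z -> phi (z + c) = 0.
Proof.
move=> H c1 c2 z hz; apply: H => -[h1 h2]; apply: hz; rewrite /= !subr0 in h1 h2.
split; rewrite /= subr0.
- have := ler_normB (z.1 + c.1) c.1; rewrite addrK => h.
  by apply: (le_trans h); exact: lerD.
- have := ler_normB (z.2 + c.2) c.2; rewrite addrK => h.
  by apply: (le_trans h); exact: lerD.
Qed.

Lemma csquare_mono (m m' : R) z : m <= m' -> ~ csquare (0, 0) m' z -> ~ csquare (0, 0) m z.
Proof. by move=> mm h [h1 h2]; apply: h; split; exact: le_trans mm. Qed.

(* Both sides are limits of the same integral, by translation invariance. *)
Lemma weak_derivative_quotients Omega u g v (s_ : nat -> R) (Cu : R) :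
  measurable_fun setT u -> measurable_fun setT g -> (forall z, `|u z| <= Cu) ->
  (forall n, 0 < s_ n) -> s_ @ \oo --> 0 ->
  {ae lebesgue2 R, forall z, Omega z -> (u (z + s_ n *: v) - u z) / s_ n @[n --> \oo] --> g z} ->
  (forall K, compact K -> K `<=` Omega -> exists C n0, forall n z, (n0 <= n)%N -> K z ->
     `|u (z + s_ n *: v) - u z| <= C * s_ n) ->
  forall phi, test_function Omega phi ->
  \int[lebesgue2 R]_(z in Omega) (u z * 'D_v phi z) =
  - \int[lebesgue2 R]_(z in Omega) (g z * phi z).
Proof.
move=> mu mg uC sp s0 ug ulip phi t0; have t1 := test_iter_derive [:: v] t0.
rewrite (Rintegral_test u t1) (Rintegral_test g t0).
have [K_ cK KO] := t0.
have [C [n0 HC]] := ulip _ cK KO.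
have [n1 _ Hn1] : \forall n \near \oo, `|s_ n| <= 1 
  by have /cvgr0Pnorm_le/(_ 1 ltr01) := s0.
(* The sequence is restarted where both the Lipschitz bound on the support of [phi] and
   [|s_ n| <= 1] hold, so that all translated supports stay in one square. *)
pose N := maxn n0 n1; pose s n := s_ (n + N)%N.
have sn n : s n != 0 by rewrite gt_eqF// sp.
have sn0 : s @ \oo --> 0 by rewrite /s cvg_shiftn.
have sle n : `|s n| <= 1.
  by apply: Hn1 => /=; rewrite (leq_trans (leq_maxr n0 n1))// leq_addl.
have [m m0 Hm] := test_support t0.
have [Cp Cp0 HCp] := test_taylor1 v t0.
have [Cq Cq0 HCq] := test_bounded t0.
have Cu0 : 0 <= Cu by exact: le_trans (uC (0, 0)).
have mphi := measurable_test t0.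
pose S : R := `|v.1| + `|v.2|.
have S0 : 0 <= S by rewrite addr_ge0.
have cS n : `|(- s n *: v).1| <= S /\ `|(- s n *: v).2| <= S.
  rewrite /= /GRing.scale /= !normrM normrN; split.
    by apply: (@le_trans _ _ `|v.1|); rewrite ?ler_piMl// lerDl.
  by apply: (@le_trans _ _ `|v.2|); rewrite ?ler_piMl// lerDr.
pose f1 n z := u z * ((phi (z + - s n *: v) - phi z) / - s n).
pose f2 n z := (u (z + s n *: v) - u z) / s n * phi z.
pose F n z := u z * phi (z + - s n *: v).
have mF n : measurable_fun setT (F n).
  by apply: measurable_funM => //; exact: measurable_shift2.
have mf1 n : measurable_fun setT (f1 n).
  apply: measurable_funM => //; apply: measurable_funM => //.
  by apply: measurable_funB => //; exact: measurable_shift2.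
have mf2 n : measurable_fun setT (f2 n).
  apply: measurable_funM => //; apply: measurable_funM => //.
  by apply: measurable_funB => //; exact: measurable_shift2.
have f1C n z : `|f1 n z| <= Cu * Cp.
  rewrite normrM; apply: ler_pM => //; rewrite normrM normfV normrN.
  by rewrite ler_pdivrMr ?normr_gt0// -[X in _ * X]normrN HCp.
have supp1 n z : ~ csquare (0, 0) (m + S) z -> phi (z + - s n *: v) = 0 /\ phi z = 0.
  move=> hz; split; first by have [a b] := cS n; exact: (test_shift_support Hm a b).
  by apply: Hm; apply: csquare_mono hz; rewrite lerDl.
have f10 n z : ~ csquare (0, 0) (m + S) z -> f1 n z = 0.
  by move=> /(supp1 n)[h1 h2]; rewrite /f1 h1 h2 subrr mul0r mulr0.
have L1 : \int[lebesgue2 R]_z f1 n z @[n --> \oo] --> \int[lebesgue2 R]_z (u z * 'D_v phi z).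
  apply: (dominated_cvg2 mf1 _ f1C f10).
    by apply: measurable_funM => //; exact: (measurable_test t1).
  apply: aeW => z; apply: cvgMr; apply: (test_quotient_cvg (Omega:=Omega)) => //.
    by move=> n; rewrite oppr_eq0.
  by rewrite -oppr0; exact: cvgN.
have f2C n z : `|f2 n z| <= `|C| * Cq.
  have [Kz|Kz] := pselect (closure [set z | phi z != 0] z); last first.
    rewrite /f2; have -> : phi z = 0 by apply: contrapT => /eqP h; apply/Kz/subset_closure.
    by rewrite mulr0 normr0 mulr_ge0.
  rewrite /f2 normrM; apply: ler_pM => //.
  rewrite normrM normfV ler_pdivrMr ?normr_gt0// (gtr0_norm (sp _)).
  apply: (le_trans (HC _ _ _ Kz)); first by rewrite (leq_trans (leq_maxl n0 n1))// leq_addl.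
  by rewrite ler_wpM2r ?ler_norm// ltW.
have f20 n z : ~ csquare (0, 0) (m + S) z -> f2 n z = 0.
  by move=> /(supp1 n)[_ h2]; rewrite /f2 h2 mulr0.
have L2 : \int[lebesgue2 R]_z f2 n z @[n --> \oo] --> \int[lebesgue2 R]_z (g z * phi z).
  apply: (dominated_cvg2 mf2 _ f2C f20).
    exact: measurable_funM.
  apply: ae2S ug => z ugz.
  have [Oz|Oz] := pselect (Omega z); last first.
    rewrite (test_out t0 Oz) mulr0; under eq_fun do rewrite /f2 (test_out t0 Oz) mulr0.
    exact: cvg_cst.
  apply: cvgMl.
  by have := ugz Oz; rewrite -(cvg_shiftn N).
have iF n : (lebesgue2 R).-integrable setT (fun z => (F n z)%:E).
  apply: (bounded_integrable2 (C:=Cu * Cq) (c:=(0,0)) (m:=m + S) (mF n)) => z.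
    by rewrite normrM; apply: ler_pM.
  by move=> /(supp1 n)[h1 _]; rewrite /F h1 mulr0.
have mFs n : measurable_fun setT (fun z => F n (z + s n *: v)) by exact: measurable_shift2.
have Es n z : F n (z + s n *: v) = u (z + s n *: v) * phi z.
  by rewrite /F -addrA -scalerDl addrN scale0r addr0.
have iFs n : (lebesgue2 R).-integrable setT (fun z => (F n (z + s n *: v))%:E).
  apply: (bounded_integrable2 (C:=Cu * Cq) (c:=(0,0)) (m:=m + S) (mFs n)) => z.
    by rewrite Es normrM; apply: ler_pM.
  by move=> /(supp1 n)[_ h2]; rewrite Es h2 mulr0.
have if1 n : (lebesgue2 R).-integrable setT (fun z => (f1 n z)%:E).
  exact: (bounded_integrable2 (mf1 n) (f1C n) (f10 n)).
have if2 n : (lebesgue2 R).-integrable setT (fun z => (f2 n z)%:E).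
  exact: (bounded_integrable2 (mf2 n) (f2C n) (f20 n)).
(* [f1 n + f2 n] is the difference between a translate of [F n] and [F n], divided by [s n]; its
   integral vanishes. *)
have E12 n : \int[lebesgue2 R]_z f1 n z = - \int[lebesgue2 R]_z f2 n z.
  apply/eqP; rewrite -subr_eq0 opprK -(RintegralD measurableT (if1 n) (if2 n)).
  have -> : (\int[lebesgue2 R]_z (f1 n z + f2 n z) =
     \int[lebesgue2 R]_z ((F n (z + s n *: v) - F n z) * (s n)^-1))%R.
    by apply: eq_Rintegral => z _; rewrite Es /f1 /f2 /F; field; exact: sn.
  rewrite RintegralZr//; last exact (integrableB measurableT (iFs n) (iF n)).
  have Z : \int[lebesgue2 R]_z (F n (z + s n *: v) - F n z) = 0.
    apply: (etrans (RintegralB measurableT (iFs n) (iF n))); apply/eqP; rewrite subr_eq0; apply/eqP.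
    exact (integral_shift2 (s n *: v) (mF n) (iF n)).
  by rewrite Z mul0r.
move: L1; under eq_fun do rewrite E12.
move=> L1; rewrite -[LHS](cvg_lim (@Rhausdorff R) L1).
exact: (cvg_lim (@Rhausdorff R) (cvgN L2)).
Qed.

End weak_calculus.

(** * Almost everywhere differentiability of Lipschitz functions *)

Section lipschitz_ae.
Context {R : realType}.

(** [F] and [x - F x] both increase, and their Stieltjes measures add up to Lebesgue measure. So the
    measure of [F] is absolutely continuous, and finite because [F] is bounded; up to a constant [F]
    is the integral of its Radon-Nikodym density, to which Lebesgue differentiation applies. *)
Lemma bounded_contraction_ae_derivable (F : R -> R) (a c : R) :
  {homo F : x y / x <= y} -> (forall x y, x <= y -> F y - F x <= y - x) ->
  (forall x, a <= F x <= c) ->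
  {ae (@lebesgue_measure R), forall x, derivable F x 1}.
Proof.
move=> ndF lipF Fb.
have cF : continuous F.
  move=> x; apply/cvgrPdist_le => e e0; near=> y.
  have L u v : u <= v -> `|F v - F u| <= `|v - u|.
    by move=> uv; rewrite !ger0_norm ?subr_ge0 ?ndF ?lipF.
  have xy : `|x - y| <= e by near: y; apply: cvgr_dist_le.
  have [yx|/ltW xy'] := leP y x; first exact: le_trans (L _ _ yx) xy.
  by rewrite distrC; apply: le_trans (L _ _ xy') _; rewrite distrC.
pose F2 x := x - F x.
have ndF2 : {homo F2 : x y / x <= y}.
  by move=> x y xy; have := lipF _ _ xy; rewrite /F2; lra.
have cF2 : continuous F2 by move=> x; apply: cvgB; [exact: cvg_id|exact: cF].
pose c1 : cumulative R R := HB.pack F (isCumulative.Build R _ R F ndF (right_continuousW cF)).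
pose c2 : cumulative R R := HB.pack F2 (isCumulative.Build R _ R F2 ndF2 (right_continuousW cF2)).
pose nu1 : {measure set (measurableTypeR R) -> \bar R} := lebesgue_stieltjes_measure c1.
pose nu2 : {measure set (measurableTypeR R) -> \bar R} := lebesgue_stieltjes_measure c2.
have nuE (f : cumulative R R) (x y : R) : x <= y ->
    lebesgue_stieltjes_measure f `]x, y] = (f y - f x)%:E.
  move=> xy; rewrite /lebesgue_stieltjes_measure/= /measure_extension measurable_mu_extE//=.
    by rewrite wlength_itv_bnd.
  exact: is_ocitv.
have nu1E (x y : R) : x <= y -> nu1 `]x, y]%classic = (F y - F x)%:E := @nuE c1 x y.
have nu2E (x y : R) : x <= y -> nu2 `]x, y]%classic = (F2 y - F2 x)%:E := @nuE c2 x y.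
have sum0 X : ocitv X -> lebesgue_measure X = (nu1 X + nu2 X)%E.
  move=> /ocitvP[->|[[x y] /= xy ->]]; first by rewrite !measure0 adde0.
  rewrite nu1E ?(ltW xy)// nu2E ?(ltW xy)// lebesgue_measure_itv/= lte_fin xy.
  by rewrite -!EFinD; congr EFin; rewrite /F2; ring.
have sum (A : set (measurableTypeR R)) : measurable A -> lebesgue_measure A = (nu1 A + nu2 A)%E.
  move=> mA; rewrite -[RHS](measure_addE nu1 nu2 A).
  apply: (@lebesgue_measure_unique R (measure_add nu1 nu2)) => // X oX.
  by apply: (etrans (sum0 X oX)); exact: (esym (measure_addE nu1 nu2 X)).
have dom : nu1 `<< lebesgue_measure.
  apply/null_content_dominatesP => A mA A0; have := sum A mA; rewrite A0 => /esym/eqP.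
  by rewrite padde_eq0 ?measure_ge0// => /andP[/eqP].
pose In (n : nat) : set (measurableTypeR R) := `]- n%:R, n%:R]%classic.
have mIn n : measurable (In n) by exact: measurable_itv.
have IT : \bigcup_n In n = [set: measurableTypeR R].
  apply/seteqP; split=> // x _; exists (Num.truncn `|x|).+1 => //=.
  by rewrite /In/= in_itv/=; have := truncnS_gt `|x|; rewrite ltr_norml => /andP[-> /ltW].
have ndI : {homo In : n m / (n <= m)%N >-> (n <= m)%O}.
  move=> n m nm; apply/subsetPset => x; rewrite /In/= !in_itv/= => /andP[h1 h2].
  have nmR : n%:R <= m%:R :> R by rewrite ler_nat.
  by rewrite (le_lt_trans _ h1) ?lerN2//= (le_trans h2).
have nuT : (nu1 setT <= (c - a)%:E)%E.
  have mU : measurable (\bigcup_n In n) by rewrite IT.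
  have cv := @nondecreasing_cvg_mu _ _ _ nu1 In mIn mU ndI.
  rewrite -IT -(cvg_lim _ cv)//; apply: lime_le; first by apply/cvg_ex; eexists; exact: cv.
  apply: nearW => n; rewrite /= /In nu1E; last by rewrite lerNl (le_trans _ (ler0n _ _))// oppr_le0.
  rewrite lee_fin /=; have /andP[_ h1] := Fb n%:R; have /andP[h2 _] := Fb (- n%:R).
  exact: lerB.
have nufin : fin_num_fun nu1.
  move=> A mA; rewrite ge0_fin_numE ?measure_ge0//; apply: le_lt_trans (ltry (c - a)).
  by apply: le_trans nuT; apply: le_measure; rewrite ?inE.
pose nuF : {finite_measure set (measurableTypeR R) -> \bar R} :=
  HB.pack (Measure.sort nu1) (Measure_isFinite.Build _ _ _ (Measure.sort nu1) nufin).
have [f [f0 ffin intf fE]] := @radon_nikodym_sigma_finite _ _ _ lebesgue_measure nuF dom.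
pose g x := fine (f x).
have gE : EFin \o g = f by apply/funext => x; rewrite /= fineK.
have intg : lebesgue_measure.-integrable setT (EFin \o g) by rewrite gE.
have locg : locally_integrable setT g.
  by apply: open_integrable_locally => //; exact: openT.
have intgy y : lebesgue_measure.-integrable `]-oo, y] (EFin \o g).
  by apply: integrableS intg.
have := FTC1Ny intgy locg; apply: negligibleS => x /= nd h; apply: nd.
have [d _] := h.
pose G y := (\int[lebesgue_measure]_(t in [set` `]-oo, y]]) g t)%R.
have inc y z : y <= z -> F z - F y = G z - G y.
  move=> yz; rewrite /G Rintegral_itvB//.
  have := fE `]y, z]%classic (measurable_itv _); rewrite -gE => E.
  rewrite /Rintegral -[LHS]/(fine (F z - F y)%:E) -nu1E//; congr fine; exact: E.
have incE y z : F z - F y = G z - G y.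
  have [yz|/ltW zy] := leP y z; first exact: inc.
  by rewrite -[LHS]opprB inc// opprB.
have -> : F = G + cst (F 0 - G 0).
  by apply/funext => y; rewrite /= fctE /=; have := incE 0 y; lra.
by apply: derivableD => //; exact: derivable_cst.
Unshelve. all: by end_near. Qed.

(** After clamping the variable to [[a, b]], adding [D] times the identity and dividing by [2 * D],
    [f] becomes a bounded monotone contraction. *)
Lemma local_lipschitz_ae_derivable (f : R -> R) (a b C : R) :
  (forall x y, a <= x -> x <= y -> y <= b -> `|f y - f x| <= C * (y - x)) ->
  {ae (@lebesgue_measure R), forall x, a < x < b -> derivable f x 1}.
Proof.
move=> lipf; have [ba|ab] := leP b a.
  by apply: aeW => x /andP[ax xb]; have := lt_trans ax xb; rewrite ltNge ba.
pose D : R := `|C| + 1; have D0 : 0 < D by rewrite ltr_wpDl.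
pose cl x := Num.max a (Num.min x b).
have cl_id x : a <= x -> x <= b -> cl x = x.
  by move=> ax xb; rewrite /cl (min_idPl xb) (max_idPr ax).
have cla x : a <= cl x by rewrite /cl le_max lexx.
have clb x : cl x <= b by rewrite /cl ge_max (ltW ab) ge_min lexx orbT.
have cl_mono x y : x <= y -> 0 <= cl y - cl x <= y - x.
  move=> xy; rewrite /cl.
  have : 0 <= Num.min y b - Num.min x b <= y - x.
    by apply/andP; split; case: (leP x b) => ?; case: (leP y b) => ?; lra.
  move: (Num.min y b) (Num.min x b) => v u /andP[? ?].
  by apply/andP; split; case: (leP a v) => ?; case: (leP a u) => ?; lra.
pose F x := (f (cl x) + D * cl x) / (2 * D).
have D2 : 0 < 2 * D by rewrite mulr_gt0.
have inc x y : x <= y -> 0 <= F y - F x <= y - x.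
  move=> xy; have /andP[c0 c1] := cl_mono _ _ xy.
  have := lipf (cl x) (cl y) (cla x); rewrite -subr_ge0 c0 clb => /(_ isT isT).
  rewrite ler_norml => /andP[l1 l2].
  have CD : C * (cl y - cl x) <= D * (cl y - cl x).
    by rewrite ler_wpM2r// (le_trans (ler_norm _))// lerDl.
  rewrite /F -mulrBl; apply/andP; split.
    by rewrite divr_ge0 ?(ltW D2)//; lra.
  have : D * (cl y - cl x) <= D * (y - x) by rewrite ler_wpM2l// ltW.
  by rewrite ler_pdivrMr//; lra.
have := @bounded_contraction_ae_derivable F (F a) (F b).
have ndF : {homo F : x y / x <= y} by move=> x y /inc/andP[]; rewrite subr_ge0.
have Fb x : F a <= F x <= F b.
  have <- : F (cl x) = F x by rewrite /F (cl_id (cl x)).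
  by apply/andP; split; apply: ndF.
move=> /(_ ndF (fun x y xy => proj2 (andP (inc x y xy))) Fb).
apply: negligibleS => x /= nd h; apply: nd => /andP[ax xb].
have dG : derivable (fun y => 2 * D * F y - D * y) x 1.
  by apply: derivableB; apply: derivableM => //; exact: derivable_cst.
apply: near_eq_derivable dG.
have : \forall y \near x, a < y /\ y < b.
  by near=> y; split; near: y; [exact: lt_nbhsr|exact: lt_nbhsl].
apply: filterS => y [ay yb]; rewrite /F cl_id ?ltW//; field; rewrite gt_eqF//.
Unshelve. all: by end_near. Qed.

Lemma derivable_quotient_cvg (f : R -> R) (x : R) (s_ : nat -> R) :
  derivable f x 1 -> (forall n, 0 < s_ n) -> s_ @ \oo --> 0 ->
  exists l : R, (f (x + s_ n) - f x) / s_ n @[n --> \oo] --> l.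
Proof.
move=> /cvg_ex[/= l hl] sp s0; exists l.
have sd : s_ @ \oo --> 0^'.
  move=> A; rewrite /dnbhs/= /within/= => hA.
  have := s0 _ hA; rewrite /= !near_simpl; apply: filterS => n; apply.
  by rewrite gt_eqF.
have := cvg_comp _ _ sd hl; apply: cvg_trans; apply: near_eq_cvg.
apply: nearW => n /=; rewrite /GRing.scale /= mulr1 [s_ n + x]addrC; ring.
Qed.

Lemma lebesgue2_null_xsection (N : set (R * R)) : measurable N ->
  (forall x, {ae (@lebesgue_measure R), forall t, ~ N (x, t)}) -> lebesgue2 R N = 0%E.
Proof.
move=> mN H; rewrite /lebesgue2 /product_measure1; apply: integral0_eq => x _ /=.
apply/negligibleP; first exact: measurable_xsection.
by apply: negligibleS (H x) => t /=; rewrite /xsection/= inE => h; exact.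
Qed.

Lemma lebesgue2_null_ysection (N : set (R * R)) : measurable N ->
  (forall t, {ae (@lebesgue_measure R), forall x, ~ N (x, t)}) -> lebesgue2 R N = 0%E.
Proof.
move=> mN H; rewrite /lebesgue2.
have -> : (lebesgue_measure \x lebesgue_measure)%E N = (lebesgue_measure \x^ lebesgue_measure)%E N.
  by apply: product_measure_unique => // A B mA mB; rewrite /= product_measure2E.
rewrite /product_measure2; apply: integral0_eq => t _ /=.
apply/negligibleP; first exact: measurable_ysection.
by apply: negligibleS (H t) => x /=; rewrite /ysection/= inE => h; exact.
Qed.

End lipschitz_ae.

(** * Regularity of the value function *)

Section limits_of_quotients.
Context {R : realType}.
Implicit Types (q : nat -> R * R -> R) (D : set (R * R)).

(** Vanishes exactly where [q n z] converges to a real number, and is measurable in [z]; convergence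
    is thus a measurable condition. *)
Local Notation defect q := (fun z => limn_esup (fun n => (`|q n z - fine (limn_esup (fun n => (q n z)%:E))|)%:E)).

Let limn_esup_EFin (u : nat -> R) (l : R) : u n @[n --> \oo] --> l ->
  limn_esup (fun n => (u n)%:E) = l%:E.
Proof.
move=> ul; have h : (u n)%:E @[n --> \oo] --> l%:E by apply: cvg_EFin => //; exact: nearW.
by have [_ ->] := cvg_limn_einf_sup h.
Qed.

Let defect0 q z : (exists l : R, q n z @[n --> \oo] --> l) <-> defect q z = 0%E.
Proof.
split=> [[l ql]|].
- have E : limn_esup (fun n => (q n z)%:E) = l%:E.
    exact: limn_esup_EFin.
  rewrite E /=; apply: limn_esup_EFin.
  apply: cvg_trans (_ : `|q n z - l| @[n --> \oo] --> 0); first exact: cvg_refl.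
  rewrite -(@normr0 _ R) -(subrr l); apply: cvg_norm; apply: cvgB => //; exact: cvg_cst.
- move=> d0; set l := fine _ in d0; exists l.
  have : (`|q n z - l|)%:E @[n --> \oo] --> 0%E.
    by apply: limn_esup_le_cvg; rewrite ?d0// => n; rewrite lee_fin.
  move=> /fine_cvg /= h; apply/cvgrPdistC_le => e e0.
  by move/cvgr0Pnorm_le/(_ e e0): h; apply: filterS => n; rewrite normr_id.
Qed.

(** Off the convergence set [g] is set to 0, so that signs and bounds of the quotients pass to [g]
    at every point. The last clause reduces convergence almost everywhere to the nullity of
    measurable sets of divergence, which are later examined line by line with Fubini. *)
Lemma quotient_limit q D : (forall n, measurable_fun setT (q n)) -> measurable D ->
  exists g : R * R -> R, [/\ measurable_fun setT g,
    forall z, D z -> (exists l : R, q n z @[n --> \oo] --> l) -> q n z @[n --> \oo] --> g z,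
    forall z, g z = 0 \/ (D z /\ q n z @[n --> \oo] --> g z) &
    (forall N, measurable N -> N `<=` D ->
      (forall z, N z -> ~ exists l : R, q n z @[n --> \oo] --> l) -> lebesgue2 R N = 0%E) ->
    {ae lebesgue2 R, forall z, D z -> q n z @[n --> \oo] --> g z}].
Proof.
move=> mq mD.
pose L z := fine (limn_esup (fun n => (q n z)%:E)).
have mL : measurable_fun setT L.
  apply: (measurableT_comp (f:=@fine R)); first exact: fine_measurable.
  by apply: measurable_fun_limn_esup => n; exact/measurable_EFinP.
have mdef : measurable_fun setT (defect q).
  apply: measurable_fun_limn_esup => n; apply/measurable_EFinP.
  by apply: measurableT_comp => //; exact: measurable_funB.
pose G := D `&` (defect q) @^-1` [set 0%E].
have mG : measurable G.
  apply: measurableI => //; rewrite -[X in measurable X]setTI; exact: mdef.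
have LG z : D z -> (exists l : R, q n z @[n --> \oo] --> l) -> q n z @[n --> \oo] --> (L \_ G) z.
  move=> Dz [l ql]; rewrite patchE mem_set; last first.
    by split=> //; apply/defect0; exists l.
  suff -> : L z = l by [].
  by rewrite /L (limn_esup_EFin ql).
exists (L \_ G); split=> //.
- by apply/(measurable_restrictT _ _).1 => //; exact: measurable_funTS.
- move=> z; rewrite patchE; case: ifPn => [|_]; last by left.
  rewrite inE => -[Dz d0]; right; split=> //.
  by have := LG z Dz ((defect0 q z).2 d0); rewrite patchE mem_set.
- move=> H; exists (D `\` G); split; first exact: measurableD.
    apply: H; [exact: measurableD|by move=> z []|].
    by move=> z [Dz nG] /defect0 d0; apply: nG; split.
  move=> z /= hz; have Dz : D z by apply: contrapT => nD; apply: hz => /nD.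
  split=> // -[_ d0]; apply: hz => _; apply: LG => //; exact: (defect0 q z).2.
Qed.

End limits_of_quotients.

(** * Slopes of functions with bounded dyadic second differences *)

Section dyadic.
Context {R : realType}.
Let s := @step_x R.

Lemma step_xS n : s n.+1 = s n / 2.
Proof. by rewrite /s /step_x exprSr invfM. Qed.

Lemma step_x_gt0 n : 0 < s n.
Proof. by rewrite invr_gt0 exprn_gt0. Qed.

(** Slopes at consecutive scales differ by at most [C * (s n - s n.+1)], so the slope of step [s n]
    is within [C * s n] of its limit. Along a lattice of step [s n], slopes change by at most [C]
    times the distance. The Lipschitz bound on [f] handles points off the lattice. *)
Lemma dyadic_slope_lip (f d : R -> R) (a b C L : R) : 0 <= C -> 0 <= L ->
  (forall x y, `|f x - f y| <= L * `|x - y|) ->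
  (forall i x, a <= x - s i -> x + s i <= b ->
     `|f (x + s i) - 2 * f x + f (x - s i)| <= C * s i ^+ 2) ->
  (forall x, a < x -> x < b -> (f (x + s n) - f x) / s n @[n --> \oo] --> d x) ->
  forall x y, a < x -> x <= y -> y < b -> `|d y - d x| <= C * (y - x).
Proof.
move=> C0 L0 lip sec cvd.
pose D n x := (f (x + s n) - f x) / s n.
have sp := step_x_gt0; have s2 n := gt_eqF (sp n).
have DS n x : a <= x -> x + s n <= b -> `|D n.+1 x - D n x| <= C * (s n - s n.+1).
  move=> ax xb; have e := step_xS n; have := sp n => sn.
  have := sec n.+1 (x + s n.+1).
  rewrite addrK -addrA (_ : s n.+1 + s n.+1 = s n); last by rewrite e; field.
  move=> /(_ ax xb) h.
  have -> : D n.+1 x - D n x = - ((f (x + s n) - 2 * f (x + s n.+1) + f x) / s n).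
    by rewrite /D e; field; rewrite gt_eqF.
  rewrite normrN normrM normfV (gtr0_norm sn) ler_pdivrMr//; apply: (le_trans h).
  by rewrite -mulrA ler_wpM2l// e expr2; have := mulr_ge0 (ltW sn) (ltW sn); lra.
have DnD n x : a < x -> x + s n <= b -> x < b -> `|D n x - d x| <= C * s n.
  move=> ax xsb xb.
  have ind p : `|D (n + p)%N x - D n x| <= C * (s n - s (n + p)%N).
    elim: p => [|p IH]; first by rewrite addn0 !subrr normr0 mulr0.
    rewrite addnS (_ : D _ _ - _ = (D (n + p).+1 x - D (n + p)%N x) + (D (n + p)%N x - D n x)); last by ring.
    apply: (le_trans (ler_normD _ _)).
    have sle : s (n + p)%N <= s n.
      by rewrite /s /step_x lef_pV2 ?posrE ?exprn_gt0// ler_eXn2l ?ltr1n// leq_addr.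
    have := @DS (n + p)%N x (ltW ax); rewrite (le_trans _ xsb) ?lerD2l// => /(_ isT).
    by move: IH; lra.
  have cv : `|D (n + p)%N x - D n x| @[p --> \oo] --> `|d x - D n x|.
    apply: cvg_norm; apply: cvgB; last exact: cvg_cst.
    have := cvd x ax xb; rewrite -(cvg_shiftn n); apply: cvg_trans; apply: near_eq_cvg.
    by apply: nearW => p /=; rewrite addnC.
  rewrite distrC; apply: (cvgn_le (m0:=0%N) cv) => p _; apply: (le_trans (ind p)).
  by rewrite ler_wpM2l// gerBl ltW.
have Dmul n x j : a < x -> x + s n *+ j + s n <= b ->
    `|D n (x + s n *+ j) - D n x| <= C * (s n *+ j).
  move=> ax; elim: j => [|j IH] xb; first by rewrite !mulr0n addr0 subrr normr0 mulr0.
  have sn := sp n.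
  have xb' : x + s n *+ j + s n <= b by move: xb; rewrite mulrSr; lra.
  have := sec n (x + s n *+ j.+1).
  rewrite (_ : x + s n *+ j.+1 - s n = x + s n *+ j); last by rewrite mulrSr; ring.
  have aj : a <= x + s n *+ j by rewrite (le_trans (ltW ax))// lerDl mulrn_wge0// ltW.
  move=> /(_ aj xb) h.
  have e : x + s n *+ j.+1 = x + s n *+ j + s n by rewrite mulrSr addrA.
  have dj : D n (x + s n *+ j.+1) - D n (x + s n *+ j) =
     (f (x + s n *+ j.+1 + s n) - 2 * f (x + s n *+ j.+1) + f (x + s n *+ j)) / s n.
    by rewrite /D -e; field; rewrite gt_eqF.
  rewrite (_ : D n _ - D n x = (D n (x + s n *+ j.+1) - D n (x + s n *+ j)) + (D n (x + s n *+ j) - D n x)); last by ring.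
  apply: (le_trans (ler_normD _ _)); rewrite dj normrM normfV (gtr0_norm sn).
  have h2 : `|f (x + s n *+ j.+1 + s n) - 2 * f (x + s n *+ j.+1) + f (x + s n *+ j)| / s n <= C * s n.
    by rewrite ler_pdivrMr// -mulrA -expr2.
  have eC : C * (s n *+ j.+1) = C * s n + C * (s n *+ j) by rewrite (mulrS (s n) j) mulrDr.
  by rewrite eC; exact: (lerD h2 (IH xb')).
move=> x y ax xy yb.
have yb0 : 0 < b - y by rewrite subr_gt0.
(* Compare at the scale [s m], after moving [y] to the dyadic point
   [x + j s_(2m)], where the slopes are within [O(s m)] of their limits. *)
have s0 : s @ \oo --> 0 by exact: step_x_cvg0.
have [m0 _ Hm0] : \forall m \near \oo, `|s m| <= b - y.
  by have /cvgr0Pnorm_le/(_ _ yb0) := s0.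
have bound m : (m0 <= m)%N -> `|d y - d x| <= C * (y - x) + (4 * C + 2 * L) * s m.
  move=> hm; have sm := sp m; have smb : s m <= b - y by have := Hm0 _ hm; rewrite gtr0_norm.
  pose n := (m + m)%N; have sn := sp n.
  have snm : s n = s m * s m by rewrite /s /step_x exprD invfM.
  have sm1 : s m <= 1 by exact: step_x_le1.
  pose j := Num.truncn ((y - x) / s n); pose y' := x + s n *+ j.
  have quo : 0 <= (y - x) / s n by rewrite divr_ge0 ?subr_ge0// ltW.
  have /andP[j1 j2] := truncn_itv quo.
  rewrite ler_pdivlMr// ltr_pdivrMr// in j1 j2.
  have ey' : s n *+ j = j%:R * s n by rewrite mulr_natl.
  have y'y : y' <= y by rewrite /y' ey'; lra.
  have yy' : y - y' <= s n by rewrite /y' ey'; move: j2; rewrite -natr1 mulrDl mul1r; lra.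
  have xy' : x <= y' by rewrite lerDl mulrn_wge0// ltW.
  have snsm : s n <= s m by rewrite snm ger_pMr.
  have h1 : `|D m y - d y| <= C * s m by apply: DnD; lra.
  have h2 : `|D m y' - d y'| <= C * s m by apply: DnD; lra.
  have h3 : `|D n y' - d y'| <= C * s n by apply: DnD; lra.
  have h4 : `|D n x - d x| <= C * s n by apply: DnD; lra.
  have h5 : `|D n y' - D n x| <= C * (y' - x).
    by have := @Dmul n x j ax; rewrite -/y' (_ : s n *+ j = y' - x) ?/y'; [apply; lra|ring].
  (* A quotient at scale [s m] magnifies the displacement [y - y' <= s n] by [1 / s m], which
     [s n = s m * s m] compensates. *)
  have h6 : `|D m y - D m y'| <= 2 * L * s m.
    rewrite (_ : D m y - D m y' = ((f (y + s m) - f (y' + s m)) - (f y - f y')) / s m); last first.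
      by rewrite /D -mulrBl; congr (_ * _); ring.
    rewrite normrM normfV (gtr0_norm sm) ler_pdivrMr//.
    apply: (le_trans (ler_normB _ _)).
    have l1 := lip (y + s m) (y' + s m); have l2 := lip y y'.
    have e1 : `|y + s m - (y' + s m)| = y - y' by rewrite ger0_norm; lra.
    have e2 : `|y - y'| = y - y' by rewrite ger0_norm; lra.
    rewrite e1 in l1; rewrite e2 in l2.
    have l3 : L * (y - y') <= L * (s m * s m) by rewrite ler_wpM2l// -snm.
    by move: l1 l2 l3; lra.
  have h7 : C * (y' - x) <= C * (y - x) by rewrite ler_wpM2l//; lra.
  have h8 : C * s n <= C * s m by rewrite ler_wpM2l.
  move: h1 h2 h3 h4 h5 h6 h7 h8; rewrite !ler_norml.
  move=> /andP[? ?] /andP[? ?] /andP[? ?] /andP[? ?] /andP[? ?] /andP[? ?] ? ?.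
  by apply/andP; split; lra.
apply: (cvgn_ge (m0:=m0) _ bound).
rewrite -[X in _ --> X]addr0 -(mulr0 (4 * C + 2 * L)).
by apply: cvgD; [exact: cvg_cst|exact: cvgMr].
Qed.

End dyadic.

(** * Compact margins, membership in L^p, and the domain *)

Section spaces.
Context {R : realType}.
Implicit Types (z : R * R) (u : R * R -> R).

Lemma compact_margin (K O : set (R * R)) : compact K -> open O -> K `<=` O ->
  exists2 e : R, 0 < e & forall z, K z -> csquare z e `<=` O.
Proof.
move=> cK oO KO.
have := (@compact_near_coveringP (R * R)%type K).1 cK nat \oo
  (fun n z => csquare z n.+1%:R^-1 `<=` O) _.
case=> [z Kz|n0 _ Hn0]; last first.
  exists n0.+1%:R^-1; first by rewrite invr_gt0.
  by move=> z Kz; apply: (Hn0 n0) => /=.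
have [e e0 He] := open_square oO (KO z Kz).
exists (ball z (e / 2), [set n | (Num.truncn (2 / e) < n)%N]).
  split; first by apply: nbhsx_ballx; rewrite divr_gt0.
  by exists (Num.truncn (2 / e)).+1.
move=> [z' n] [/= [b1 b2] hn] z'' [h1 h2]; apply: He.
have ne : n.+1%:R^-1 <= e / 2 :> R.
  rewrite -[leRHS]invrK lef_pV2 ?posrE ?invr_gt0 ?divr_gt0// invf_div.
  apply: (le_trans (ltW (truncnS_gt _))); rewrite ler_nat.
  exact: leq_trans hn (leqnSn n).
rewrite /ball/= in b1 b2; split.
- rewrite (_ : z''.1 - z.1 = (z''.1 - z'.1) - (z.1 - z'.1)); last by ring.
  by apply: (le_trans (ler_normB _ _)); move: h1 b1 ne; move: `|_| `|_| _^-1 => a b c; lra.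
- rewrite (_ : z''.2 - z.2 = (z''.2 - z'.2) - (z.2 - z'.2)); last by ring.
  by apply: (le_trans (ler_normB _ _)); move: h2 b2 ne; move: `|_| `|_| _^-1 => a b c; lra.
Qed.

Lemma measurable_compact2 (K : set (R * R)) : compact K -> measurable K.
Proof.
move=> cK; rewrite -[K]setCK; apply: measurableC; apply: open_measurable2.
by apply: closed_openC; exact: compact_closed.
Qed.

Lemma locally_bounded_locally_integrable2 (O : set (R * R)) u : open O ->
  measurable_fun setT u ->
  (forall K, compact K -> K `<=` O -> exists C : R, forall z, K z -> `|u z| <= C) ->
  locally_integrable2 O u.
Proof.
move=> oO mu H; split=> //; first exact: measurable_funTS.
move=> K cK KO; have [C HC] := H K cK KO; have [m _ Km] := compact_csquare cK.
have mK : measurable (K : set (plane R)) by exact: measurable_compact2.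
apply: measurable_bounded_integrable => //.
- apply: le_lt_trans (lebesgue2_csquare_lty (0, 0) m); apply: le_measure => //; rewrite inE//.
  exact: measurable_csquare.
- exact: measurable_funTS.
- exists C; split; first exact: num_real.
  by move=> x Cx z Kz; exact: le_trans (HC z Kz) (ltW Cx).
Qed.

Lemma in_Lp_bounded (p C m : R) (D : set (R * R)) u : 1 < p -> measurable D ->
  D `<=` csquare (0, 0) m -> measurable_fun setT u -> (forall z, D z -> `|u z| <= C) ->
  in_Lp p D u.
Proof.
move=> p1 mD Dm mu uC; have p0 : 0 < p by lra.
have mr : measurable_fun [set: plane R] (u \_ D).
  by apply/(measurable_restrictT _ _).1 => //; exact: measurable_funTS.
have rC z : `|(u \_ D) z| <= Num.max C 0.
  rewrite patchE; case: ifPn => [|_]; last by rewrite normr0 le_max lexx orbT.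
  by rewrite inE => Dz; rewrite le_max uC.
pose w z := `|(u \_ D) z| `^ p.
have iw : (lebesgue2 R).-integrable setT (fun z => (w z)%:E).
  apply: (@bounded_integrable2 _ w (Num.max C 0 `^ p) (0, 0) m).
  - exact: (measurableT_comp (measurable_powR p) (measurableT_comp (@normr_measurable R setT) mr)).
  - move=> z; rewrite /w ger0_norm ?powR_ge0// ge0_ler_powR ?nnegrE ?(ltW p0)//.
    by rewrite le_max lexx orbT.
  - move=> z hz; rewrite /w patchE; case: ifPn => [|_]; last by rewrite normr0 powR0// gt_eqF.
    by rewrite inE => /Dm /hz.
rewrite /in_Lp inE; apply/andP; split; first by rewrite inE.
rewrite inE/= /finite_norm unlock.
apply: poweR_lty; have /integrableP[_] := iw; apply: le_lt_trans.
rewrite le_eqVlt; apply/orP; left; apply/eqP; apply: eq_integral => z _.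
by rewrite /= (ger0_norm (powR_ge0 _ _)).
Qed.

Lemma add_dir_x z (c : R) : z + c *: dir_x R = (z.1 + c, z.2).
Proof. by case: z => x t; congr pair; rewrite /= ?mulr1 ?mulr0 ?addr0// /GRing.scale/= ?mulr1 ?mulr0 ?addr0. Qed.

Lemma add_dir_t z (c : R) : z + c *: dir_t R = (z.1, z.2 + c).
Proof. by case: z => x t; congr pair; rewrite /= ?mulr1 ?mulr0 ?addr0// /GRing.scale/= ?mulr1 ?mulr0 ?addr0. Qed.

Lemma open_Qopen (k1 T : R) : open (Qopen k1 T).
Proof.
have -> : Qopen k1 T = [set z : R * R | z.1 < ln k1] `&` ([set z | 0 < z.2] `&` [set z | z.2 < T]).
  by apply/seteqP; split=> -[x t] /=; [move=> [? /andP[? ?]]|move=> [? [? ?]]]; split => //; apply/andP.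
by apply: openI; last apply: openI;
  [apply: (open_comp (f:=fst) (D:=[set x : R | x < ln k1]))|apply: (open_comp (f:=snd) (D:=[set x : R | 0 < x]))
  |apply: (open_comp (f:=snd) (D:=[set x : R | x < T]))];
  first [by move=> *; exact: cvg_fst|by move=> *; exact: cvg_snd|exact: open_lt|exact: open_gt].
Qed.

(** The two sets differ by part of the line [t = T], which is null. Weak derivatives live on the
    open set, the inequalities of the problem on the half-closed one. *)
Lemma ae_Qset (k1 T : R) (P : R * R -> Prop) :
  {ae lebesgue2 R, forall z, Qopen k1 T z -> P z} -> {ae lebesgue2 R, forall z, Qset k1 T z -> P z}.
Proof.
move=> H; have N0 : {ae lebesgue2 R, forall z, z.2 != T}.
  exists [set z | z.2 = T]; split.
  - have -> : [set z : R * R | z.2 = T] = setT `*` [set T].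
      by apply/seteqP; split=> -[x t] //= [_ ->].
    exact: measurableX.
  - apply: lebesgue2_null_xsection => [|x].
      have -> : [set z : R * R | z.2 = T] = setT `*` [set T].
        by apply/seteqP; split=> -[x t] //= [_ ->].
      exact: measurableX.
    exists [set T]; split=> //; first exact: lebesgue_measure_set1.
    by move=> t /= /contrapT.
  - by move=> z /= /negP; rewrite negbK => /eqP.
apply: ae2S (ae2_and H N0) => z [h zT] [h1 /andP[h2 h3]]; apply: h; split=> //.
by rewrite h2 lt_neqAle zT.
Qed.

End spaces.

(** * Weak derivatives of a function satisfying the limit estimates *)

Section regularity.
Context {R : realType} (K1 k1 M : R) (Y : R * R -> R).
Let s := @step_x R.
Let a := ln k1.
Let l := ln K1.
Hypotheses (k10 : 0 < k1) (Yc : continuous Y) (YM : forall z, `|Y z| <= M).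
Hypothesis Yt : forall x t t', t <= t' -> Y (x, t) <= Y (x, t').
Hypothesis Yx : forall x y t, x <= y -> 0 <= Y (y, t) - Y (x, t) <= expR y - expR x.
Hypothesis Ylip : forall x y t, `|Y (x, t) - Y (y, t)| <= k1 * `|x - y|.
Hypothesis Yloc : forall rho : R, 0 < rho -> exists2 C : R, 0 <= C &
  forall x t t', rho <= `|x - l| \/ rho <= t -> t <= t' -> Y (x, t') - Y (x, t) <= C * (t' - t).
Hypothesis Ylo : exists2 C : R, 0 <= C & forall i x t, x + s i <= a ->
  - (C * s i ^+ 2) <= Y (x + s i, t) - 2 * Y (x, t) + Y (x - s i, t).
Hypothesis Yup : forall rho : R, 0 < rho -> exists2 C : R, 0 <= C & forall i x t,
  (forall y, `|y - x| <= s i -> rho <= `|y - l|) \/ rho <= t ->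
  Y (x + s i, t) - 2 * Y (x, t) + Y (x - s i, t) <= C * s i ^+ 2.

Let sp := @step_x_gt0 R.
Let mY : measurable_fun setT Y. Proof. exact: continuous_measurable2. Qed.
Let left_half : set (R * R) := [set z | z.1 < a].

Let left_half_open : open left_half.
Proof. by apply: (open_comp (f:=fst) (D:=[set x : R | x < a])); [move=> *; exact: cvg_fst|exact: open_lt]. Qed.

Let small (e : R) : 0 < e -> exists n0, forall n, (n0 <= n)%N -> s n <= e.
Proof.
move=> e0; have [n0 _ H] : \forall n \near \oo, `|s n| <= e.
  by have /cvgr0Pnorm_le/(_ _ e0) := @step_x_cvg0 R.
by exists n0 => n /H; rewrite gtr0_norm.
Qed.

Let quo (u : R * R -> R) v n z := (u (z + s n *: v) - u z) / s n.

Let mquo u v n : measurable_fun setT u -> measurable_fun setT (quo u v n).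
Proof.
move=> mu; apply: measurable_funM; last exact: measurable_cst.
by apply: measurable_funB => //; exact: measurable_shift2.
Qed.

Let Yinc n x t : 0 <= Y (x + s n, t) - Y (x, t) <= expR (x + s n) - expR x.
Proof. by apply: Yx; rewrite lerDl ltW. Qed.

(** The lower bound on second differences is a semiconvexity: it makes the quotient plus
    [C / 2 * s n] eventually nonincreasing in [n]. Being nonnegative, this quantity converges, at
    every point. *)
Let x_slope_cvg z : left_half z -> exists l : R, quo Y (dir_x R) n z @[n --> \oo] --> l.
Proof.
case: z => x t; rewrite /left_half/= => xa.
have [C C0 HC] := Ylo.
have [|n0 Hn0] := small (e := a - x); first by rewrite subr_gt0.
pose e_ n := quo Y (dir_x R) n (x, t) + C / 2 * s n.
have e0 n : 0 <= e_ n.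
  apply: addr_ge0; last by apply: mulr_ge0; [exact: divr_ge0|exact/ltW/sp].
  rewrite /quo add_dir_x/= divr_ge0 ?(ltW (sp n))//.
  by have /andP[] := Yinc n x t.
have eS n : (n0 <= n)%N -> e_ n.+1 <= e_ n.
  move=> hn; have sn := sp n; have snS := @step_xS R n.
  have := HC n.+1 (x + s n.+1) t; rewrite addrK -addrA (_ : s n.+1 + s n.+1 = s n); last first.
    by rewrite /s snS; field.
  have h1 : x + s n <= a by have := Hn0 n hn; lra.
  move=> /(_ h1) h; rewrite /e_ /quo !add_dir_x/=.
  have -> : (Y (x + s n.+1, t) - Y (x, t)) / s n.+1 = (Y (x + s n, t) - Y (x, t)) / s n -
      (Y (x + s n, t) - 2 * Y (x + s n.+1, t) + Y (x, t)) / s n.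
    by rewrite /s snS; field; rewrite gt_eqF.
  have h2 : - (C * s n.+1 ^+ 2) / s n <= (Y (x + s n, t) - 2 * Y (x + s n.+1, t) + Y (x, t)) / s n.
    by rewrite ler_pM2r// invr_gt0.
  have h3 : - (C * s n.+1 ^+ 2) / s n = - (C * s n / 4).
    by rewrite /s snS; field; rewrite gt_eqF.
  have h4 : C / 2 * s n.+1 = C * s n / 4 by rewrite /s snS; field.
  have h5 : C / 2 * s n = 2 * (C * s n / 4) by field.
  rewrite h3 in h2; rewrite h4 h5; move: h2; move: (_ / s n) (_ / s n) (C * s n / 4) => A B D.
  by lra.
have cve : cvgn (fun n => e_ (n + n0)%N).
  apply: nonincreasing_is_cvgn; last by exists 0 => _ [n _ <-].
  by apply/nonincreasing_seqP => n; rewrite addSn; apply: eS; rewrite leq_addl.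
have [L HL] : exists L : R, e_ n @[n --> \oo] --> L.
  by exists (limn (fun n => e_ (n + n0)%N)); rewrite -(cvg_shiftn n0).
exists L; rewrite (_ : (fun n => _) = (fun n => e_ n - C / 2 * s n)); last first.
  by apply/funext => n; rewrite /e_ addrK.
rewrite -[L]subr0 -(mulr0 (C / 2)); apply: cvgB => //; apply: cvgMr; exact: step_x_cvg0.
Qed.

Lemma x_derivative_exists : exists g : R * R -> R,
  [/\ measurable_fun setT g,
      forall z, z.1 < a -> (Y (z + s n *: dir_x R) - Y z) / s n @[n --> \oo] --> g z,
      forall z, 0 <= g z <= k1 & forall z, g z <= expR z.1].
Proof.
have [g [mg gc g0 _]] := quotient_limit (mquo (dir_x R) ^~ mY) (open_measurable2 left_half_open).
have qcv z : z.1 < a -> (Y (z + s n *: dir_x R) - Y z) / s n @[n --> \oo] --> g z.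
  by move=> za; apply: gc => //; exact: x_slope_cvg.
exists g; split=> //.
- move=> z; have [->|[za cv]] := g0 z; first by rewrite lexx ltW.
  apply/andP; split.
    apply: (cvgn_ge (m0:=0%N) cv) => n _; case: z {za cv} => x t.
    rewrite /quo add_dir_x/= divr_ge0 ?(ltW (sp n))//.
    by have /andP[] := Yinc n x t.
  apply: (cvgn_le (m0:=0%N) cv) => n _; case: z {za cv} => x t.
  rewrite /quo add_dir_x/= ler_pdivrMr//; apply: (le_trans (ler_norm _)).
  by apply: (le_trans (Ylip _ _ _)); rewrite addrAC subrr add0r gtr0_norm.
- move=> z; have [->|[za cv]] := g0 z; first exact: expR_ge0.
  have E : expR (z.1 + s n) @[n --> \oo] --> expR z.1.
    apply: (cvg_comp (fun n => z.1 + s n) expR); last exact: continuous_expR.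
    suff : z.1 + s n @[n --> \oo] --> z.1 + 0 by rewrite addr0.
    by apply: cvgD; [exact: cvg_cst|exact: step_x_cvg0].
  apply: (le_cvgn (m0:=0%N) cv E) => n _; case: z {za cv E} => x t.
  rewrite /quo add_dir_x/= ler_pdivrMr//.
  have /andP[_ h] := Yinc n x t.
  apply: (le_trans h); have -> : expR x = expR (x + s n) * expR (- s n) by rewrite -expRD addrK.
  have : expR (x + s n) * (1 + - s n) <= expR (x + s n) * expR (- s n).
    by rewrite ler_wpM2l ?expR_ge0// expR_ge1Dx.
  by rewrite mulrDr mulr1 mulrN; lra.
Qed.

Section second_order.
Context (g : R * R -> R) (mg : measurable_fun setT g).
Context (gc : forall z, z.1 < a -> (Y (z + s n *: dir_x R) - Y z) / s n @[n --> \oo] --> g z).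

Lemma x_derivative_lip (rho : R) : 0 < rho -> exists2 C : R, 0 <= C &
  forall x y t : R, (forall w : R, x <= w <= y -> 2 * rho <= `|w - l|) \/ rho <= t ->
    x <= y -> y < a -> `|g (y, t) - g (x, t)| <= C * (y - x).
Proof.
move=> r0; have [C1 C10 H1] := Ylo; have [C2 C20 H2] := Yup r0.
exists (C1 + C2) => [|x y t hx xy ya]; first exact: addr_ge0.
have ayr : Num.min a (y + rho) <= y + rho by rewrite ge_min lexx orbT.
have aya : Num.min a (y + rho) <= a by rewrite ge_min lexx.
(* Stencils may leave [[x, y]] by [rho], so the distance [2 * rho] assumed on [[x, y]] leaves [rho].
   The right end is cut at [a], where the lower bound on second differences stops. *)
apply: (@dyadic_slope_lip R (fun w => Y (w, t)) (fun w => g (w, t)) (x - rho) (Num.min a (y + rho)) _ k1) => //.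
- exact: addr_ge0.
- exact: ltW.
- move=> i w w1 w2; rewrite ler_norml; apply/andP; split.
    have h := H1 i w t (le_trans w2 aya); apply: le_trans h.
    by rewrite lerN2 ler_wpM2r ?sqr_ge0// lerDl.
  have h : Y (w + s i, t) - 2 * Y (w, t) + Y (w - s i, t) <= C2 * s i ^+ 2.
    apply: H2; case: hx => [hx|]; [left=> v|by right].
    rewrite ler_norml => /andP[v1 v2]; have si : 0 < s i := sp i.
    have w1' : x - rho <= w - s i := w1.
    have w2' : w + s i <= y + rho := le_trans w2 ayr.
    have vw : x - rho <= v <= y + rho by apply/andP; split; lra.
    have [vx|xv] := ltP v x.
      have := hx x; rewrite lexx xy => /(_ isT) hh.
      have := ler_distD v x l; rewrite (ger0_norm (_ : 0 <= x - v)); last by lra.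
      by move: vw => /andP[? ?] => ?; lra.
    have [yv|vy] := ltP y v.
      have := hx y; rewrite lexx xy => /(_ isT) hh.
      have := ler_distD v y l; rewrite (ler0_norm (_ : y - v <= 0)); last by lra.
      by move: vw => /andP[? ?] => ?; lra.
    by have := hx v; rewrite xv vy => /(_ isT); lra.
  by apply: (le_trans h); rewrite ler_wpM2r ?sqr_ge0// lerDr.
- move=> w _ wa; have := gc (z:=(w, t)) (lt_le_trans wa aya).
  by under eq_fun do rewrite add_dir_x.
- by lra.
- by rewrite lt_min ya; lra.
Qed.

(** On each horizontal line [t > 0] the function [g] is Lipschitz up to [a], hence differentiable
    almost everywhere, and Fubini makes the set of divergence null. *)
Lemma xx_derivative_exists (T : R) : exists gg : R * R -> R,
  [/\ measurable_fun setT gg,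
      {ae lebesgue2 R, forall z, Qopen k1 T z ->
        (g (z + s n *: dir_x R) - g z) / s n @[n --> \oo] --> gg z} &
      forall rho : R, 0 < rho -> exists2 C : R, 0 <= C & forall z,
        rho <= `|z.1 - l| \/ rho <= z.2 -> `|gg z| <= C].
Proof.
have mQ : measurable (Qopen k1 T) by apply: open_measurable2; exact: open_Qopen.
have [gg [mgg _ gg0 ggae]] := quotient_limit (mquo (dir_x R) ^~ mg) mQ.
exists gg; split=> //.
- apply: ggae => N mN NQ Nc; apply: lebesgue2_null_ysection => // t.
  have [t0|t0] := leP t 0.
    by apply: aeW => x /NQ [_ /=]; rewrite ltNge t0.
  have [C C0 HC] := x_derivative_lip t0.
  have : {ae @lebesgue_measure R, forall x, forall m : nat, - m%:R < x < a - m.+1%:R^-1 ->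
      derivable (fun x => g (x, t)) x 1}.
    apply: ae_foralln => m; apply: (@local_lipschitz_ae_derivable _ _ _ _ C) => x y _ xy ya.
    by apply: HC => //; [right|apply: (le_lt_trans ya); rewrite gtrBl].
  apply: negligibleS => x /= nN Hx; apply: nN => Nx; apply: (Nc _ Nx).
  have /NQ[/= xa _] := Nx.
  pose m := maxn (Num.truncn `|x|).+1 (Num.truncn (a - x)^-1).+1.
  have dm : - m%:R < x < a - m.+1%:R^-1.
    have ax0 : 0 < a - x by rewrite subr_gt0.
    have m1 : `|x| < m%:R by apply: (lt_le_trans (truncnS_gt _)); rewrite ler_nat leq_maxl.
    have m2 : (a - x)^-1 < m.+1%:R.
      by apply: (lt_le_trans (truncnS_gt _)); rewrite ler_nat ltnW// ltnS leq_maxr.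
    have m3 : m.+1%:R^-1 < a - x.
      by rewrite -[ltRHS]invrK ltf_pV2 ?posrE ?invr_gt0.
    by move: m1; rewrite ltr_norml => /andP[-> _]/=; move: m3; move: (_^-1) => v; lra.
  have [L HL] := derivable_quotient_cvg (Hx m dm) sp (@step_x_cvg0 R).
  by exists L; under eq_fun do rewrite /quo add_dir_x.
(* The segment from [x] to [x + s n] has length at most [r], so it stays at distance [2 * r] from
   [l], as [x_derivative_lip] asks. *)
- move=> rho r0; pose r := rho / 3; have r'0 : 0 < r by rewrite divr_gt0.
  have [C C0 HC] := x_derivative_lip r'0; exists C => // -[x t] hx.
  have [->|[[xa _] cv]] := gg0 (x, t); first by rewrite normr0.
  have [|n0 Hn0] := small (e := Num.min r ((a - x) / 2)).
    by rewrite lt_min r'0 divr_gt0 ?subr_gt0.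
  apply: (cvgn_le (m0:=n0) (cvg_norm cv)) => n hn; have sn := sp n.
  have := Hn0 n hn; rewrite le_min => /andP[s1 s2].
  rewrite /quo add_dir_x normrM normfV (gtr0_norm sn) ler_pdivrMr//.
  have := HC x (x + s n) t; rewrite (_ : x + s n - x = s n); last by ring.
  have sa : x + s n < a by move: xa s2; rewrite /= -/a; lra.
  apply; [|by rewrite lerDl ltW|exact: sa].
  case: hx => /= hx; [left=> w /andP[w1 w2]|by right; rewrite /r; lra].
  have := ler_distD w x l; rewrite (ler0_norm (_ : x - w <= 0)); last by lra.
  by move: hx s1; rewrite /r => ? ? ?; lra.
Qed.

End second_order.

Lemma t_derivative_exists (T : R) : exists h : R * R -> R,
  [/\ measurable_fun setT h,
      {ae lebesgue2 R, forall z, Qopen k1 T z ->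
        (Y (z + s n *: dir_t R) - Y z) / s n @[n --> \oo] --> h z},
      forall z, 0 <= h z &
      forall rho : R, 0 < rho -> exists2 C : R, 0 <= C & forall z,
        rho <= `|z.1 - l| \/ rho <= z.2 -> `|h z| <= C].
Proof.
have mQ : measurable (Qopen k1 T) by apply: open_measurable2; exact: open_Qopen.
have [h [mh _ h0 hae]] := quotient_limit (mquo (dir_t R) ^~ mY) mQ.
exists h; split=> //.
- apply: hae => N mN NQ Nc; apply: lebesgue2_null_xsection => // x.
  have : {ae @lebesgue_measure R, forall t, forall m : nat, m.+1%:R^-1 < t < m%:R ->
      derivable (fun t => Y (x, t)) t 1}.
    apply: ae_foralln => m.
    have m0 : 0 < m.+1%:R^-1 :> R by rewrite invr_gt0.
    have [C C0 HC] := Yloc m0.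
    apply: (@local_lipschitz_ae_derivable _ _ _ _ C) => t t' mt tt _.
    by rewrite ger0_norm ?subr_ge0 ?Yt// HC//; right.
  apply: negligibleS => t /= nN Ht; apply: nN => Nt; apply: (Nc _ Nt).
  have /NQ[_ /andP[/= t0 _]] := Nt.
  pose m := maxn (Num.truncn t).+1 (Num.truncn t^-1).+1.
  have dm : m.+1%:R^-1 < t < m%:R.
    have m1 : t < m%:R by apply: (lt_le_trans (truncnS_gt _)); rewrite ler_nat leq_maxl.
    have m2 : t^-1 < m.+1%:R.
      by apply: (lt_le_trans (truncnS_gt _)); rewrite ler_nat ltnW// ltnS leq_maxr.
    by rewrite m1 andbT -[ltRHS]invrK ltf_pV2 ?posrE ?invr_gt0.
  have [L HL] := derivable_quotient_cvg (Ht m dm) sp (@step_x_cvg0 R).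
  by exists L; under eq_fun do rewrite /quo add_dir_t.
- move=> z; have [->//|[_ cv]] := h0 z.
  apply: (cvgn_ge (m0:=0%N) cv) => n _; case: z {cv} => x t.
  rewrite /quo add_dir_t/= divr_ge0 ?(ltW (sp n))// subr_ge0 Yt// lerDl.
  exact: ltW.
- move=> rho r0; have [C C0 HC] := Yloc r0; exists C => // -[x t] hx.
  have [->|[_ cv]] := h0 (x, t); first by rewrite normr0.
  apply: (cvgn_le (m0:=0%N) (cvg_norm cv)) => n _; have sn := sp n.
  rewrite /quo add_dir_t normrM normfV (gtr0_norm sn) ler_pdivrMr//.
  have st : t <= t + s n by rewrite lerDl ltW.
  rewrite ger0_norm ?subr_ge0 ?Yt//; have := HC x t _ hx st.
  by rewrite (_ : t + s n - t = s n)//; ring.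
Qed.

Lemma value_Wp (p T : R) : 1 < p -> exists Dx Dxx Dt,
  [/\ Wp_with p K1 k1 T Y Dx Dxx Dt, (forall z, 0 <= Dt z) & (forall z, 0 <= Dx z <= expR z.1)].
Proof.
move=> p1.
have [Dx [mx xc xb xe]] := x_derivative_exists.
have [Dxx [mxx xxc xxb]] := xx_derivative_exists mx xc T.
have [Dt [mt tc t0 tb]] := t_derivative_exists T.
have oQ := @open_Qopen R k1 T.
have xb' z : `|Dx z| <= k1 by have /andP[h1 h2] := xb z; rewrite ger0_norm.
(* A compact subset of the open domain stays away from [t = 0] and from [x = a], so the local bounds
   apply through their alternative [rho <= t]. *)
have margin (K : set (R * R)) : compact K -> K `<=` Qopen k1 T ->
    exists2 e : R, 0 < e & forall z, K z -> e <= z.2 /\ z.1 + e < a.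
  move=> cK KQ; have [e e0 He] := compact_margin cK oQ KQ; exists e => // z Kz.
  have [|_ /andP[/= h _]] := He z Kz (z.1, z.2 - e).
    split=> /=; first by rewrite subrr normr0 ltW.
    by rewrite (_ : z.2 - e - z.2 = - e) ?normrN ?gtr0_norm//; ring.
  have [|/= h' _] := He z Kz (z.1 + e, z.2).
    split=> /=; last by rewrite subrr normr0 ltW.
    by rewrite (_ : z.1 + e - z.1 = e) ?gtr0_norm//; ring.
  by split=> //; move: h; rewrite subr_gt0 => /ltW.
have li (u : R * R -> R) : measurable_fun setT u -> (forall rho : R, 0 < rho -> exists2 C : R, 0 <= C &
      forall z : R * R, rho <= `|z.1 - l| \/ rho <= z.2 -> `|u z| <= C) -> locally_integrable2 (Qopen k1 T) u.
  move=> mu H; apply: locally_bounded_locally_integrable2 => // K cK KQ.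
  have [e e0 He] := margin K cK KQ; have [C _ HC] := H e e0.
  by exists C => z /He[h _]; apply: HC; right.
have bd (u : R * R -> R) (C : R) : (forall z, `|u z| <= C) -> forall rho : R, 0 < rho -> exists2 C : R, 0 <= C &
      forall z : R * R, rho <= `|z.1 - l| \/ rho <= z.2 -> `|u z| <= C.
  by move=> H rho _; exists C => [|z _]; [exact: le_trans (normr_ge0 _) (H (0, 0))|exact: H].
have mQ (rad rho : R) : measurable (Qpunctured K1 k1 T rad rho : set (R * R)).
  apply: measurableD; apply: open_measurable2.
    have -> : [set z : R * R | [/\ z.1 < ln k1, - rad < z.1 < rad & 0 < z.2 < T]] =
        Qopen k1 T `&` ([set z | - rad < z.1] `&` [set z | z.1 < rad]).
      by apply/seteqP; split=> z /=; [move=> [? /andP[? ?] ?]|move=> [[? ?] [? ?]]]; split=> //; apply/andP.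
    apply: openI => //; apply: openI.
      by apply: (open_comp (f:=fst) (D:=[set x : R | - rad < x])); [move=> *; exact: cvg_fst|exact: open_gt].
    by apply: (open_comp (f:=fst) (D:=[set x : R | x < rad])); [move=> *; exact: cvg_fst|exact: open_lt].
  apply: (open_comp (f:=fun z : R * R => (z.1 - l) ^+ 2 + (z.2 - 0) ^+ 2) (D:=[set x : R | x < rho ^+ 2])); last exact: open_lt.
  move=> z _; rewrite /= ; apply: cvgD.
    by under eq_fun do rewrite expr2; apply: cvgM; (apply: cvgB; [exact: cvg_fst|exact: cvg_cst]).
  by under eq_fun do rewrite expr2; apply: cvgM; (apply: cvgB; [exact: cvg_snd|exact: cvg_cst]).
have Lp (u : R * R -> R) (rad rho : R) : 0 < rad -> 0 < rho -> measurable_fun setT u -> (forall rho : R, 0 < rho -> exists2 C : R, 0 <= C &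
      forall z : R * R, rho <= `|z.1 - l| \/ rho <= z.2 -> `|u z| <= C) -> in_Lp p (Qpunctured K1 k1 T rad rho) u.
  (* Outside the disc of radius [rho], one of the coordinates relative to [(l, 0)] is at least
     [rho / 2] in absolute value. *)
  move=> rad0 rho0 mu H; have [|C _ HC] := H (rho / 2); first by rewrite divr_gt0.
  apply: (@in_Lp_bounded _ p C (Num.max rad T)) => //.
    move=> z [[_ /andP[h1 h2] /andP[h3 h4]] _]; split; rewrite /= subr0 le_max.
      by rewrite ler_norml (ltW h1) (ltW h2).
    by rewrite (gtr0_norm h3) (ltW h4) orbT.
  move=> z [[_ _ /andP[h3 _]] /= hd]; apply: HC.
  have [h|h] := leP (rho / 2) `|z.1 - l|; first by left.
  have [h'|h'] := leP (rho / 2) z.2; [by right|exfalso; apply: hd].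
  rewrite /disc/= subr0 -[X in X + _]real_normK ?num_real//.
  have n0 := normr_ge0 (z.1 - l).
  have q1 : `|z.1 - l| ^+ 2 <= (rho / 2) ^+ 2 by rewrite lerXn2r ?nnegrE ?normr_ge0 ?divr_ge0 ?(ltW rho0) ?(ltW h).
  have q2 : z.2 ^+ 2 <= (rho / 2) ^+ 2 by rewrite lerXn2r ?nnegrE ?divr_ge0 ?(ltW rho0) ?(ltW h3) ?(ltW h').
  have q3 : 0 < rho ^+ 2 by rewrite exprn_gt0.
  apply: (le_lt_trans (lerD q1 q2)); rewrite !expr2; move: q3; rewrite expr2; lra.
have wx (phi : R * R -> R) : test_function (Qopen k1 T) phi ->
    \int[lebesgue2 R]_(z in Qopen k1 T) (Y z * 'D_(dir_x R) phi z) =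
    - \int[lebesgue2 R]_(z in Qopen k1 T) (Dx z * phi z).
  apply: (@weak_derivative_quotients _ _ _ _ _ s M) => //; first exact: step_x_cvg0.
    by apply: aeW => z [za _]; exact: xc.
  move=> K _ _; exists k1, 0%N => n -[x t] _ _; rewrite add_dir_x.
  by apply: (le_trans (Ylip _ _ _)); rewrite addrAC subrr add0r gtr0_norm.
exists Dx, Dxx, Dt; split=> //; last first.
  by move=> z; have /andP[-> _] := xb z; rewrite xe.
split.
- exact: continuous_subspaceT.
- split; [exact: li mY (bd _ _ YM)|exact: li mx (bd _ _ xb')|].
  by move=> phi t1; rewrite /= expr1 mulN1r; exact: wx.
- split; [exact: li mY (bd _ _ YM)|exact: li|].
  move=> phi t1; rewrite /= expr2 mulN1r opprK mul1r.
  (* Two integrations by parts: [Y] against the derivative of [phi], then [Dx] against [phi]. *)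
  rewrite (wx _ (test_iter_derive [:: dir_x R] t1)) /=.
  rewrite (@weak_derivative_quotients _ _ _ Dxx _ s k1) ?opprK//; first exact: step_x_cvg0.
  move=> K cK KQ; have [e e0 He] := margin K cK KQ; have [C C0 HC] := x_derivative_lip xc e0.
  have [n0 Hn0] := small e0; exists C, n0 => n -[x t] hn /He[/= h1 h2].
  rewrite add_dir_x/=; have := HC x (x + s n) t; rewrite (_ : x + s n - x = s n); last by ring.
  by apply; [right|rewrite lerDl ltW|have := Hn0 n hn; lra].
- split; [exact: li mY (bd _ _ YM)|exact: li|].
  move=> phi t1; rewrite /= expr1 mulN1r.
  apply: (@weak_derivative_quotients _ _ _ _ _ s M) => //; first exact: step_x_cvg0.
  move=> K cK KQ; have [e e0 He] := margin K cK KQ; have [C C0 HC] := Yloc e0.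
  exists C, 0%N => n -[x t] _ /He[/= h1 h2]; rewrite add_dir_t/=.
  have st : t <= t + s n by rewrite lerDl ltW.
  rewrite ger0_norm ?subr_ge0 ?Yt//; have := HC x t _ (or_intror h1) st.
  by rewrite (_ : t + s n - t = s n)//; ring.
- move=> rad rho rad0 rho0; split; apply: Lp => //; [exact: bd YM|exact: bd xb'].
Qed.

End regularity.

(** * The variational inequality in the limit *)

(* The formal adjoint of [d/dt - Lop]. *)
Definition adjoint_op {R : realType} (sigma r q : R) (phi : R * R -> R) (z : R * R) : R :=
  r * phi z - 'D_(dir_t R) phi z + (r - q - sigma ^+ 2 / 2) * 'D_(dir_x R) phi z
  - sigma ^+ 2 / 2 * 'D_(dir_x R) ('D_(dir_x R) phi) z.

(* The transpose of one step of the tree, acting on functions of [(x, t)]. *)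
Definition adjoint_step {R : realType} (r b k h : R) (phi : R * R -> R) (z : R * R) : R :=
  expR (r * k) * phi (z + - k *: dir_t R) -
  2^-1 * (phi (z + - (b * k + h) *: dir_x R) + phi (z + - (b * k - h) *: dir_x R)).

(** * Transposition and consistency of the scheme *)

Section transpose.
Context {R : realType}.
Implicit Types (u phi : R * R -> R) (z c : R * R).

Lemma Rintegral_lin3 (f0 f1 f2 : R * R -> R) (c : R) :
  (lebesgue2 R).-integrable setT (fun z => (f0 z)%:E) ->
  (lebesgue2 R).-integrable setT (fun z => (f1 z)%:E) ->
  (lebesgue2 R).-integrable setT (fun z => (f2 z)%:E) ->
  \int[lebesgue2 R]_z (c * f0 z - 2^-1 * (f1 z + f2 z)) =
  c * \int[lebesgue2 R]_z f0 z - 2^-1 * (\int[lebesgue2 R]_z f1 z + \int[lebesgue2 R]_z f2 z).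
Proof.
move=> i0 i1 i2.
have i12 : (lebesgue2 R).-integrable setT (fun z => (f1 z + f2 z)%:E) by exact (integrableD measurableT i1 i2).
have i0' : (lebesgue2 R).-integrable setT (fun z => (c * f0 z)%:E) by exact (integrableZl measurableT c i0).
have i12' : (lebesgue2 R).-integrable setT (fun z => (2^-1 * (f1 z + f2 z))%:E) by exact (integrableZl measurableT 2^-1 i12).
apply: (etrans (RintegralB measurableT i0' i12')).
by rewrite (RintegralZl c measurableT i0) (RintegralZl 2^-1 measurableT i12) (RintegralD measurableT i1 i2).
Qed.

Lemma tree_transpose Omega u phi (Cu alpha : R) (c0 c1 c2 : R * R) :
  measurable_fun setT u -> (forall z, `|u z| <= Cu) -> test_function Omega phi ->
  \int[lebesgue2 R]_z ((alpha * u (z + c0) - 2^-1 * (u (z + c1) + u (z + c2))) * phi z) =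
  \int[lebesgue2 R]_z (u z * (alpha * phi (z - c0) - 2^-1 * (phi (z - c1) + phi (z - c2)))).
Proof.
move=> mu uC t0; have mphi := measurable_test t0.
have [Cq Cq0 HCq] := test_bounded t0; have [m m0 Hm] := test_support t0.
pose F c z := u z * phi (z - c).
have mF c : measurable_fun setT (F c) by apply: measurable_funM => //; exact: measurable_shift2.
have FC c z : `|F c z| <= Cu * Cq by rewrite normrM; apply: ler_pM.
have iF c : (lebesgue2 R).-integrable setT (fun z => (F c z)%:E).
  apply: (bounded_integrable2 (c:=(0,0)) (m:=m + (`|c.1| + `|c.2|)) (mF c) (FC c)) => z hz.
  rewrite /F (test_shift_support (S:=`|c.1| + `|c.2|) Hm _ _ hz) ?mulr0//= normrN ?lerDl ?lerDr//.
pose G c z := u (z + c) * phi z.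
have GE c z : F c (z + c) = G c z by rewrite /F addrK.
have mG c : measurable_fun setT (G c) by apply: measurable_funM => //; exact: measurable_shift2.
have GC c z : `|G c z| <= Cu * Cq by rewrite normrM; apply: ler_pM.
have iG c : (lebesgue2 R).-integrable setT (fun z => (G c z)%:E).
  apply: (bounded_integrable2 (c:=(0,0)) (m:=m) (mG c) (GC c)) => z hz.
  by rewrite /G Hm ?mulr0.
have T c : \int[lebesgue2 R]_z G c z = \int[lebesgue2 R]_z F c z.
  have <- := integral_shift2 c (mF c) (iF c).
  by apply: eq_Rintegral => z _; rewrite GE.
transitivity (\int[lebesgue2 R]_z (alpha * G c0 z - 2^-1 * (G c1 z + G c2 z))).
  by apply: eq_Rintegral => z _; rewrite /G; ring.
rewrite Rintegral_lin3// !T -Rintegral_lin3//.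
by apply: eq_Rintegral => z _; rewrite /F; ring.
Qed.

Lemma expR_taylor1 (x : R) : 0 <= x -> 0 <= expR x - 1 - x <= x ^+ 2 * expR x.
Proof.
move=> x0; have e1 := expR_ge1Dx x; have e2 := expR_ge1Dx (- x); have e0 := expR_gt0 x.
have m : expR x * expR (- x) = 1 by rewrite -expRD subrr expR0.
have h : expR x - 1 <= x * expR x.
  have : expR x * (1 + - x) <= expR x * expR (- x) by rewrite ler_wpM2l// ltW.
  by rewrite m; lra.
apply/andP; split; first by lra.
have h2 : x * (expR x - 1) <= x * (x * expR x) by rewrite ler_wpM2l.
by rewrite expr2 -mulrA; lra.
Qed.

(** The terms of first order in [h] of the two moves cancel, and [h^2 = sigma^2 * k] turns their
    second-order terms into the diffusion. The rest is of order [h^3], so the error is still O(h)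
    after division by [k]. *)
Lemma scheme_consistency Omega phi (sigma r q : R) : 0 < sigma -> 0 < r -> test_function Omega phi ->
  exists2 C : R, 0 <= C & forall (h k : R) z, 0 < h -> h <= 1 -> k = h ^+ 2 / sigma ^+ 2 ->
    `|adjoint_step r (r - q - sigma ^+ 2 / 2) k h phi z - k * adjoint_op sigma r q phi z| <= C * h ^+ 3.
Proof.
move=> sg0 r0 t0; set b := r - q - _.
have [C1 C10 H1] := test_taylor1 (dir_t R) t0.
have [C2 C20 H2] := test_taylor2 (dir_t R) t0.
have [C3 C30 H3] := test_taylor2 (dir_x R) t0.
have [F0 F00 HF0] := test_bounded t0.
have [F1 F10 HF1] := test_bounded (test_iter_derive [:: dir_t R; dir_t R] t0).
have [F2 F20 HF2] := test_bounded (test_iter_derive [:: dir_x R; dir_x R] t0).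
pose kap := (sigma ^+ 2)^-1; have kap0 : 0 < kap by rewrite invr_gt0 exprn_gt0.
pose B : R := `|b| * kap + 1.
have B0 : 0 <= B by rewrite addr_ge0// mulr_ge0// ltW.
pose E := expR (r * kap).
have E0 : 0 <= E by exact: expR_ge0.
pose c1 := r ^+ 2 * kap ^+ 2 * E * F0; pose c2 := r * C1 * kap ^+ 2.
pose c3 := C2 * kap ^+ 3; pose c4 := kap ^+ 2 * F1; pose c5 := b ^+ 2 * kap ^+ 2 * F2.
pose c6 := C3 * B ^+ 3.
have kp : 0 <= kap by exact: ltW.
have c10 : 0 <= c1 by rewrite /c1 !mulr_ge0 ?exprn_ge0// ltW.
have c20 : 0 <= c2 by rewrite /c2 !mulr_ge0 ?exprn_ge0// ltW.
have c30 : 0 <= c3 by rewrite /c3 !mulr_ge0 ?exprn_ge0.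
have c40 : 0 <= c4 by rewrite /c4 !mulr_ge0 ?exprn_ge0.
have c50 : 0 <= c5 by rewrite /c5 mulr_ge0// mulr_ge0 ?sqr_ge0.
have c60 : 0 <= c6 by rewrite /c6 !mulr_ge0 ?exprn_ge0.
exists (c1 + c2 + c3 + c4 + c5 + c6); first by rewrite !addr_ge0.
move=> h k z h0 h1 kE; have hp : 0 <= h by exact: ltW.
have kE' : k = kap * h ^+ 2 by rewrite kE mulrC.
have k0 : 0 <= k by rewrite kE' mulr_ge0// sqr_ge0.
set H := h ^+ 3; have H0 : 0 <= H by rewrite exprn_ge0.
have h21 : h ^+ 2 <= h by rewrite expr2 ler_piMl.
have kk : k <= kap by rewrite kE' ler_piMr// (le_trans h21).
have kh : k <= kap * h by rewrite kE' ler_wpM2l.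
have k2 : k ^+ 2 <= kap ^+ 2 * H.
  by rewrite kE' exprMn ler_wpM2l ?exprn_ge0// -exprM /H (_ : (2 * 2 = 3.+1)%N)// exprSr ler_piMr// exprn_ge0.
have k3 : k ^+ 3 <= kap ^+ 3 * H.
  by rewrite kE' exprMn ler_wpM2l ?exprn_ge0// -exprM /H (_ : (2 * 3 = 3 + 3)%N)// exprD ler_piMr ?exprn_ge0// exprn_ile1.
pose f := phi z; pose ft := 'D_(dir_t R) phi z; pose fx := 'D_(dir_x R) phi z.
pose ftt := 'D_(dir_t R) ('D_(dir_t R) phi) z; pose fxx := 'D_(dir_x R) ('D_(dir_x R) phi) z.
pose P := phi (z + - k *: dir_t R).
pose P1 := phi (z + - (b * k + h) *: dir_x R); pose P2 := phi (z + - (b * k - h) *: dir_x R).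
pose A1 := expR (r * k) - 1 - r * k.
pose R3 := P - f + k * ft - k ^+ 2 / 2 * ftt.
pose R1 := P1 - f + (b * k + h) * fx - (b * k + h) ^+ 2 / 2 * fxx.
pose R2 := P2 - f + (b * k - h) * fx - (b * k - h) ^+ 2 / 2 * fxx.
have id0 : adjoint_step r b k h phi z - k * adjoint_op sigma r q phi z =
    A1 * P + r * k * (P - f) + R3 + k ^+ 2 / 2 * ftt - (b * k) ^+ 2 / 2 * fxx - 2^-1 * (R1 + R2).
  rewrite /adjoint_step /adjoint_op -/b -/P -/P1 -/P2 -/f -/ft -/fx -/fxx /A1 /R3 /R1 /R2.
  move: (expR (r * k)) => e.
  have kk2 : k * sigma ^+ 2 = h ^+ 2 by rewrite kE divfK// gt_eqF// exprn_gt0.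
  transitivity (e * P - 2^-1 * (P1 + P2) - k * (r * f - ft + b * fx) + k * sigma ^+ 2 / 2 * fxx).
    by ring.
  by rewrite kk2; field.
have b1 : `|A1 * P| <= c1 * H.
  have rk0 : 0 <= r * k by rewrite mulr_ge0// ltW.
  have /andP[a1 a2] := expR_taylor1 rk0.
  have e1 : (r * k) ^+ 2 * expR (r * k) <= r ^+ 2 * (kap ^+ 2 * H) * E.
    apply: ler_pM; [exact: sqr_ge0|exact: expR_ge0|by rewrite exprMn ler_wpM2l ?sqr_ge0|].
    by rewrite ler_expR ler_wpM2l// ltW.
  rewrite normrM (_ : c1 * H = r ^+ 2 * (kap ^+ 2 * H) * E * F0); last by rewrite /c1; ring.
  by apply: ler_pM => //; [rewrite ger0_norm//; exact: le_trans e1|exact: HF0].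
have b2 : `|r * k * (P - f)| <= c2 * H.
  rewrite normrM ger0_norm ?mulr_ge0 ?(ltW r0)//.
  have := H1 z (- k); rewrite normrN (ger0_norm k0) => h3.
  apply: (le_trans (ler_wpM2l (mulr_ge0 (ltW r0) k0) h3)).
  rewrite (_ : r * k * (C1 * k) = r * C1 * k ^+ 2); last by ring.
  by rewrite /c2 -(mulrA (r * C1)) ler_wpM2l// mulr_ge0// ltW.
have b3 : `|R3| <= c3 * H.
  have := H2 z (- k); rewrite normrN (ger0_norm k0) sqrrN mulNr opprK => h3.
  have c3E : c3 * H = C2 * (kap ^+ 3 * H) by rewrite /c3 -(mulrA C2).
  by rewrite c3E; apply: (le_trans h3); exact: ler_wpM2l.
have b4 : `|k ^+ 2 / 2 * ftt| <= c4 * H.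
  rewrite normrM ger0_norm ?divr_ge0 ?sqr_ge0// (_ : c4 * H = kap ^+ 2 * H * F1); last (by rewrite /c4; ring);  apply: ler_pM => //; last exact: HF1.
    by rewrite divr_ge0 ?sqr_ge0.
  by apply: le_trans k2; rewrite ler_pdivrMr// ler_peMr ?sqr_ge0// ler1n.
have b5 : `|(b * k) ^+ 2 / 2 * fxx| <= c5 * H.
  rewrite normrM ger0_norm ?divr_ge0 ?sqr_ge0// (_ : c5 * H = b ^+ 2 * (kap ^+ 2 * H) * F2); last (by rewrite /c5; ring);  apply: ler_pM => //; last exact: HF2.
    by rewrite divr_ge0 ?sqr_ge0.
  rewrite exprMn -(mulrA (b ^+ 2)) ler_wpM2l ?sqr_ge0//.
  by apply: le_trans k2; rewrite ler_pdivrMr// ler_peMr ?sqr_ge0// ler1n.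
have bk : `|b * k| <= `|b| * kap * h by rewrite normrM (ger0_norm k0) -mulrA ler_wpM2l.
have cube (x : R) : `|x| <= B * h -> `|x| ^+ 3 <= B ^+ 3 * H.
  by move=> hx; rewrite /H -exprMn lerXn2r// nnegrE mulr_ge0.
have b6 : `|R1| <= c6 * H.
  have := H3 z (- (b * k + h)); rewrite normrN sqrrN mulNr opprK => h3.
  apply: (le_trans h3); rewrite /c6 -(mulrA C3); apply: ler_wpM2l => //; apply: cube.
  by apply: (le_trans (ler_normD _ _)); rewrite (ger0_norm hp) /B (mulrDl (`|b| * kap) 1 h) mul1r lerD2r.
have b7 : `|R2| <= c6 * H.
  have := H3 z (- (b * k - h)); rewrite normrN sqrrN mulNr opprK => h3.
  apply: (le_trans h3); rewrite /c6 -(mulrA C3); apply: ler_wpM2l => //; apply: cube.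
  by apply: (le_trans (ler_normB _ _)); rewrite (ger0_norm hp) /B (mulrDl (`|b| * kap) 1 h) mul1r lerD2r.
rewrite id0 (_ : (c1 + c2 + c3 + c4 + c5 + c6) * H = c1 * H + c2 * H + c3 * H + c4 * H + c5 * H + c6 * H); last by ring.
move: b1 b2 b3 b4 b5 b6 b7.
move: (A1 * P) (r * k * (P - f)) (k ^+ 2 / 2 * ftt) ((b * k) ^+ 2 / 2 * fxx) (R1) (R2) (R3).
move: (c1 * H) (c2 * H) (c3 * H) (c4 * H) (c5 * H) (c6 * H) => d1 d2 d3 d4 d5 d6 x1 x2 x3 x4 x5 x6 x7.
rewrite !ler_norml => /andP[? ?] /andP[? ?] /andP[? ?] /andP[? ?] /andP[? ?] /andP[? ?] /andP[? ?].
by apply/andP; split; lra.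
Qed.

End transpose.

(** * Passage to the limit in the tested recursion *)

Section weak_equation.
Context {R : realType} (K1 k1 k2 K2 sigma r q : R).
Context (hK1 : 0 < K1) (hK1k1 : K1 < k1) (hk1k2 : k1 < k2) (hk2K2 : k2 < K2).
Context (hsigma : 0 < sigma) (hr : 0 < r) (hq : 0 <= q).
Let b := r - q - sigma ^+ 2 / 2.
Let h := @step_x R.
Let k := step_t sigma.
Let V := tree_fun K1 k1 K2 sigma r q.
Let h0 N : 0 < h N. Proof. exact: step_x_gt0. Qed.
Let k0 N : 0 < k N. Proof. exact: step_t_gt0. Qed.
Let h1 N : h N <= 1. Proof. exact: step_x_le1. Qed.
Let M := K2 - K1.

(** The plane splits into countably many strips with a fixed number of steps, on each of which the
    function depends on [x] alone, continuously. *)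
Lemma measurable_tree_fun N : measurable_fun setT (V N).
Proof.
have kN : 0 < k N := k0 N.
pose E n : set (R * R) := [set z | Num.truncn (z.2 / k N) = n].
have mE n : measurable (E n).
  have -> : E n = setT `*` [set t | Num.truncn (t / k N) = n].
    by apply/seteqP; split=> -[x t] //= [].
  apply: measurableX => //; apply: is_interval_measurable => x y /= xn yn t /andP[xt ty].
  have mono (a c : R) : a <= c -> (Num.truncn (a / k N) <= Num.truncn (c / k N))%N.
    by move=> ac; apply: le_truncn; rewrite ler_pM2r ?invr_gt0.
  by apply/eqP; rewrite eqn_leq -{1}yn -{1}xn !mono.
have -> : [set: R * R] = \bigcup_n E n.
  by apply/seteqP; split=> // z _; exists (Num.truncn (z.2 / k N)).
apply/(measurable_fun_bigcup _ mE) => n.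
pose w x := V N (x, k N *+ n).
have cw : continuous w.
  have kp : 0 < k1 by move: (hK1) (hK1k1) => *; lra.
  move=> x; apply/cvgrPdist_le => e e0; near=> y.
  apply: (le_trans (tree_fun_lip_x hK1 hK1k1 hk1k2 hk2K2 hsigma hr hq N x y _)).
  rewrite mulrC -ler_pdivlMr//; near: y; apply: cvgr_dist_le => //.
  by rewrite divr_gt0.
apply: (eq_measurable_fun (w \o fst)).
  move=> [x t]; rewrite inE /E/= => tn; rewrite /w /V /tree_fun /=; congr (tree_value _ _ _ _ _ _ _).
  by rewrite -mulr_natl mulfK ?gt_eqF// natrK tn.
apply: measurable_funTS; apply: (measurableT_comp (f:=w)); last exact: measurable_fst.
exact: continuous_measurable_fun.
Unshelve. all: by end_near.
Qed.

Lemma tree_fun_norm N z : `|V N z| <= M.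
Proof.
have /andP[g1 g2] := tree_fun_bounds q hK1k1 hk1k2 hk2K2 hsigma hr N z.
rewrite ger0_norm//; apply: le_trans g1; exact: (obstacle_ge0 hK1 hK1k1 hk1k2 hk2K2).
Qed.

Context (Y : R * R -> R) (s : nat -> nat) (Yc : continuous Y).
Context (sm : forall m, (m <= s m)%N).
Context (sY : forall (m : nat) (z : R * R), `|z.1| <= m%:R -> `|z.2| <= m%:R ->
         `|V (s m) z - Y z| <= m.+1%:R^-1).

Let residual N z := expR (r * k N) * V N (z + k N *: dir_t R) -
  2^-1 * (V N (z + (b * k N + h N) *: dir_x R) + V N (z + (b * k N - h N) *: dir_x R)).

(** Transposition puts the scheme on [phi], which can be expanded by Taylor's formula; bounded
    pointwise convergence of the tree values then suffices. *)
Let residual_cvg Omega phi : test_function Omega phi ->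
  \int[lebesgue2 R]_z (residual (s m) z * phi z) / k (s m) @[m --> \oo] -->
  \int[lebesgue2 R]_z (Y z * adjoint_op sigma r q phi z).
Proof.
move=> t0; have [C C0 HC] := scheme_consistency q hsigma hr t0.
have mphi := measurable_test t0; have [m m0 Hm] := test_support t0.
have [F F0 HF] : exists2 F : R, 0 <= F & forall z, `|adjoint_op sigma r q phi z| <= F.
  have [F0 F00 HF0] := test_bounded t0.
  have [F1 F10 HF1] := test_bounded (test_iter_derive [:: dir_t R] t0).
  have [F2 F20 HF2] := test_bounded (test_iter_derive [:: dir_x R] t0).
  have [F3 F30 HF3] := test_bounded (test_iter_derive [:: dir_x R; dir_x R] t0).
  exists (r * F0 + F1 + `|b| * F2 + sigma ^+ 2 / 2 * F3).
    by rewrite !addr_ge0 ?mulr_ge0 ?divr_ge0 ?sqr_ge0// ltW.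
  move=> z; rewrite /adjoint_op.
  apply: (le_trans (ler_normB _ _)); apply: lerD; last first.
    by rewrite normrM ger0_norm ?divr_ge0 ?sqr_ge0// ler_wpM2l ?divr_ge0 ?sqr_ge0//; exact: HF3.
  apply: (le_trans (ler_normD _ _)); apply: lerD; last by rewrite normrM ler_wpM2l//; exact: HF2.
  apply: (le_trans (ler_normB _ _)); apply: lerD; last exact: HF1.
  by rewrite normrM (gtr0_norm hr) ler_wpM2l// ltW.
pose A N z := adjoint_step r b (k N) (h N) phi z / k N.
have AE N z : `|A N z - adjoint_op sigma r q phi z| <= C * sigma ^+ 2 * h N.
  have e := HC (h N) (k N) z (h0 N) (h1 N) erefl; have kn := gt_eqF (k0 N).
  have -> : A N z - adjoint_op sigma r q phi z =
     (adjoint_step r b (k N) (h N) phi z - k N * adjoint_op sigma r q phi z) / k N.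
    by rewrite /A; field; rewrite kn.
  rewrite normrM normfV (gtr0_norm (k0 N)) ler_pdivrMr//; apply: (le_trans e).
  have s0 : sigma != 0 by rewrite gt_eqF.
  by rewrite le_eqVlt; apply/orP; left; apply/eqP; rewrite /k /step_t -/(h N); field.
have mt s' : measurable_fun setT (iter_derive s' phi) by exact: measurable_test (test_iter_derive s' t0).
have mA N : measurable_fun setT (A N).
  apply: measurable_funM; last exact: measurable_cst.
  apply: measurable_funB; apply: measurable_funM; try exact: measurable_cst; first exact: measurable_shift2.
  by apply: measurable_funD; exact: measurable_shift2.
have mQ : measurable_fun setT (adjoint_op sigma r q phi).
  apply: measurable_funB; last first.
    by apply: measurable_funM; [exact: measurable_cst|exact: (mt [:: dir_x R; dir_x R])].
  apply: measurable_funD; last by apply: measurable_funM; [exact: measurable_cst|exact: (mt [:: dir_x R])].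
  by apply: measurable_funB; [apply: measurable_funM => //; exact: measurable_cst|exact: (mt [:: dir_t R])].
have M0 : 0 <= M by exact: le_trans (normr_ge0 _) (tree_fun_norm 0 (0, 0)).
have mY : measurable_fun setT Y by exact: continuous_measurable2.
have cvgh : h (s i) @[i --> \oo] --> 0.
  apply: cvg_comp (@step_x_cvg0 R); apply/cvgnyPge => a.
  by exists a => // i /= ai; exact: leq_trans ai (sm i).
pose kap := (sigma ^+ 2)^-1; have kap0 : 0 <= kap by rewrite invr_ge0 sqr_ge0.
pose S : R := `|b| * kap + 1 + kap.
have kle N : k N <= kap.
  by rewrite /k /step_t ler_piMl// exprn_ile1 ?h1// ltW// h0.
have bk N : `|b * k N| <= `|b| * kap by rewrite normrM (gtr0_norm (k0 N)) ler_wpM2l.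
have A0 N z : ~ csquare (0, 0) (m + S) z -> V N z * A N z = 0.
  move=> hz; rewrite /A /adjoint_step.
  have Z c : `|c.1| <= S -> `|c.2| <= S -> phi (z + c) = 0.
    by move=> c1 c2; exact: (test_shift_support Hm c1 c2 hz).
  have S0 : 0 <= S by rewrite !addr_ge0// mulr_ge0.
  have b0 : 0 <= `|b| * kap by rewrite mulr_ge0.
  have hp := h1 N; have hg := h0 N; have kl := kle N; have kg := k0 N; have bl := bk N.
  have z1 (c : R) : `|c| <= S -> phi (z + c *: dir_x R) = 0.
    by move=> cS; apply: Z; rewrite /= /GRing.scale/= ?mulr1 ?mulr0 ?normr0.
  have z2 (c : R) : `|c| <= S -> phi (z + c *: dir_t R) = 0.
    by move=> cS; apply: Z; rewrite /= /GRing.scale/= ?mulr1 ?mulr0 ?normr0.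
  rewrite z1 ?z1 ?z2 ?addr0 ?mulr0 ?subr0 ?mul0r ?mulr0//.
  + by rewrite normrN gtr0_norm// (le_trans kl)// /S; lra.
  + rewrite normrN; apply: (le_trans (ler_normB _ _)); rewrite (gtr0_norm hg) /S; lra.
  + rewrite normrN; apply: (le_trans (ler_normD _ _)); rewrite (gtr0_norm hg) /S; lra.
have VAC N z : `|V N z * A N z| <= M * (F + C * sigma ^+ 2).
  rewrite normrM; apply: ler_pM => //; first exact: tree_fun_norm.
  rewrite -[A _ _](subrK (adjoint_op sigma r q phi z)) addrC.
  apply: (le_trans (ler_normD _ _)); apply: lerD => //; apply: (le_trans (AE _ _)).
  by rewrite ler_piMr// mulr_ge0// sqr_ge0.
have mVA N : measurable_fun setT (fun z => V N z * A N z).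
  by apply: measurable_funM => //; exact: measurable_tree_fun.
have iVA N : (lebesgue2 R).-integrable setT (fun z => (V N z * A N z)%:E).
  exact: (bounded_integrable2 (mVA N) (VAC N) (A0 N)).
have L : \int[lebesgue2 R]_z (V (s i) z * A (s i) z) @[i --> \oo] -->
    \int[lebesgue2 R]_z (Y z * adjoint_op sigma r q phi z).
  apply: (@dominated_cvg2 R _ _ (M * (F + C * sigma ^+ 2)) (0, 0) (m + S)) => //.
  - exact: measurable_funM.
  - by move=> i z hz; exact: A0.
  - apply: aeW => z; apply: cvgM; first exact: value_cvg sY z.
    apply/cvgrPdistC_le => e e0.
    have : C * sigma ^+ 2 * h (s i) @[i --> \oo] --> C * sigma ^+ 2 * 0 by exact: cvgMr.
    rewrite mulr0 => /cvgr0Pnorm_le/(_ e e0); apply: filterS => i hi.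
    by apply: (le_trans (AE _ _)); exact: le_trans (ler_norm _) hi.
move: L; apply: cvg_trans; apply: near_eq_cvg; apply: nearW => i.
have := tree_transpose (expR (r * k (s i))) (k (s i) *: dir_t R) ((b * k (s i) + h (s i)) *: dir_x R)
  ((b * k (s i) - h (s i)) *: dir_x R) (measurable_tree_fun (s i)) (tree_fun_norm (s i)) t0.
rewrite -/(residual _) => ->.
have kn : k (s i) != 0 by rewrite gt_eqF.
have -> : \int[lebesgue2 R]_z (V (s i) z * A (s i) z) =
    \int[lebesgue2 R]_z (V (s i) z * A (s i) z) * k (s i) / k (s i) by rewrite mulfK.
congr (_ / _); apply: (etrans (esym (RintegralZr (k (s i)) measurableT (iVA (s i))))).
by apply: eq_Rintegral => z _; rewrite /A /adjoint_step !scaleNr -mulrA divfK.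
Qed.

Let residualE N x t : residual N (x, t) = expR (r * k N) * V N (x, t + k N) -
  (V N (x + b * k N + h N, t) + V N (x + b * k N - h N, t)) / 2.
Proof. by rewrite /residual add_dir_t !add_dir_x /= !addrA [_ / 2]mulrC. Qed.

Lemma value_weak_supersolution Omega phi : test_function Omega phi ->
  (forall z, Omega z -> 0 <= z.2) -> (forall z, 0 <= phi z) ->
  0 <= \int[lebesgue2 R]_z (Y z * adjoint_op sigma r q phi z).
Proof.
move=> t0 O0 p0; apply: (cvgn_ge (m0:=0%N) (residual_cvg t0)) => m _.
rewrite divr_ge0 ?(ltW (k0 _))//; apply: Rintegral_ge0 => -[x t] _.
have [Oz|Oz] := pselect (Omega (x, t)); last by rewrite (test_out t0 Oz) mulr0.
rewrite mulr_ge0// residualE subr_ge0; exact: (tree_fun_step_le _ _ _ _ _ hsigma _ _ (O0 _ Oz)).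
Qed.

Lemma value_weak_solution Omega phi : test_function Omega phi ->
  (forall z, Omega z -> 0 <= z.2 /\ obstacle K1 k1 K2 z.1 < Y z) ->
  \int[lebesgue2 R]_z (Y z * adjoint_op sigma r q phi z) = 0.
Proof.
move=> t0 O0; have [_ cK KO] := t0; set K := closure _ in cK KO.
(* Written as the trace of [Y] at time 0, the obstacle inherits the Lipschitz bound of [Y] in
   [x]. *)
have gE (z : R * R) : obstacle K1 k1 K2 z.1 = Y (z.1, 0).
  by rewrite (@value_init R K1 k1 K2 sigma r q hsigma Y s sY).
have gc : continuous (fun z : R * R => Y z - Y (z.1, 0)).
  move=> z; apply: cvgB; first exact: Yc.
  have kp : 0 < k1 by move: (hK1) (hK1k1) => *; lra.
  have c1 : z'.1 @[z' --> z] --> z.1 by exact: cvg_fst.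
  apply/cvgrPdist_le => e e0; have e0' : 0 < e / k1 by rewrite divr_gt0.
  have /cvgrPdist_le/(_ _ e0') := c1; apply: filterS => z' hz'.
  apply: (le_trans (value_lip_x hK1 hK1k1 hk1k2 hk2K2 hsigma hr hq sY _ _ _)).
  by rewrite mulrC -ler_pdivlMr.
(* On the compact support, the strict inequality with the obstacle passes from [Y] to [V (s m)] for
   all large [m]; the residual then vanishes there. *)
have := (@compact_near_coveringP (R * R)%type K).1 cK nat \oo
  (fun m z => obstacle K1 k1 K2 z.1 < V (s m) z) _.
case=> [z Kz|m0 _ Hm0].
  have [_ gz] := O0 z (KO z Kz); rewrite gE -subr_gt0 in gz.
  pose d := (Y z - Y (z.1, 0)) / 2; have d0 : 0 < d by rewrite divr_gt0.
  have n1 : nbhs z [set z' | `|(Y z - Y (z.1, 0)) - (Y z' - Y (z'.1, 0))| < d].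
    by have /cvgrPdist_lt/(_ d d0) := gc z.
  pose m1 := maxn (maxn (Num.truncn (`|z.1| + 1)).+1 (Num.truncn (`|z.2| + 1)).+1) (Num.truncn d^-1).+1.
  exists ([set z' | `|(Y z - Y (z.1, 0)) - (Y z' - Y (z'.1, 0))| < d] `&` ball z 1, [set m | (m1 <= m)%N]).
    by split; [apply: filterI => //; exact: nbhsx_ballx|exists m1].
  move=> [z' m] [/= [h3 [b1 b2]] hm]; rewrite /ball/= in b1 b2.
  rewrite gE; move: hm; rewrite !geq_max => /andP[/andP[e1 e2] e3].
  have q1 : `|z'.1| <= m%:R.
    apply: (le_trans (_ : _ <= `|z.1| + 1)); last first.
      by apply: (le_trans (ltW (truncnS_gt _))); rewrite ler_nat.
    rewrite -[z'.1](subrKC z.1); apply: (le_trans (ler_normD _ _)); rewrite lerD2l distrC; exact: ltW.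
  have q2 : `|z'.2| <= m%:R.
    apply: (le_trans (_ : _ <= `|z.2| + 1)); last first.
      by apply: (le_trans (ltW (truncnS_gt _))); rewrite ler_nat.
    rewrite -[z'.2](subrKC z.2); apply: (le_trans (ler_normD _ _)); rewrite lerD2l distrC; exact: ltW.
  have := sY q1 q2; have q3 : m.+1%:R^-1 < d.
    rewrite -[ltRHS]invrK ltf_pV2 ?posrE ?invr_gt0//.
    by apply: (lt_le_trans (truncnS_gt _)); rewrite ler_nat ltnW.
  have d2 : Y z - Y (z.1, 0) = 2 * d by rewrite /d; field.
  move: h3 q3 d2; rewrite ltr_norml ler_norml.
  move: (d) (m.+1%:R^-1 : R) (Y z) (Y (z.1, 0)) (Y z') (Y (z'.1, 0)) (V (s m) z') => D v y1 y2 y3 y4 y5.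
  by move=> /andP[? ?] ? ? /andP[? ?]; lra.
rewrite -(cvg_lim (@Rhausdorff R) (residual_cvg t0)).
apply: (cvg_lim (@Rhausdorff R)); apply: cvg_near_cst; exists m0 => // m hm.
have -> : \int[lebesgue2 R]_z (residual (s m) z * phi z) = \int[lebesgue2 R]_z (0 : R).
  apply: eq_Rintegral => -[x t] _.
  have [Kz|Kz] := pselect (K (x, t)); last first.
    have -> : phi (x, t) = 0 by apply: contrapT => /eqP H; apply/Kz/subset_closure.
    by rewrite mulr0.
  have [/= tp _] := O0 _ (KO _ Kz).
  by rewrite residualE (tree_fun_step_eq hsigma tp (Hm0 m hm _ Kz)) subrr mul0r.
by rewrite /Rintegral integral0 mul0r.
Qed.

End weak_equation.

(** * Bump functions and signs of locally integrable functions *)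

Section flat_functions.
Context {R : realType}.

(** All powers [k] are kept because the derivative of [flat k] is [flat k.+2 - k * flat k.+1]: the
    linear span of the family is closed under differentiation. *)
Definition flat (k : nat) (x : R) : R := if 0 < x then x^-1 ^+ k * expR (- x^-1) else 0.

Lemma flat_ge0 k x : 0 <= flat k x.
Proof. by rewrite /flat; case: ifP => // x0; rewrite mulr_ge0 ?expR_ge0// exprn_ge0// invr_ge0 ltW. Qed.

Lemma flat0_le1 x : flat 0 x <= 1.
Proof.
rewrite /flat; case: ifP => // x0; rewrite expr0 mul1r -[leRHS]expR0 ler_expR.
by rewrite oppr_le0 invr_ge0 ltW.
Qed.

Lemma flat_gt0 k x : 0 < x -> 0 < flat k x.
Proof. by move=> x0; rewrite /flat x0 mulr_gt0 ?expR_gt0// exprn_gt0// invr_gt0. Qed.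

Lemma flat_le0 k x : x <= 0 -> flat k x = 0.
Proof. by move=> x0; rewrite /flat ltNge x0. Qed.

(** With [y = 1 / x], raise [y / k <= expR (y / k)] to the power [k]. *)
Lemma flat_bound k x : flat k x <= k%:R ^+ k.
Proof.
rewrite /flat; case: ifP => x0; last by rewrite exprn_ge0.
set y := x^-1; have y0 : 0 < y by rewrite invr_gt0.
have h : y ^+ k <= k%:R ^+ k * expR y.
  case: k => [|k]; first by rewrite !expr0 mul1r -[leLHS]expR0 ler_expR ltW.
  have {1}-> : y = k.+1%:R * (y / k.+1%:R) by rewrite mulrC divfK.
  rewrite exprMn ler_wpM2l ?exprn_ge0//.
  have -> : expR y = expR (y / k.+1%:R) ^+ k.+1 by rewrite -expRM_natl mulrC divfK.
  rewrite lerXn2r ?nnegrE ?expR_ge0 ?divr_ge0 ?(ltW y0)//.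
  by have := expR_ge1Dx (y / k.+1%:R); move: (y / _) => v; lra.
have e : expR y * expR (- y) = 1 by rewrite -expRD subrr expR0.
apply: (le_trans (ler_wpM2r (expR_ge0 (- y)) h)).
by rewrite -mulrA e mulr1.
Qed.

Lemma near_is_derive (V : normedModType R) (f g : V -> R) (x v : V) d :
  (\near x, f x = g x) -> is_derive x v f d -> is_derive x v g d.
Proof.
move=> fg [df dfE]; split; first exact: near_eq_derivable fg df.
by rewrite -(near_eq_derive v fg).
Qed.

Lemma is_derive_flat (k : nat) (x : R) : is_derive x 1 (flat k) (flat k.+2 x - k%:R * flat k.+1 x).
Proof.
have [x0|x0|->] := ltgtP x 0.
- rewrite !flat_le0 ?ltW// mulr0 subr0; have h : is_derive x (1 : R) (cst (0 : R)) 0 by exact: is_derive_cst.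
  apply: near_is_derive h.
  near=> y; rewrite flat_le0// ltW//; near: y; exact: lt_nbhsl.
- pose F (y : R) := (y^-1) ^+ k * expR (- y^-1).
  apply: (@near_is_derive _ F).
    near=> y; rewrite /flat /F ifT//; near: y; exact: lt_nbhsr.
  have xn : x != 0 by rewrite gt_eqF.
  have di : is_derive x 1 (fun y : R => y^-1) (- x ^- 2 *: 1) by apply: (is_deriveV xn).
  have dk := is_deriveX k di.
  have E (m : nat) : (fun y : R => y^-1) ^+ m = (fun y : R => y^-1 ^+ m).
    elim: m => [|m IH]; first by apply/funext => y; rewrite !expr0.
    by rewrite exprS IH; apply/funext => y; rewrite exprS.
  rewrite E in dk.
  have dn := is_deriveN di.
  have de : is_derive x 1 (expR \o (- (fun y : R => y^-1))) (expR (- x^-1) * (- (- x ^- 2 *: 1))).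
    exact: (is_derive1_comp (is_derive_expR _) dn).
  have dF := is_deriveM dk de.
  apply: (is_derive_eq dF).
  rewrite /flat x0 /= /GRing.scale /= fctE !mulr1 /=.
  have -> : x ^- 2 = x^-1 * x^-1 by rewrite -exprVn expr2.
  move: (expR (- x^-1)) => e; move: (x^-1) => y.
  by case: k {dk dF F} => [|m] /=; rewrite ?mulr0n ?mul0r ?exprS; ring.
- rewrite !flat_le0// mulr0 subr0.
  have H : (fun h : R => h^-1 *: (flat k (h *: 1 + 0) - flat k 0)) @ 0^' --> (0 : R).
    apply/cvgrPdist_le => e e0; near=> h.
    have h0 : h != 0 by near: h; exact: nbhs_dnbhs_neq.
    have hC : `|h| <= e / (k.+2%:R ^+ k.+2).
      near: h; apply: dnbhs0_le; rewrite divr_gt0// exprn_gt0//.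
    rewrite sub0r normrN (@flat_le0 k 0 (lexx 0)) subr0 addr0 /GRing.scale /= mulr1 normrM normfV.
    rewrite ler_pdivrMl ?normr_gt0// (ger0_norm (flat_ge0 _ _)).
    have [hl|hg] := leP h 0; first by rewrite flat_le0// mulr_ge0// ltW.
    (* For [h > 0] the difference quotient at 0 is [h * flat k.+2 h], and [flat k.+2] is bounded. *)
    have -> : flat k h = h ^+ 2 * flat k.+2 h.
      have hh : h * h^-1 = 1 by rewrite divff.
      rewrite /flat hg !exprS; transitivity ((h * h^-1) ^+ 2 * (h^-1 ^+ k * expR (- h^-1))).
        by rewrite hh expr1n mul1r.
      by move: (expR _) => u; ring.
    rewrite expr2 -mulrA gtr0_norm// ler_wpM2l ?(ltW hg)//.
    rewrite (gtr0_norm hg) ler_pdivlMr ?exprn_gt0// in hC.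
    by apply: le_trans hC; rewrite ler_wpM2l ?(ltW hg)// flat_bound.
  split; first by apply/cvg_ex; exists 0.
  exact: (cvg_lim (@Rhausdorff R) H).
Unshelve. all: by end_near.
Qed.

Lemma continuous_flat k : continuous (flat k).
Proof.
by move=> x; apply: differentiable_continuous; apply/derivable1_diffP; have [] := is_derive_flat k x.
Qed.

End flat_functions.

(** * Smooth bumps on boxes *)

Section smooth_bumps.
Context {R : realType}.
Implicit Types (z v : R * R) (f g : R * R -> R).

(* Closed under directional derivatives, hence made of smooth functions. *)
Inductive flat_poly : (R * R -> R) -> Prop :=
| flat_poly_cst c : flat_poly (cst c)
| flat_poly_flat k p u w : flat_poly (fun z => flat k (p + u * z.1 + w * z.2))
| flat_poly_add f g : flat_poly f -> flat_poly g -> flat_poly (f + g)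
| flat_poly_mul f g : flat_poly f -> flat_poly g -> flat_poly (f * g).

Lemma is_derive_along f z v (d : R) :
  is_derive (0 : R) 1 (fun s : R => f (s *: v + z)) d -> is_derive z v f d.
Proof.
have E : (fun h : R => h^-1 *: (f ((h *: 1 + 0) *: v + z) - f (0 *: v + z))) =
    (fun h : R => h^-1 *: (f (h *: v + z) - f z)).
  apply/funext => h; rewrite scale0r add0r addr0.
  by have -> : h *: 1 = h :> R by rewrite /GRing.scale /= mulr1.
by move=> [d1 d2]; split; [move: d1; rewrite /derivable /= E|move: d2; rewrite /derive /= E].
Qed.

Lemma flat_poly_derive f v : flat_poly f ->
  exists2 g, flat_poly g & forall z, is_derive z v f (g z).
Proof.
elim=> [c|k p u w|{}f g _ [f' pf' df] _ [g' pg' dg]|{}f g pf [f' pf' df] pg [g' pg' dg]].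
- by exists (cst 0); [exact: flat_poly_cst|move=> z; exact: is_derive_cst].
- exists (cst (u * v.1 + w * v.2) * ((fun z => flat k.+2 (p + u * z.1 + w * z.2)) +
     cst (- k%:R) * (fun z => flat k.+1 (p + u * z.1 + w * z.2)))).
    apply: flat_poly_mul; first exact: flat_poly_cst.
    apply: flat_poly_add; first exact: flat_poly_flat.
    by apply: flat_poly_mul; [exact: flat_poly_cst|exact: flat_poly_flat].
  move=> z; apply: is_derive_along.
  pose A := p + u * z.1 + w * z.2; pose B := u * v.1 + w * v.2.
  have -> : (fun s : R => flat k (p + u * (s *: v + z).1 + w * (s *: v + z).2)) =
      flat k \o (fun s : R => s * B + A).
    by apply/funext => s /=; congr flat; rewrite /A /B /GRing.scale /=; ring.
  have dl : is_derive (0 : R) 1 (fun s : R => s * B + A) B.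
    have h1 := is_deriveM (is_derive_id (0 : R) (1 : R)) (is_derive_cst B (0 : R) (1 : R)).
    have h2 := is_deriveD h1 (is_derive_cst A (0 : R) (1 : R)).
    by apply: (is_derive_eq h2); rewrite /GRing.scale /= mulr0 add0r mulr1 addr0.
  have h := @is_derive1_comp R (flat k) (fun s => s * B + A) 0 _ B (is_derive_flat k _) dl.
  apply: (is_derive_eq h); rewrite mul0r add0r /= !fctE /= /A /B; ring.
- by exists (f' + g'); [exact: flat_poly_add|move=> z; exact: is_deriveD].
- exists (f * g' + g * f'); first by apply: flat_poly_add; exact: flat_poly_mul.
  by move=> z; exact: is_deriveM.
Qed.

Lemma flat_poly_continuous f : flat_poly f -> continuous f.
Proof.
elim=> [c|k p u w|{}f g _ cf _ cg|{}f g _ cf _ cg] z.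
- exact: cvg_cst.
- apply: (cvg_comp (fun z : R * R => p + u * z.1 + w * z.2) (flat k)); last exact: continuous_flat.
  apply: cvgD; [apply: cvgD; [exact: cvg_cst|]|]; apply: cvgMr; [exact: cvg_fst|exact: cvg_snd].
- by apply: cvgD; [exact: cf|exact: cg].
- by apply: cvgM; [exact: cf|exact: cg].
Qed.

Lemma flat_poly_smooth f : flat_poly f -> smooth f.
Proof.
move=> pf s; have {pf} ps : flat_poly (iter_derive s f).
  elim: s => [//|v s /flat_poly_derive -/(_ v) [g pg dg]] /=.
  suff -> : 'D_v (iter_derive s f) = g by [].
  by apply/funext => z; have [] := dg z.
split; first exact: flat_poly_continuous.
by move=> z v; have [g _ /(_ z)[]] := flat_poly_derive v ps.
Qed.

Let eta_x a b z := flat 0 (z.1 - a) * flat 0 (b - z.1).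
Let eta_t c d z := flat 0 (z.2 - c) * flat 0 (d - z.2).

(** Powers of [1 - eta] are 1 where [eta] vanishes and tend to 0 where it is positive. The support
    thus stays in the closed box while the bumps tend to the indicator of the open one. *)
Definition box_bump (a b c d : R) (n : nat) z : R :=
  (1 - (1 - eta_x a b z) ^+ n) * (1 - (1 - eta_t c d z) ^+ n).

Definition open_box (a b c d : R) : set (R * R) := [set z | a < z.1 < b /\ c < z.2 < d].

Let eta_x01 a b z : 0 <= eta_x a b z <= 1.
Proof. by rewrite mulr_ge0 ?flat_ge0//= mulr_ile1 ?flat_ge0 ?flat0_le1. Qed.
Let eta_t01 a b z : 0 <= eta_t a b z <= 1.
Proof. by rewrite mulr_ge0 ?flat_ge0//= mulr_ile1 ?flat_ge0 ?flat0_le1. Qed.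

Let pow01 (x : R) n : 0 <= x <= 1 -> 0 <= 1 - (1 - x) ^+ n <= 1.
Proof.
move=> /andP[x0 x1]; have h0 : 0 <= 1 - x by rewrite subr_ge0.
have := exprn_ge0 n h0; have : (1 - x) ^+ n <= 1 by rewrite exprn_ile1// gerBl.
by move=> *; apply/andP; split; lra.
Qed.

Lemma box_bump01 a b c d n z : 0 <= box_bump a b c d n z <= 1.
Proof.
have /andP[h1 h2] := pow01 n (eta_x01 a b z); have /andP[h3 h4] := pow01 n (eta_t01 c d z).
by rewrite mulr_ge0//= mulr_ile1.
Qed.

Lemma box_bump_out a b c d n z : ~ open_box a b c d z -> box_bump a b c d n z = 0.
Proof.
move=> hz; have E (x y : R) : ~~ (0 < x) \/ ~~ (0 < y) -> flat 0 x * flat 0 y = 0.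
  by rewrite -!leNgt => -[h|h]; rewrite (flat_le0 0 h) ?mul0r ?mulr0.
have P (x : R) : x = 0 -> 1 - (1 - x) ^+ n = 0 by move=> ->; rewrite subr0 expr1n subrr.
rewrite /box_bump; have [/andP[h1 h2]|h] := boolP (a < z.1 < b); last first.
  rewrite P ?mul0r// /eta_x; apply: E; rewrite !subr_gt0.
  by move: h; rewrite negb_and => /orP[]; [left|right].
have [h|h] := boolP (c < z.2 < d); first by exfalso; apply: hz; split=> //; apply/andP.
rewrite [X in _ * X]P ?mulr0// /eta_t; apply: E; rewrite !subr_gt0.
by move: h; rewrite negb_and => /orP[]; [left|right].
Qed.

Lemma box_bump_cvg a b c d z :
  box_bump a b c d n z @[n --> \oo] --> (\1_(open_box a b c d) z : R).
Proof.
rewrite indicE; have [oz|oz] := pselect (open_box a b c d z); last first.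
  by rewrite memNset//; under eq_fun do rewrite box_bump_out//; exact: cvg_cst.
rewrite mem_set//=; case: oz => /andP[h1 h2] /andP[h3 h4].
have C (x : R) : 0 < x -> x <= 1 -> 1 - (1 - x) ^+ n @[n --> \oo] --> (1 : R).
  move=> x0 x1; rewrite -[X in _ --> X]subr0; apply: cvgB; first exact: cvg_cst.
  by apply: cvg_expr; rewrite ger0_norm ?subr_ge0// gtrBl.
rewrite -[X in _ --> X]mulr1; apply: cvgM; apply: C.
- by rewrite mulr_gt0// flat_gt0// subr_gt0.
- by have /andP[] := eta_x01 a b z.
- by rewrite mulr_gt0// flat_gt0// subr_gt0.
- by have /andP[] := eta_t01 c d z.
Qed.

Lemma compact_box (a b c d : R) : compact ([set z | a <= z.1 <= b /\ c <= z.2 <= d] : set (R * R)).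
Proof.
have -> : [set z : R * R | a <= z.1 <= b /\ c <= z.2 <= d] = `[a, b] `*` `[c, d].
  by apply/seteqP; split=> -[x t] /=; rewrite !in_itv.
by apply: compact_setX; exact: segment_compact.
Qed.

Lemma box_bump_test (O : set (R * R)) a b c d n :
  [set z | a <= z.1 <= b /\ c <= z.2 <= d] `<=` O -> test_function O (box_bump a b c d n).
Proof.
move=> BO; have cB := @compact_box a b c d.
have sub : closure [set z | box_bump a b c d n z != 0] `<=` [set z | a <= z.1 <= b /\ c <= z.2 <= d].
  rewrite [X in _ `<=` X](iffLR (closure_id _) (compact_closed _ cB))//.
  apply: closure_subset => z /= /eqP hz; apply: contrapT => nz; apply: hz; apply: box_bump_out.
  by move=> [/andP[h1 h2] /andP[h3 h4]]; apply: nz; rewrite !ltW.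
split; last exact: subset_trans BO.
- apply: flat_poly_smooth; rewrite /box_bump.
  have pw f m : flat_poly f -> flat_poly (fun z => 1 - (1 - f z) ^+ m).
    move=> pf.
    have p1 : flat_poly (fun z => 1 - f z).
      have -> : (fun z => 1 - f z) = cst 1 + cst (-1) * f by apply/funext => z /=; rewrite !fctE /= mulN1r.
      by apply: flat_poly_add; [exact: flat_poly_cst|apply: flat_poly_mul => //; exact: flat_poly_cst].
    have pm : flat_poly (fun z => (1 - f z) ^+ m).
      elim: m => [|m IH]; first exact: (flat_poly_cst 1).
      have -> : (fun z => (1 - f z) ^+ m.+1) = (fun z => 1 - f z) * (fun z => (1 - f z) ^+ m).
        by apply/funext => z /=; rewrite !fctE /= exprS.
      exact: flat_poly_mul.
    have -> : (fun z => 1 - (1 - f z) ^+ m) = cst 1 + cst (-1) * (fun z => (1 - f z) ^+ m).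
      by apply/funext => z /=; rewrite !fctE /= mulN1r.
    by apply: flat_poly_add; [exact: flat_poly_cst|apply: flat_poly_mul => //; exact: flat_poly_cst].
  have fx k p u w (f : R * R -> R) : (forall z, f z = flat k (p + u * z.1 + w * z.2)) -> flat_poly f.
    by move=> E; rewrite (_ : f = fun z => flat k (p + u * z.1 + w * z.2)); [exact: flat_poly_flat|exact/funext].
  have := @flat_poly_mul (fun z => 1 - (1 - eta_x a b z) ^+ n) (fun z => 1 - (1 - eta_t c d z) ^+ n); apply; apply: pw.
    apply: (@flat_poly_mul (fun z => flat 0 (z.1 - a)) (fun z => flat 0 (b - z.1))).
      by apply: (fx 0%N (- a) 1 0) => z; congr flat; ring.
    by apply: (fx 0%N b (- 1) 0) => z; congr flat; ring.
  apply: (@flat_poly_mul (fun z => flat 0 (z.2 - c)) (fun z => flat 0 (d - z.2))).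
    by apply: (fx 0%N (- c) 0 1) => z; congr flat; ring.
  by apply: (fx 0%N d 0 (- 1)) => z; congr flat; ring.
- by apply: (subclosed_compact _ cB sub); exact: closed_closure.
Qed.

End smooth_bumps.

(** * The sign of a function from its integrals *)

Section fundamental_lemma.
Context {R : realType}.
Implicit Types (g : R * R -> R) (z : R * R).

Lemma ae1_and (P Q : R -> Prop) :
  {ae (@lebesgue_measure R), forall x, P x} -> {ae (@lebesgue_measure R), forall x, Q x} ->
  {ae (@lebesgue_measure R), forall x, P x /\ Q x}.
Proof.
move=> hP hQ; apply: negligibleS (negligibleU hP hQ) => x /= h.
by have [Px|] := pselect (P x); [right => Qx; exact: h|left].
Qed.

(* The indefinite integral is monotone on the rationals, hence has a nonnegative
   derivative wherever it is differentiable. *)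
Lemma ae_ge0_of_interval_integrals (f : R -> R) :
  (@lebesgue_measure R).-integrable setT (EFin \o f) ->
  (forall p q : rat, (p < q)%R -> 0 <= \int[lebesgue_measure]_(x in `]ratr p, ratr q[) f x) ->
  {ae (@lebesgue_measure R), forall x, 0 <= f x}.
Proof.
move=> intf H.
have locf : locally_integrable setT f by apply: open_integrable_locally => //; exact: openT.
have intfy y : lebesgue_measure.-integrable `]-oo, y] (EFin \o f) by apply: integrableS intf.
have := FTC1Ny intfy locf; apply: negligibleS => x /= nf [df fE]; apply: nf.
rewrite leNgt; apply/negP => fx; move: df fE; set F := fun y : R => _ => df fE.
have mono (p q : rat) : p < q -> F (ratr p) <= F (ratr q).
  move=> pq; rewrite -subr_ge0 /F Rintegral_itvB//; last by rewrite bnd_simp ler_rat ltW.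
  rewrite -Rintegral_itv_bndo_bndc; first exact: H.
  by apply: integrableS intf.
have cv : (fun h : R => h^-1 *: (F (h *: 1 + x) - F x)) @ 0^' --> f x.
  by rewrite -fE derive1E; exact: df.
have nf0 : 0 < - f x by rewrite oppr_gt0.
have /cvgrPdist_lt/(_ _ nf0) h1 := cv.
have {h1} /nbhs_ballP[d /= d0 Hd] : nbhs (0 : R) (fun h : R => h != 0 ->
    `|f x - h^-1 *: (F (h *: 1 + x) - F x)| < - f x) := h1.
have key (y : R) : y != x -> `|y - x| < d -> (F y - F x) / (y - x) < 0.
  move=> yx yd; have := Hd (y - x); rewrite /ball/= sub0r normrN subr_eq0 => /(_ yd yx).
  have -> : (y - x) *: 1 + x = y by rewrite /GRing.scale/= mulr1 subrK.
  by rewrite /GRing.scale/= mulrC ltr_norml => /andP[h1 h2]; lra.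
have [|p] := @rat_in_itvoo R (x - d) x; first by rewrite ltrBlDr ltrDl.
rewrite in_itv/= => /andP[p1 p2].
have [|q] := @rat_in_itvoo R x (x + d); first by rewrite ltrDl.
rewrite in_itv/= => /andP[q1 q2].
have := mono p q; rewrite -(ltr_rat R) (lt_trans p2 q1) => /(_ isT) pq.
have p3 : `|ratr p - x| < d.
  by rewrite ltr_norml; move: p1 p2; move: (ratr p : R) => u *; apply/andP; split; lra.
have q3 : `|ratr q - x| < d.
  by rewrite ltr_norml; move: q1 q2; move: (ratr q : R) => u *; apply/andP; split; lra.
have := key _ (negbT (lt_eqF p2)) p3.
rewrite ltr_ndivrMr ?subr_lt0// mul0r subr_gt0 => k1.
have := key _ (negbT (gt_eqF q1)) q3.
rewrite ltr_pdivrMr ?subr_gt0// mul0r subr_lt0 => k2.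
by have := lt_trans k2 k1; rewrite ltNge pq.
Qed.

Lemma lebesgue2_null_ae_xsection (N : set (R * R)) : measurable N ->
  {ae (@lebesgue_measure R), forall x, {ae (@lebesgue_measure R), forall t, ~ N (x, t)}} ->
  lebesgue2 R N = 0%E.
Proof.
move=> mN H; rewrite /lebesgue2 /product_measure1.
rewrite (ae_eq_integral (cst 0%E))//; first by rewrite integral_cst// mul0e.
  exact: measurable_fun_xsection.
apply: negligibleS H => x /= h1 h2; apply: h1 => _ /=.
apply/negligibleP; first exact: measurable_xsection.
by apply: negligibleS h2 => t /=; rewrite /xsection/= inE => h; exact.
Qed.

Lemma measurable_open_box (a b c d : R) : measurable (open_box a b c d).
Proof.
have -> : open_box a b c d = `]a, b[ `*` `]c, d[.
  by apply/seteqP; split=> -[x t] /=; rewrite /open_box/= !in_itv.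
exact: measurableX.
Qed.

(** The one-dimensional criterion is applied twice. For each rational interval, the integral of
    [g (x, .)] over it has nonnegative integrals in [x], so it is nonnegative for almost all [x].
    For almost every [x] this holds for all rational intervals together, and the criterion applies
    to [g (x, .)]. *)
Lemma ae_ge0_of_box_integrals g : measurable_fun setT g ->
  (lebesgue2 R).-integrable setT (EFin \o g) ->
  (forall a b c d, 0 <= \int[lebesgue2 R]_(z in open_box a b c d) g z) ->
  {ae lebesgue2 R, forall z, 0 <= g z}.
Proof.
move=> mg ig H.
pose S (i : rat * rat) : set (plane R) := setT `*` `]ratr i.1, ratr i.2[.
have mS i : measurable (S i) by exact: measurableX.
have iS (D : set (plane R)) : measurable D ->
    (lebesgue2 R).-integrable setT (fun z => ((g \_ D) z)%:E).
  move=> mD; have : (lebesgue2 R).-integrable D (EFin \o g) by apply: integrableS ig.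
  move/(iffLR (integrable_mkcond _ mD)); congr (_.-integrable _ _).
  by apply/funext => z; rewrite restrict_EFin.
pose F i x := (\int[@lebesgue_measure R]_t ((g \_ (S i)) (x, t))%:E)%E.
have iF i : (@lebesgue_measure R).-integrable setT (F i) := integrable_fubini_F (iS _ (mS i)).
have mF i : measurable_fun setT (F i) := measurable_int _ (iF i).
pose G i x := fine (F i x).
have mG i : measurable_fun setT (G i).
  by apply: (measurableT_comp (f:=@fine R)) => //; exact: fine_measurable.
have iG i : (@lebesgue_measure R).-integrable setT (EFin \o G i).
  apply: le_integrable (iF i) => //; first exact/measurable_EFinP.
  by move=> x _; rewrite /G /=; case: (F i x) => [r| |] //=; exact: leey.
have FG i : {ae (@lebesgue_measure R), forall x, F i x = (G i x)%:E}.
  have := integrable_ae measurableT (iF i).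
  by apply: negligibleS => x /= h1 h2; apply: h1; rewrite /G fineK//; exact: h2.
have G0 i : {ae (@lebesgue_measure R), forall x, 0 <= G i x}.
  apply: ae_ge0_of_interval_integrals (iG i) _ => p q pq.
  pose D : set (measurableTypeR R) := `]ratr p, ratr q[%classic.
  have mD : measurable D by exact: measurable_itv.
  have -> : \int[lebesgue_measure]_(x in D) G i x = \int[lebesgue2 R]_(z in open_box (ratr p) (ratr q) (ratr i.1) (ratr i.2)) g z.
    rewrite [RHS]Rintegral_mkcond /Rintegral; congr fine.
    transitivity (\int[lebesgue_measure]_(x in D) F i x)%E.
      apply: ae_eq_integral => //; [by apply/measurable_EFinP; exact: measurable_funTS|exact: measurable_funTS|].
      by apply: negligibleS (FG i) => x /= h1 h2; apply: h1 => _; rewrite h2.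
    rewrite [LHS]integral_mkcond.
    have iB := iS _ (measurable_open_box (ratr p) (ratr q) (ratr i.1) (ratr i.2)).
    rewrite -[RHS](integral12_prod_meas1 iB); apply: eq_integral => x _.
    rewrite patchE /fubini_F; case: ifPn => xD.
      apply: eq_integral => t _; congr EFin; rewrite !patchE.
      rewrite inE /D /= in_itv /= in xD.
      by congr (if _ then _ else _); apply/idP/idP; rewrite !inE /S /open_box /= in_itv /= => -[].
    rewrite -[LHS](@integral0 _ _ _ (@lebesgue_measure R) setT); apply: eq_integral => t _.
    rewrite patchE memNset// => -[h _]; move/negP: xD; apply.
    by rewrite inE /D /= in_itv.
  exact: H.
have G0' : {ae (@lebesgue_measure R), forall x, forall n, if unpickle n is Some i then 0 <= G i x else true}.
  by apply: ae_foralln => n; case: (unpickle n) => [i|]; [exact: G0|exact: aeW].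
have gx : {ae (@lebesgue_measure R), forall x, (@lebesgue_measure R).-integrable setT (fun t => (g (x, t))%:E)}.
  exact: (ae_integrable1 ig).
pose N : set (plane R) := [set z | g z < 0].
have mN : measurable N.
  have -> : N = g @^-1` `]-oo, 0[ by apply/seteqP; split=> z /=; rewrite in_itv.
  by rewrite -[X in measurable X]setTI; exact: mg.
exists N; split=> //; last by move=> z /=; rewrite /N /= => /negP; rewrite -ltNge.
apply: lebesgue2_null_ae_xsection => //.
apply: negligibleS (ae1_and G0' gx) => x /= h1 [h2 h3]; apply: h1.
have : {ae (@lebesgue_measure R), forall t, 0 <= g (x, t)}.
  apply: ae_ge0_of_interval_integrals => // p q pq.
  have := h2 (pickle (p, q)); rewrite pickleK; congr (0 <= _).
  rewrite Rintegral_mkcond /G /F /Rintegral; congr fine; apply: eq_integral => t _; congr EFin.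
  rewrite !patchE; congr (if _ then _ else _).
  by apply/idP/idP; rewrite !inE /S /= in_itv /=; [case|split].
by apply: negligibleS => t /= h4 h5; apply: h4; rewrite /N /= ltNge h5.
Qed.

(** Near a rational square, [g] is cut to a slightly larger box inside [O], where it is integrable.
    Bumps on sub-boxes tend to indicators under the domination by the absolute value of the cut
    function, which turns the hypothesis into one on box integrals. *)
Lemma ae_ge0_of_test (O : set (R * R)) g : open O -> locally_integrable2 O g ->
  (forall phi, test_function O phi -> (forall z, 0 <= phi z) ->
    0 <= \int[lebesgue2 R]_(z in O) (g z * phi z)) ->
  {ae lebesgue2 R, forall z, O z -> 0 <= g z}.
Proof.
move=> oO [mg _ ig] H; have mO : measurable O by exact: open_measurable2.
apply: ae_open_rat => // -[[u1 u2] n] iO.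
set c1 : R := ratr u1; set c2 : R := ratr u2; set e : R := n.+1%:R^-1.
have e0 : 0 < e by rewrite invr_gt0.
pose box (r : R) : set (R * R) := [set z | c1 - r <= z.1 <= c1 + r /\ c2 - r <= z.2 <= c2 + r].
have boxE (r : R) : box r = csquare (c1, c2) r.
  apply/seteqP; split=> -[x t]; rewrite /box /csquare /= !ler_norml.
    by move=> [/andP[? ?] /andP[? ?]]; split; apply/andP; split; lra.
  by move=> [/andP[? ?] /andP[? ?]]; split; apply/andP; split; lra.
have cbox (r : R) : compact (box r) by exact: compact_box.
have boxO : box e `<=` O by rewrite boxE.
have [d d0 Hd] := compact_margin (cbox e) oO boxO.
have bO : box (e + d) `<=` O.
  move=> [x t] [/= /andP[x1 x2] /andP[t1 t2]].
  (* Projection onto [[c - e, c + e]]: a coordinate of the enlarged box is within [d] of its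
     projection. *)
  pose cl (c y : R) := Num.max (c - e) (Num.min (c + e) y).
  have Hcl (c y : R) : c - (e + d) <= y -> y <= c + (e + d) -> (c - e <= cl c y <= c + e) /\ `|y - cl c y| <= d.
    move=> y1 y2; rewrite /cl ler_norml; case: (leP (c + e) y) => h1.
      by rewrite (max_idPr _); [|lra]; split; apply/andP; split; lra.
    by case: (leP (c - e) y) => h2; split; apply/andP; split; lra.
  have [a1 a2] := Hcl c1 x x1 x2; have [b1 b2] := Hcl c2 t t1 t2.
  by apply: (Hd (cl c1 x, cl c2 t)); split.
pose B := open_box (c1 - (e + d)) (c1 + (e + d)) (c2 - (e + d)) (c2 + (e + d)).
have Bbox : B `<=` box (e + d) by move=> z [/andP[? ?] /andP[? ?]]; split; apply/andP; split; exact: ltW.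
have mB : measurable (B : set (plane R)) by exact: measurable_open_box.
pose h := g \_ B.
have mh : measurable_fun setT h.
  apply/(measurable_restrictT _ _).1 => //; apply: measurable_funS mg => //.
  exact: subset_trans Bbox bO.
have ih : (lebesgue2 R).-integrable setT (EFin \o h).
  have : (lebesgue2 R).-integrable B (EFin \o g).
    apply: integrableS (ig _ (cbox (e + d)) bO) => //; rewrite boxE; exact: measurable_csquare.
  move/(iffLR (integrable_mkcond _ mB)); congr (_.-integrable _ _).
  by apply/funext => z; rewrite /h /= restrict_EFin.
have : {ae lebesgue2 R, forall z, 0 <= h z}; last first.
  apply: ae2S => z hz iz; move: hz; rewrite /h patchE mem_set//.
  have : box e z by rewrite boxE.
  by move=> [/andP[? ?] /andP[? ?]]; split; apply/andP; split; lra.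
apply: ae_ge0_of_box_integrals => // a b c d'.
pose a1 := Num.max a (c1 - (e + d)); pose b1 := Num.min b (c1 + (e + d)).
pose a2 := Num.max c (c2 - (e + d)); pose b2 := Num.min d' (c2 + (e + d)).
have BB z : open_box a1 b1 a2 b2 z <-> open_box a b c d' z /\ B z.
  rewrite /B /open_box /= /a1 /b1 /a2 /b2 !gt_max !lt_min; split.
    by move=> [/andP[/andP[-> ->] /andP[-> ->]] /andP[/andP[-> ->] /andP[-> ->]]].
  by move=> [[/andP[-> ->] /andP[-> ->]] [/andP[-> ->] /andP[-> ->]]].
pose phi n := box_bump a1 b1 a2 b2 n.
have tphi m : test_function O (phi m).
  apply: box_bump_test => z /=; rewrite /a1 /b1 /a2 /b2 !ge_max !le_min.
  move=> [/andP[/andP[_ ?] /andP[_ ?]] /andP[/andP[_ ?] /andP[_ ?]]]; apply: bO.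
  by split; apply/andP.
have phi01 m z : 0 <= phi m z <= 1 := box_bump01 a1 b1 a2 b2 m z.
pose f_ m z := h z * phi m z.
pose f z := h z * \1_(open_box a1 b1 a2 b2) z.
have mf_ m : measurable_fun setT (f_ m) by apply: measurable_funM => //; exact: measurable_test (tphi m).
have mf : measurable_fun setT f.
  by apply: measurable_funM => //; apply: measurable_indic; exact: measurable_open_box.
have q1 m : measurable_fun [set: plane R] (fun z : plane R => (f_ m z)%:E) by apply/measurable_EFinP; exact: mf_.
have q2 : measurable_fun [set: plane R] (fun z : plane R => (f z)%:E) by exact/measurable_EFinP.
have q3 : {ae lebesgue2 R, forall z : plane R, [set: plane R] z ->
    (f_ m z)%:E @[m --> \oo] --> (f z)%:E}.
  apply: aeW => z _; apply: cvg_EFin; first exact: nearW.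
  by apply: cvgMr; exact: box_bump_cvg.
have q4 : {ae lebesgue2 R, forall (z : plane R) m, [set: plane R] z ->
    (`|(f_ m z)%:E| <= `|(h z)%:E|)%E}.
  apply: aeW => z m _; rewrite /= lee_fin /f_ normrM ler_piMr//.
  by have /andP[? ?] := phi01 m z; rewrite ger0_norm.
have iah : (lebesgue2 R).-integrable [set: plane R] (fun z => `|(h z)%:E|)%E by exact: integrable_abse.
have [intf _ cv] := dominated_convergence measurableT q1 q2 q3 iah q4.
have cv' : \int[lebesgue2 R]_z f_ m z @[m --> \oo] --> \int[lebesgue2 R]_z f z.
  by apply: fine_cvg; rewrite fineK; [exact: cv|exact: integrable_fin_num].
have -> : \int[lebesgue2 R]_(z in open_box a b c d') h z = \int[lebesgue2 R]_z f z.
  rewrite Rintegral_mkcond; apply: eq_Rintegral => z _; rewrite patchE /f indicE.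
  have [Bz|nBz] := pselect (B z).
    case: ifPn; rewrite ?inE ?notin_setE => oz.
      by rewrite mem_set ?mulr1//; apply/BB.
    by rewrite memNset ?mulr0// => /BB[].
  have -> : h z = 0 by rewrite /h patchE memNset.
  by rewrite mul0r; case: ifP.
apply: (cvgn_ge (m0:=0%N) cv') => m _.
have := H _ (tphi m) (fun z => (andP (phi01 m z)).1).
rewrite (Rintegral_test g (tphi m)); congr (0 <= _); apply: eq_Rintegral => z _.
rewrite /f_ /h patchE; case: ifPn => //; rewrite notin_setE => nB.
by rewrite /phi box_bump_out ?mulr0// => /BB[].
Qed.

End fundamental_lemma.

(** * Weak maximum principle and uniqueness *)

Section test_limits.
Context {R : realType}.
Implicit Types (w phi : R * R -> R) (z v c : R * R).

Lemma compact_uniform (f : R * R -> R) (K : set (R * R)) (e : R) : continuous f -> compact K -> 0 < e ->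
  exists2 d : R, 0 < d & forall z, K z -> forall z', csquare z d z' -> `|f z' - f z| <= e.
Proof.
move=> fc cK e0.
have := (@compact_near_coveringP (R * R)%type K).1 cK nat \oo
  (fun n z => forall z', csquare z n.+1%:R^-1 z' -> `|f z' - f z| <= e) _.
case=> [z Kz|n0 _ Hn0]; last first.
  exists n0.+1%:R^-1; first by rewrite invr_gt0.
  by move=> z Kz; apply: (Hn0 n0) => /=.
have e2 : 0 < e / 2 by rewrite divr_gt0.
have : nbhs z [set z' | `|f z - f z'| < e / 2] by have /cvgrPdist_lt/(_ _ e2) := fc z.
move=> /nbhs_ballP[d /= d0 Hd].
exists (ball z (d / 2), [set n | (Num.truncn (2 / d) < n)%N]).
  split; first by apply: nbhsx_ballx; rewrite divr_gt0.
  by exists (Num.truncn (2 / d)).+1.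
move=> [z' n] [/= [b1 b2] hn] z'' [h1 h2].
have nd : n.+1%:R^-1 < d / 2 :> R.
  rewrite -[ltRHS]invrK ltf_pV2 ?posrE ?invr_gt0 ?divr_gt0// invf_div.
  apply: (lt_le_trans (truncnS_gt _)); rewrite ler_nat.
  exact: leq_trans hn (leqnSn n).
rewrite /ball/= in b1 b2.
have k1 : `|f z - f z'| < e / 2.
  by apply: Hd; split; rewrite /ball/=; [apply: (lt_trans b1)|apply: (lt_trans b2)]; lra.
have k2 : `|f z - f z''| < e / 2.
  apply: Hd; split; rewrite /ball/=.
  - rewrite (_ : z.1 - z''.1 = (z.1 - z'.1) - (z''.1 - z'.1)); last by ring.
    by apply: (le_lt_trans (ler_normB _ _)); move: h1 b1 nd; move: `|_| `|_| _^-1 => x y t; lra.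
  - rewrite (_ : z.2 - z''.2 = (z.2 - z'.2) - (z''.2 - z'.2)); last by ring.
    by apply: (le_lt_trans (ler_normB _ _)); move: h2 b2 nd; move: `|_| `|_| _^-1 => x y t; lra.
rewrite (_ : f z'' - f z' = (f z - f z') - (f z - f z'')); last by ring.
by apply: (le_trans (ler_normB _ _)); move: k1 k2; move: `|_| `|_| => x y; lra.
Qed.

Section first_second.
Context (Omega : set (R * R)) (phi w : R * R -> R) (Cw : R).
Context (t0 : test_function Omega phi) (mw : measurable_fun setT w) (wC : forall z, `|w z| <= Cw).

Let mphi : measurable_fun setT phi := measurable_test t0.

Lemma integrable_shifted_test c : (lebesgue2 R).-integrable setT (fun z => (w z * phi (z + c))%:E).
Proof.
have [Cq Cq0 HCq] := test_bounded t0; have [m m0 Hm] := test_support t0.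
have mF : measurable_fun setT (fun z => w z * phi (z + c)).
  by apply: measurable_funM => //; exact: measurable_shift2.
apply: (bounded_integrable2 (C:=Cw * Cq) (c:=(0,0)) (m:=m + (`|c.1| + `|c.2|)) mF) => z.
  by rewrite normrM; apply: ler_pM.
by move=> hz; rewrite (test_shift_support (S:=`|c.1| + `|c.2|) Hm _ _ hz) ?mulr0// ?lerDl ?lerDr.
Qed.

Let J c := \int[lebesgue2 R]_z (w z * phi (z + c)).

Let J3 (c1 c2 : R * R) (a : R) :
  \int[lebesgue2 R]_z ((1 * (w z * phi (z + 0)) - 2^-1 * (w z * phi (z + c1) + w z * phi (z + c2))) * a) =
  (J 0 - 2^-1 * (J c1 + J c2)) * a.
Proof.
have i1 := integrable_shifted_test c1; have i2 := integrable_shifted_test c2.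
have i0 := integrable_shifted_test 0.
have i12 : (lebesgue2 R).-integrable setT (fun z => (w z * phi (z + c1) + w z * phi (z + c2))%:E) by exact (integrableD measurableT i1 i2).
have i12' := integrableZl measurableT 2^-1 i12; have i0' := integrableZl measurableT 1 i0.
rewrite RintegralZr//; last exact (integrableB measurableT i0' i12').
by rewrite Rintegral_lin3// mul1r.
Qed.

Let mS c : measurable_fun setT (fun z => w z * phi (z + c)).
Proof. by apply: measurable_funM => //; exact: measurable_shift2. Qed.

Let m3 (c1 c2 : R * R) (a : R) :
  measurable_fun setT (fun z => (1 * (w z * phi (z + 0)) - 2^-1 * (w z * phi (z + c1) + w z * phi (z + c2))) * a).
Proof.
apply: measurable_funM; last exact: measurable_cst.
apply: measurable_funB; apply: measurable_funM; try exact: measurable_cst; first exact: mS.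
by apply: measurable_funD; exact: mS.
Qed.

(** Computes a derivative of the mollification of [w] on the test function, so that [w] may be
    merely measurable and bounded. *)
Lemma test_first_cvg v (s_ : nat -> R) : (forall n, s_ n != 0) -> (forall n, `|s_ n| <= 1) ->
  s_ @ \oo --> 0 ->
  (J (s_ n *: v) - J 0) / s_ n @[n --> \oo] --> \int[lebesgue2 R]_z (w z * 'D_v phi z).
Proof.
move=> s0 s1 scv; have [m m0 Hm] := test_support t0; have [C C0 HC] := test_taylor1 v t0.
have t1 := test_iter_derive [:: v] t0.
(* Recast in the shape of [J3], with both shifts equal, to reuse its linearity. *)
have E n : (J (s_ n *: v) - J 0) / s_ n = (J 0 - 2^-1 * (J (s_ n *: v) + J (s_ n *: v))) * (- (s_ n)^-1).
  by field; exact: s0.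
under eq_fun do rewrite E -J3.
have Z n z : (1 * (w z * phi (z + 0)) - 2^-1 * (w z * phi (z + s_ n *: v) + w z * phi (z + s_ n *: v))) * - (s_ n)^-1 =
    w z * ((phi (z + s_ n *: v) - phi z) / s_ n) by rewrite addr0; field; exact: s0.
have Cw0 : 0 <= Cw by exact: le_trans (normr_ge0 _) (wC (0, 0)).
apply: (@dominated_cvg2 R _ _ (Cw * C) (0, 0) (m + (`|v.1| + `|v.2|))).
- by move=> n; exact: m3.
- by apply: measurable_funM => //; exact: (measurable_test t1).
- move=> n z; rewrite Z normrM; apply: ler_pM => //.
  by rewrite normrM normfV ler_pdivrMr ?normr_gt0.
- move=> n z hz; rewrite Z; have -> : phi (z + s_ n *: v) = 0.
    apply: (test_shift_support Hm _ _ hz); rewrite /= /GRing.scale /= normrM.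
      by apply: (@le_trans _ _ `|v.1|); rewrite ?ler_piMl ?lerDl.
    by apply: (@le_trans _ _ `|v.2|); rewrite ?ler_piMl ?lerDr.
  have -> : phi z = 0 by apply: Hm; apply: csquare_mono hz; rewrite lerDl addr_ge0.
  by rewrite subr0 mul0r mulr0.
- apply: aeW => z; under eq_fun do rewrite Z; apply: cvgMr.
  exact: (test_quotient_cvg (Omega:=Omega)).
Qed.

Lemma test_second_cvg v (s_ : nat -> R) : (forall n, 0 < s_ n) -> (forall n, s_ n <= 1) ->
  s_ @ \oo --> 0 ->
  (J (s_ n *: v) + J (- s_ n *: v) - 2 * J 0) / s_ n ^+ 2 @[n --> \oo] -->
  \int[lebesgue2 R]_z (w z * 'D_v ('D_v phi) z).
Proof.
move=> sp s1 scv; have s0 n : s_ n != 0 by rewrite gt_eqF.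
have [m m0 Hm] := test_support t0; have [C C0 HC] := test_taylor2 v t0.
have t2 := test_iter_derive [:: v; v] t0; have [F F0 HF] := test_bounded t2.
have E n : (J (s_ n *: v) + J (- s_ n *: v) - 2 * J 0) / s_ n ^+ 2 =
    (J 0 - 2^-1 * (J (s_ n *: v) + J (- s_ n *: v))) * (- 2 / s_ n ^+ 2).
  by field; exact: s0.
under eq_fun do rewrite E -J3.
pose D n z := (phi (z + s_ n *: v) + phi (z + - s_ n *: v) - 2 * phi z) / s_ n ^+ 2.
have Z n z : (1 * (w z * phi (z + 0)) - 2^-1 * (w z * phi (z + s_ n *: v) + w z * phi (z + - s_ n *: v))) * (- 2 / s_ n ^+ 2) =
    w z * D n z by rewrite /D addr0; field; exact: s0.
have DE n z : `|D n z - 'D_v ('D_v phi) z| <= 2 * C * s_ n.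
  have := HC z (s_ n); have := HC z (- s_ n); rewrite normrN (gtr0_norm (sp n)) sqrrN.
  set X1 := (X in `|X| <= _ -> _); set X2 := (X in _ -> `|X| <= _ -> _) => h1 h2.
  have -> : D n z - 'D_v ('D_v phi) z = (X1 + X2) / s_ n ^+ 2.
    by rewrite /D /X1 /X2; field; exact: s0.
  rewrite normrM normfV [X in _ / X]ger0_norm ?sqr_ge0// ler_pdivrMr ?exprn_gt0//.
  apply: (le_trans (ler_normD _ _)); apply: (le_trans (lerD h1 h2)).
  by rewrite le_eqVlt; apply/orP; left; apply/eqP; ring.
have Cw0 : 0 <= Cw by exact: le_trans (normr_ge0 _) (wC (0, 0)).
apply: (@dominated_cvg2 R _ _ (Cw * (F + 2 * C)) (0, 0) (m + (`|v.1| + `|v.2|))).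
- by move=> n; exact: m3.
- by apply: measurable_funM => //; exact: (measurable_test t2).
- move=> n z; rewrite Z normrM; apply: ler_pM => //.
  rewrite -[D n z](subrK ('D_v ('D_v phi) z)) addrC; apply: (le_trans (ler_normD _ _)).
  apply: lerD; first exact: HF.
  by apply: (le_trans (DE n z)); rewrite ler_piMr// mulr_ge0.
- move=> n z hz; rewrite Z /D.
  have V (c : R) : `|c| <= 1 -> phi (z + c *: v) = 0.
    move=> c1; apply: (test_shift_support Hm _ _ hz); rewrite /= /GRing.scale /= normrM.
      by apply: (@le_trans _ _ `|v.1|); rewrite ?ler_piMl ?lerDl.
    by apply: (@le_trans _ _ `|v.2|); rewrite ?ler_piMl ?lerDr.
  rewrite !V ?normrN ?gtr0_norm//.
  have -> : phi z = 0 by apply: Hm; apply: csquare_mono hz; rewrite lerDl addr_ge0.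
  by rewrite mulr0 addr0 subr0 mul0r mulr0.
- apply: aeW => z; under eq_fun do rewrite Z; apply: cvgMr.
  apply/cvgrPdistC_le => e e0.
  have : 2 * C * s_ n @[n --> \oo] --> 2 * C * 0 by exact: cvgMr.
  rewrite mulr0 => /cvgr0Pnorm_le/(_ e e0); apply: filterS => n hn.
  by apply: (le_trans (DE n z)); exact: le_trans (ler_norm _) hn.
Qed.

Lemma Rintegral_adjoint_op (sigma r q : R) :
  \int[lebesgue2 R]_z (w z * adjoint_op sigma r q phi z) =
  r * \int[lebesgue2 R]_z (w z * phi z) - \int[lebesgue2 R]_z (w z * 'D_(dir_t R) phi z)
  + (r - q - sigma ^+ 2 / 2) * \int[lebesgue2 R]_z (w z * 'D_(dir_x R) phi z)
  - sigma ^+ 2 / 2 * \int[lebesgue2 R]_z (w z * 'D_(dir_x R) ('D_(dir_x R) phi) z).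
Proof.
have I s : (lebesgue2 R).-integrable setT (fun z => (w z * iter_derive s phi z)%:E).
  have t1 := test_iter_derive s t0.
  have [Cq Cq0 HCq] := test_bounded t1; have [m m0 Hm] := test_support t1.
  have mF : measurable_fun setT (fun z => w z * iter_derive s phi z).
    by apply: measurable_funM => //; exact: measurable_test t1.
  apply: (bounded_integrable2 (C:=Cw * Cq) (c:=(0,0)) (m:=m) mF) => z.
    by rewrite normrM; apply: ler_pM.
  by move=> hz; rewrite Hm ?mulr0.
have i0 := I [::]; have it := I [:: dir_t R]; have ix := I [:: dir_x R]; have ixx := I [:: dir_x R; dir_x R].
rewrite /= in i0 it ix ixx; set b := r - q - _.
have ibx : (lebesgue2 R).-integrable setT (fun z => ((2 * b) * (w z * 'D_(dir_x R) phi z))%:E).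
  exact (integrableZl measurableT (2 * b) ix).
have isx : (lebesgue2 R).-integrable setT (fun z => (sigma ^+ 2 * (w z * 'D_(dir_x R) ('D_(dir_x R) phi) z))%:E).
  exact (integrableZl measurableT (sigma ^+ 2) ixx).
(* Coefficients are doubled so that two uses of [Rintegral_lin3], with its weights 1/2, produce the
   combination of four terms. *)
pose f1 z := 2 * (w z * 'D_(dir_t R) phi z) - 2^-1 * ((2 * b) * (w z * 'D_(dir_x R) phi z) + (2 * b) * (w z * 'D_(dir_x R) phi z)).
have if1 : (lebesgue2 R).-integrable setT (fun z => (f1 z)%:E).
  have h1 := integrableZl measurableT 2 it.
  have h2 : (lebesgue2 R).-integrable setT (fun z => ((2 * b) * (w z * 'D_(dir_x R) phi z) + (2 * b) * (w z * 'D_(dir_x R) phi z))%:E).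
    exact (integrableD measurableT ibx ibx).
  exact (integrableB measurableT h1 (integrableZl measurableT 2^-1 h2)).
set A0 := \int[lebesgue2 R]_z (w z * phi z); set At := \int[lebesgue2 R]_z (w z * 'D_(dir_t R) phi z).
set Ax := \int[lebesgue2 R]_z (w z * 'D_(dir_x R) phi z).
set Axx := \int[lebesgue2 R]_z (w z * 'D_(dir_x R) ('D_(dir_x R) phi) z).
have e1 : \int[lebesgue2 R]_z ((2 * b) * (w z * 'D_(dir_x R) phi z)) = 2 * b * Ax.
  exact: (RintegralZl _ measurableT ix).
have e2 : \int[lebesgue2 R]_z (sigma ^+ 2 * (w z * 'D_(dir_x R) ('D_(dir_x R) phi) z)) = sigma ^+ 2 * Axx.
  exact: (RintegralZl _ measurableT ixx).
have e3 : \int[lebesgue2 R]_z f1 z = 2 * At - 2^-1 * (2 * b * Ax + 2 * b * Ax).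
  by rewrite -e1; exact: (Rintegral_lin3 2 it ibx ibx).
have -> : \int[lebesgue2 R]_z (w z * adjoint_op sigma r q phi z) =
    r * A0 - 2^-1 * (\int[lebesgue2 R]_z f1 z + sigma ^+ 2 * Axx).
  rewrite -e2 -(Rintegral_lin3 r i0 if1 isx).
  by apply: eq_Rintegral => z _; rewrite /adjoint_op -/b /f1; field.
by rewrite e3; clearbody A0 At Ax Axx b; field.
Qed.

End first_second.

Lemma mollify_close (rho u1 u2 : R * R -> R) (e c C : R) : test_function setT rho ->
  (forall z, 0 <= rho z) -> (forall z, ~ csquare (0, 0) e z -> rho z = 0) ->
  measurable_fun setT u1 -> measurable_fun setT u2 ->
  (forall z, `|u1 z| <= C) -> (forall z, `|u2 z| <= C) ->
  (forall z, csquare (0, 0) e z -> `|u1 z - u2 z| <= c) ->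
  `|\int[lebesgue2 R]_z (u1 z * rho z) - \int[lebesgue2 R]_z (u2 z * rho z)| <=
  c * \int[lebesgue2 R]_z rho z.
Proof.
move=> t0 r0 rout m1 m2 C1 C2 H; have mr := measurable_test t0.
have [Cq Cq0 HCq] := test_bounded t0.
have I (u : R * R -> R) : measurable_fun setT u -> (forall z, `|u z| <= C) -> (lebesgue2 R).-integrable setT (fun z => (u z * rho z)%:E).
  move=> mu uC; have mF : measurable_fun setT (fun z => u z * rho z) by exact: measurable_funM.
  apply: (bounded_integrable2 (C:=C * Cq) (c:=(0,0)) (m:=e) mF) => z.
    by rewrite normrM; apply: ler_pM.
  by move=> hz; rewrite rout ?mulr0.
have ir : (lebesgue2 R).-integrable setT (fun z => (rho z)%:E).
  exact: (bounded_integrable2 mr HCq rout).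
have i1 := I _ m1 C1; have i2 := I _ m2 C2.
have i12 : (lebesgue2 R).-integrable setT (fun z => (u1 z * rho z - u2 z * rho z)%:E) by exact (integrableB measurableT i1 i2).
rewrite -(RintegralB measurableT i1 i2); apply: (le_trans (le_normr_Rintegral measurableT i12)).
rewrite -(RintegralZl c measurableT ir); apply: le_Rintegral => //.
- exact (integrable_norm i12).
- exact (integrableZl measurableT c ir).
- move=> z _; rewrite -mulrBl normrM (ger0_norm (r0 z)).
  have [hz|hz] := pselect (csquare (0, 0) e z); first by rewrite ler_wpM2r// H.
  by rewrite rout// !mulr0.
Qed.

Lemma box_bump_shift (a b c d : R) n z z' :
  box_bump (a + z.1) (b + z.1) (c + z.2) (d + z.2) n z' = box_bump a b c d n (z' - z).
Proof.
case: z z' => x y [x' y']; rewrite /box_bump /=.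
rewrite (_ : x' - (a + x) = x' - x - a); last by ring.
rewrite (_ : b + x - x' = b - (x' - x)); last by ring.
rewrite (_ : y' - (c + y) = y' - y - c); last by ring.
by rewrite (_ : d + y - y' = d - (y' - y)); last by ring.
Qed.

Lemma csquareE c (e : R) z : csquare c e z <->
  c.1 - e <= z.1 <= c.1 + e /\ c.2 - e <= z.2 <= c.2 + e.
Proof.
rewrite /csquare /= !ler_norml; split=> -[/andP[? ?] /andP[? ?]].
  by split; apply/andP; split; lra.
by split; apply/andP; split; lra.
Qed.

Lemma closed_ge_preimage (f : R * R -> R) (c : R) : continuous f -> closed [set z | c <= f z].
Proof.
move=> fc; rewrite -[X in closed X]setCK; apply: open_closedC.
have -> : ~` [set z | c <= f z] = f @^-1` [set x | x < c].
  by apply/seteqP; split=> z /=; rewrite ltNge => /negP.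
by apply: open_comp => [z _|]; [exact: fc|exact: open_lt].
Qed.

Lemma box_bump_positive (e : R) : 0 < e -> exists n, 0 < \int[lebesgue2 R]_z box_bump (- e) e (- e) e n z.
Proof.
move=> e0; have tt n : test_function setT (box_bump (- e) e (- e) e n) by exact: box_bump_test.
have cv : \int[lebesgue2 R]_z box_bump (- e) e (- e) e n z @[n --> \oo] -->
    \int[lebesgue2 R]_z (\1_(open_box (- e) e (- e) e) z : R).
  apply: (@dominated_cvg2 R _ _ 1 (0, 0) e).
  - by move=> n; exact: measurable_test (tt n).
  - by apply: measurable_indic; exact: measurable_open_box.
  - by move=> n z; have /andP[h1 h2] := box_bump01 (- e) e (- e) e n z; rewrite ger0_norm.
  - move=> n z hz; apply: box_bump_out => -[/andP[? ?] /andP[? ?]]; apply: hz.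
    by split; rewrite /= subr0 ler_norml; apply/andP; split; apply: ltW.
  - by apply: aeW => z; exact: box_bump_cvg.
have I0 : 0 < \int[lebesgue2 R]_z (\1_(open_box (- e) e (- e) e) z : R).
  rewrite /Rintegral integral_indic//; last exact: measurable_open_box.
  rewrite setIT (_ : open_box _ _ _ _ = `]- e, e[ `*` `]- e, e[); last first.
    by apply/seteqP; split=> -[x t] /=; rewrite /open_box/= !in_itv.
  have E : lebesgue2 R (`]- e, e[ `*` `]- e, e[) = ((e + e) * (e + e))%:E.
    have li : lebesgue_measure (`]- e, e[%classic : set R) = (e + e)%:E.
      by rewrite lebesgue_measure_itv/= lte_fin gtrN// -EFinB opprK.
    rewrite /lebesgue2 product_measure1E; [|exact: measurable_itv..].
    by rewrite EFinM; congr (_ * _)%E; exact: li.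
  by apply: (@lt_le_trans _ _ (fine ((e + e) * (e + e))%:E)); [rewrite /= mulr_gt0// addr_gt0|rewrite -E].
have /cvgr_gt/(_ _ I0) [n _ /(_ n)] := cv.
by move=> /(_ (leqnn n)) h; exists n.
Qed.

End test_limits.

(** * The maximum principle for weak subsolutions *)

Section maximum_principle.
Context {R : realType}.
Implicit Types (z c : R * R) (w B phi : R * R -> R).

(** The hypotheses are the optimality conditions at a maximum [c] of the mollified [w] minus
    [ke * (1 + x^2 + L * t)], two-sided in [x] and backward in [t]. Shifting [phi] by [- y] moves
    the mollification by [y], so [Ax] and [At] are minus its derivatives. At such a point, the
    barrier makes the operator strictly positive. *)
Lemma adjoint_integral_gt0 (Omega : set (R * R)) phi w (Mw sigma r q ke L de : R) c :
  test_function Omega phi -> measurable_fun setT w -> (forall z, `|w z| <= Mw) ->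
  0 < r -> 0 < ke -> 0 < de -> 0 <= c.2 ->
  L = sigma ^+ 2 + (r - q - sigma ^+ 2 / 2) ^+ 2 / r ->
  ke * (1 + c.1 ^+ 2 + L * c.2) < \int[lebesgue2 R]_z (w z * phi z) ->
  (forall y : R, `|y| <= de -> \int[lebesgue2 R]_z (w z * phi (z + - y *: dir_x R)) -
     \int[lebesgue2 R]_z (w z * phi z) <= ke * (2 * c.1 * y + y ^+ 2)) ->
  (forall y : R, 0 <= y -> y <= de -> \int[lebesgue2 R]_z (w z * phi (z + y *: dir_t R)) -
     \int[lebesgue2 R]_z (w z * phi z) <= ke * (L * - y)) ->
  0 < \int[lebesgue2 R]_z (w z * adjoint_op sigma r q phi z).
Proof.
move=> t0 mw wM r0 ke0 de0 c20; set b := r - q - _ => LE a0 incx inct.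
rewrite (Rintegral_adjoint_op t0 mw wM) -/b.
set A0 := \int[lebesgue2 R]_z (w z * phi z) in a0 incx inct *.
set At := \int[lebesgue2 R]_z (w z * 'D_(dir_t R) phi z).
set Ax := \int[lebesgue2 R]_z (w z * 'D_(dir_x R) phi z).
set Axx := \int[lebesgue2 R]_z (w z * 'D_(dir_x R) ('D_(dir_x R) phi) z).
have A00 : \int[lebesgue2 R]_z (w z * phi (z + 0)) = A0 by apply: eq_Rintegral => z _; rewrite addr0.
have [n0 Hn0] : exists n0, forall n, (n0 <= n)%N -> @step_x R n <= de.
  have [n0 _ Hn] : \forall n \near \oo, `|@step_x R n| <= de.
    by have /cvgr0Pnorm_le/(_ _ de0) := @step_x_cvg0 R.
  by exists n0 => k hk; exact: le_trans (ler_norm _) (Hn k hk).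
pose s k := @step_x R (k + n0).
have sp k : 0 < s k := @step_x_gt0 R (k + n0).
have s1 k : s k <= 1 := @step_x_le1 R (k + n0).
have sde k : s k <= de by apply: Hn0; exact: leq_addl.
have scv : s @ \oo --> 0 by rewrite /s cvg_shiftn; exact: step_x_cvg0.
clearbody s; have ns k : `|s k| = s k by rewrite gtr0_norm.
have sn k : s k != 0 by rewrite gt_eqF.
have nsn k : - s k != 0 by rewrite oppr_eq0.
have ns1 k : `|s k| <= 1 by rewrite ns.
have nns1 k : `|- s k| <= 1 by rewrite normrN ns.
have nscv : (fun k => - s k) @ \oo --> 0 by rewrite -oppr0; exact: cvgN.
have lin (u d : R) : ke * (u + d * s k) @[k --> \oo] --> ke * u.
  suff : ke * (u + d * s k) @[k --> \oo] --> ke * (u + d * 0) by rewrite mulr0 addr0.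
  by apply: cvgMr; apply: cvgD; [exact: cvg_cst|exact: cvgMr].
have ax1 : Ax <= ke * (- (2 * c.1)).
  have cv := test_first_cvg t0 mw wM (v:=dir_x R) sn ns1 scv; rewrite A00 in cv.
  apply: (le_cvgn (m0:=0%N) cv (lin (- (2 * c.1)) 1)) => k _.
  have := incx (- s k); rewrite normrN ns sde => /(_ isT); rewrite opprK => h.
  rewrite ler_pdivrMr//; apply: (le_trans h).
  by rewrite le_eqVlt; apply/orP; left; apply/eqP; ring.
have ax2 : ke * (- (2 * c.1)) <= Ax.
  have cv := test_first_cvg t0 mw wM (v:=dir_x R) nsn nns1 nscv; rewrite A00 in cv.
  apply: (le_cvgn (m0:=0%N) (lin (- (2 * c.1)) (-1)) cv) => k _.
  have := incx (s k); rewrite ns sde => /(_ isT) h.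
  rewrite ler_ndivlMr ?oppr_lt0//; apply: (le_trans h).
  by rewrite le_eqVlt; apply/orP; left; apply/eqP; ring.
have at1 : At <= ke * (- L).
  have cv := test_first_cvg t0 mw wM (v:=dir_t R) sn ns1 scv; rewrite A00 in cv.
  apply: (le_cvgn (m0:=0%N) cv (lin (- L) 0)) => k _.
  have h := inct (s k) (ltW (sp k)) (sde k).
  rewrite ler_pdivrMr//; apply: (le_trans h).
  by rewrite le_eqVlt; apply/orP; left; apply/eqP; ring.
have axx1 : Axx <= ke * 2.
  have cv := test_second_cvg t0 mw wM (v:=dir_x R) sp s1 scv; rewrite A00 in cv.
  apply: (le_cvgn (m0:=0%N) cv (lin 2 0)) => k _.
  have := incx (- s k); rewrite normrN ns sde => /(_ isT); rewrite opprK => h1.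
  have := incx (s k); rewrite ns sde => /(_ isT) h2.
  rewrite ler_pdivrMr ?exprn_gt0//.
  have -> : ke * (2 + 0 * s k) * s k ^+ 2 = ke * (2 * c.1 * - s k + (- s k) ^+ 2) + ke * (2 * c.1 * s k + s k ^+ 2) by ring.
  apply: le_trans (lerD h1 h2).
  by rewrite le_eqVlt; apply/orP; left; apply/eqP; ring.
have ax : Ax = ke * (- (2 * c.1)) by apply/eqP; rewrite eq_le ax1.
clearbody A0 At Ax Axx; rewrite ax.
have h1 : r * (ke * (1 + c.1 ^+ 2 + L * c.2)) < r * A0 by rewrite ltr_pM2l.
have h2 : sigma ^+ 2 / 2 * Axx <= sigma ^+ 2 / 2 * (ke * 2) by rewrite ler_wpM2l// divr_ge0 ?sqr_ge0.
(* Completing the square, the bracket equals [r + r * (c.1 - b / r)^2 + r * L * c.2]; this is where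
   the value of [L] comes from. *)
have h3 : 0 < ke * (r * (1 + c.1 ^+ 2 + L * c.2) + L - 2 * b * c.1 - sigma ^+ 2).
  rewrite mulr_gt0//.
  have h4 : 0 <= r * (c.1 - b / r) ^+ 2 by rewrite mulr_ge0 ?sqr_ge0// ltW.
  have h5 : r * (c.1 - b / r) ^+ 2 = r * c.1 ^+ 2 - 2 * b * c.1 + b ^+ 2 / r by field; rewrite gt_eqF.
  have L0 : 0 <= L by rewrite LE addr_ge0 ?sqr_ge0// divr_ge0 ?sqr_ge0// ltW.
  have h6 : 0 <= r * (L * c.2) by rewrite mulr_ge0 ?(ltW r0)// mulr_ge0.
  have -> : r * (1 + c.1 ^+ 2 + L * c.2) + L - 2 * b * c.1 - sigma ^+ 2 = r + r * (c.1 - b / r) ^+ 2 + r * (L * c.2).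
    by rewrite h5 LE; ring.
  by rewrite ltr_wpDr// ltr_wpDr.
have e3 : ke * (r * (1 + c.1 ^+ 2 + L * c.2) + L - 2 * b * c.1 - sigma ^+ 2) =
  r * (ke * (1 + c.1 ^+ 2 + L * c.2)) - ke * (- L) + b * (ke * (- (2 * c.1))) - sigma ^+ 2 / 2 * (ke * 2) by field.
rewrite e3 in h3; apply: (lt_le_trans h3).
by apply: lerB => //; rewrite lerD2r; apply: lerB => //; exact: ltW.
Qed.

(* The mollification of [w], minus a multiple of the barrier [B], has a maximum [c]
   on the superlevel set of [w - B]; the mollifier centred at [c] is [phi]. *)
Lemma mollified_maximum w B (T Mw X : R) (z0 : R * R) :
  continuous w -> (forall z, `|w z| <= Mw) -> (forall z, z.2 <= 0 -> w z <= 0) ->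
  continuous B -> (forall z, 0 <= z.2 -> 0 <= B z) ->
  (forall z, 0 <= z.2 -> B z <= Mw -> `|z.1| <= X) ->
  B z0 < w z0 -> 0 < z0.2 -> z0.2 < T ->
  exists c phi (kap de : R), [/\ test_function [set z | 0 < w z /\ z.2 < T] phi,
    forall z, 0 <= phi z, 0 < kap, 0 < de & 0 <= c.2] /\
  [/\ kap * B c < \int[lebesgue2 R]_z (w z * phi z),
    forall y : R, `|y| <= de -> \int[lebesgue2 R]_z (w z * phi (z + - y *: dir_x R)) -
     \int[lebesgue2 R]_z (w z * phi z) <= kap * (B (c + y *: dir_x R) - B c) &
    forall y : R, 0 <= y -> y <= de -> \int[lebesgue2 R]_z (w z * phi (z + y *: dir_t R)) -
     \int[lebesgue2 R]_z (w z * phi z) <= kap * (B (c + - y *: dir_t R) - B c)].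
Proof.
move=> wc wM w0 Bc B0 BX Bw t0 z0T.
pose v z := w z - B z; pose m := v z0; have m0 : 0 < m by rewrite subr_gt0.
have vc : continuous v by move=> z; apply: cvgB; [exact: wc|exact: Bc].
(* Times stop at [z0.2]: the maximum is compared only with earlier times, so [c] may lie on this
   upper edge. *)
pose S : set (R * R) := [set z | 0 <= z.2 <= z0.2 /\ m / 2 <= v z].
have Sw z : S z -> B z < w z.
  by move=> [_ h3]; rewrite -subr_gt0; apply: lt_le_trans h3; rewrite divr_gt0.
have Sw0 z : S z -> 0 < w z.
  by move=> Sz; apply: le_lt_trans (Sw z Sz); apply: B0; have [/andP[]] := Sz.
have Sbox : S `<=` [set z | - X <= z.1 <= X /\ 0 <= z.2 <= z0.2].
  move=> z Sz; have [/andP[h1 h2] _] := Sz; split; last by rewrite h1.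
  by rewrite -ler_norml BX//; apply: (le_trans (ltW (Sw z Sz))); exact: le_trans (ler_norm _) (wM z).
have Scl : closed S.
  have -> : S = [set z | 0 <= z.2] `&` ([set z | - z0.2 <= - z.2] `&` [set z | m / 2 <= v z]).
    by apply/seteqP; split=> z /=; rewrite lerN2; [move=> [/andP[? ?] ?]|move=> [? [? ?]]; split=> //; apply/andP].
  apply: closedI; first by apply: closed_ge_preimage => z; exact: cvg_snd.
  apply: closedI; last exact: closed_ge_preimage.
  by apply: closed_ge_preimage => z; apply: cvgN; exact: cvg_snd.
have Sc : compact S by exact: subclosed_compact Scl (@compact_box _ _ _ _ _) Sbox.
pose U : set (R * R) := [set z | 0 < w z /\ z.2 < T].
have oU : open U.
  have -> : U = w @^-1` [set x | 0 < x] `&` snd @^-1` [set x | x < T] by [].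
  apply: openI; apply: open_comp; [by move=> *; exact: wc|exact: open_gt|by move=> *; exact: cvg_snd|exact: open_lt].
have SU : S `<=` U.
  by move=> z Sz; split; [exact: Sw0|have [/andP[_ h] _] := Sz; exact: le_lt_trans z0T].
have [d1 d10 Hd1] := compact_margin Sc oU SU.
(* Relative to the mass of the bump, mollification changes [w] by at most [m / 16] on [S]. Hence the
   maximum of [J] is at least [15/16 * m] times the mass, and [v c >= 7/8 * m] is strictly above the
   level [m / 2]. *)
have m16 : 0 < m / 16 by rewrite divr_gt0.
have [d2 d20 Hd2] := compact_uniform wc Sc m16.
have [e [e0 ed1 ed2]] : exists e : R, [/\ 0 < e, e <= d1 & e <= d2].
  by exists (Num.min d1 d2); rewrite lt_min d10 d20 !ge_min !lexx orbT.
have [n kap0] := box_bump_positive e0.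
set rho := box_bump (- e) e (- e) e n in kap0.
have trho : test_function setT rho by exact: box_bump_test.
have rho0 z : 0 <= rho z by have /andP[] := box_bump01 (- e) e (- e) e n z.
have rhoout z : ~ csquare (0, 0) e z -> rho z = 0.
  move=> hz; apply: box_bump_out => -[/andP[? ?] /andP[? ?]]; apply: hz.
  by split; rewrite /= subr0 ler_norml; apply/andP; split; apply: ltW.
have rhoS c z : rho (z - c) = box_bump (- e + c.1) (e + c.1) (- e + c.2) (e + c.2) n z.
  by rewrite box_bump_shift.
have ir : (lebesgue2 R).-integrable setT (fun z => (rho z)%:E).
  have [Cq Cq0 HCq] := test_bounded trho.
  exact: (bounded_integrable2 (measurable_test trho) HCq rhoout).
(* The bump is not normalised; its mass [kap] remains as a factor throughout. *)
clearbody rho; set kap := Rintegral _ _ _ in kap0.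
have kapE : \int[lebesgue2 R]_z rho z = kap by []. clearbody kap.
have mw : measurable_fun setT w by exact: continuous_measurable2.
pose I z := \int[lebesgue2 R]_z' (w (z' + z) * rho z').
have mws z : measurable_fun setT (fun z' => w (z' + z)) by exact: measurable_shift2.
have Iclose z : S z -> `|I z - kap * w z| <= kap * (m / 16).
  move=> Sz; have h := @mollify_close _ rho (fun z' => w (z' + z)) (cst (w z)) e (m / 16) Mw
    trho rho0 rhoout (mws z) (measurable_cst _) (fun z' => wM _) (fun _ => wM _).
  have E : \int[lebesgue2 R]_z' (w z * rho z') = kap * w z.
    by rewrite mulrC -kapE; exact: (RintegralZl (w z) measurableT ir).
  rewrite -E (mulrC kap) -kapE; apply: h => z' [h1 h2].
  by apply: Hd2 => //; split; rewrite /= addrK -[X in `|X|]subr0 (le_trans _ ed2).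
have Ic : continuous I.
  move=> z; apply/cvgrPdist_le => eps eps0.
  have e1 : 0 < eps / kap by rewrite divr_gt0.
  have cbox : compact (csquare z e).
    rewrite (_ : csquare z e = [set z' | z.1 - e <= z'.1 <= z.1 + e /\ z.2 - e <= z'.2 <= z.2 + e]).
      exact: compact_box.
    by apply/seteqP; split=> z' /csquareE.
  have [d d0 Hd] := compact_uniform wc cbox e1.
  have : nbhs z (ball z d) by exact: nbhsx_ballx.
  apply: filterS => y [/= y1 y2]; rewrite /ball/= in y1 y2.
  have h := @mollify_close _ rho (fun z' => w (z' + z)) (fun z' => w (z' + y)) e (eps / kap) Mw
    trho rho0 rhoout (mws z) (mws y) (fun z' => wM _) (fun _ => wM _).
  rewrite kapE divfK ?gt_eqF// in h; apply: h => z' [h1 h2]; rewrite /= !subr0 in h1 h2.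
  rewrite distrC; apply: Hd; first by split; rewrite /= addrK.
  split=> /=; rewrite distrC.
    by rewrite (_ : z'.1 + z.1 - (z'.1 + y.1) = z.1 - y.1) ?ltW//; ring.
  by rewrite (_ : z'.2 + z.2 - (z'.2 + y.2) = z.2 - y.2) ?ltW//; ring.
pose J z := I z - kap * B z.
have Jc : continuous J by move=> z; apply: cvgB; [exact: Ic|apply: cvgMr; exact: Bc].
have Sz0 : S z0.
  by split; [rewrite lexx (ltW t0)|rewrite -/m ler_pdivrMr// ler_peMr ?(ltW m0)// ler1n].
have [c] := compact_EVT_max (ex_intro _ z0 Sz0) Sc (continuous_subspaceT Jc).
rewrite inE => Scc Hc.
have cmax z : S z -> J z <= J c by move=> Sz; apply: Hc; rewrite inE.
have Jz0 : kap * (15 / 16 * m) <= J z0.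
  have := Iclose z0 Sz0; rewrite ler_norml /J => /andP[h _].
  have E : kap * m = kap * w z0 - kap * B z0 by rewrite -mulrBr.
  have -> : kap * (15 / 16 * m) = kap * m - kap * (m / 16) by field.
  rewrite E; move: h; move: (kap * (m / 16)) (kap * w z0) (kap * B z0) (I z0) => x1 x2 x3 x4.
  by clear; lra.
have Jcm := le_trans Jz0 (cmax _ Sz0).
have vcm : m / 2 < v c.
  have h0 : kap * (7 / 8 * m) <= kap * v c.
    have := Iclose c Scc; rewrite ler_norml => /andP[_ h].
    have -> : kap * (7 / 8 * m) = kap * (15 / 16 * m) - kap * (m / 16) by field.
    rewrite /v (mulrBr kap (w c)); move: Jcm h; rewrite /J.
    move: (kap * (m / 16)) (kap * w c) (kap * B c) (kap * (15 / 16 * m)) (I c) => x1 x2 x3 x4 x5.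
    by clear; lra.
  rewrite ler_pM2l// in h0; apply: lt_le_trans h0.
  by move: m0; move: (m) => x; clear; lra.
have [/andP[c20 c2t] _] := Scc.
have c2p : 0 < c.2 by rewrite ltNge; apply/negP => /w0; rewrite leNgt Sw0.
(* Since [v c > m / 2] and [c.2 > 0], horizontal neighbours of [c] and points slightly below it
   remain in [S], so [c] is a maximum among them. *)
have [dd dd0 Hdd] : exists2 dd : R, 0 < dd & csquare c dd `<=` [set z | m / 2 < v z].
  apply: open_square => //.
  by apply: (open_comp (f:=v) (D:=[set x : R | m / 2 < x])); [move=> *; exact: vc|exact: open_gt].
have [de [de0 dedd dec]] : exists de : R, [/\ 0 < de, de <= dd & de <= c.2].
  by exists (Num.min dd c.2); rewrite lt_min dd0 c2p !ge_min !lexx orbT.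
have Sx (s : R) : `|s| <= de -> S (c + s *: dir_x R).
  move=> hs; rewrite add_dir_x; split; first by rewrite /= c20.
  apply/ltW/Hdd; split; rewrite /= ?subrr ?normr0 ?(ltW dd0)//.
  by rewrite addrAC subrr add0r (le_trans hs).
have St (s : R) : 0 <= s -> s <= de -> S (c + - s *: dir_t R).
  move=> s0 hs; have sc : s <= c.2 by rewrite (le_trans hs).
  rewrite add_dir_t; split; first by rewrite /= subr_ge0 sc /= (le_trans _ c2t)// gerBl.
  apply/ltW/Hdd; split; rewrite /= ?subrr ?normr0 ?(ltW dd0)//.
  by rewrite addrAC subrr add0r normrN ger0_norm// (le_trans hs).
pose phi z' := rho (z' - c).
have tphi : test_function U phi.
  rewrite (_ : phi = box_bump (- e + c.1) (e + c.1) (- e + c.2) (e + c.2) n); last first.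
    by apply/funext => z'; rewrite -rhoS.
  apply: box_bump_test => z' [h1 h2]; apply: (Hd1 c) => //.
  rewrite ![- e + _]addrC ![e + _]addrC in h1 h2.
  have [k1 k2] : csquare c e z' by apply/csquareE; split.
  by split; exact: le_trans ed1.
have IE d : I (c + d) = \int[lebesgue2 R]_z (w z * phi (z + - d)).
  have i1 : (lebesgue2 R).-integrable setT (fun z => (w z * rho (z + - (c + d)))%:E).
    exact: (integrable_shifted_test trho mw wM).
  have m1 : measurable_fun setT (fun z => w z * rho (z + - (c + d))).
    by apply: measurable_funM => //; apply: measurable_shift2; exact: measurable_test trho.
  have E := integral_shift2 (c + d) m1 i1.
  transitivity (\int[lebesgue2 R]_z (w (z + (c + d)) * rho (z + (c + d) + - (c + d)))).
    by apply: eq_Rintegral => z _; rewrite addrK.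
  by rewrite E; apply: eq_Rintegral => z _; rewrite /phi opprD addrA addrAC.
have I0E : I c = \int[lebesgue2 R]_z (w z * phi z).
  apply: (etrans (congr1 I (esym (addr0 c)))); rewrite IE.
  by apply: eq_Rintegral => z _; rewrite oppr0 addr0.
exists c, phi, kap, de; split; first by split=> // z; exact: rho0.
have J0 : 0 < J c by apply: lt_le_trans Jcm; rewrite mulr_gt0// mulr_gt0// divr_gt0.
rewrite -I0E; split.
- by rewrite -subr_gt0.
- move=> y hy; have := cmax _ (Sx y hy); rewrite /J IE -scaleNr mulrBr.
  move: (Rintegral _ _ _) (I c) (kap * B (c + y *: dir_x R)) (kap * B c) => x1 x2 x3 x4.
  by clear; lra.
- move=> y y0 hy; have := cmax _ (St y y0 hy); rewrite /J IE -scaleNr opprK mulrBr.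
  move: (Rintegral _ _ _) (I c) (kap * B (c + - y *: dir_t R)) (kap * B c) => x1 x2 x3 x4.
  by clear; lra.
Qed.

Lemma weak_maximum_principle (sigma r q T Mw : R) w :
  0 < r -> continuous w -> (forall z, `|w z| <= Mw) ->
  (forall z, z.2 <= 0 -> w z <= 0) ->
  (forall phi, test_function [set z | 0 < w z /\ z.2 < T] phi -> (forall z, 0 <= phi z) ->
     \int[lebesgue2 R]_z (w z * adjoint_op sigma r q phi z) <= 0) ->
  forall z, z.2 < T -> w z <= 0.
Proof.
move=> r0 wc wM w0 H z0 z0T; rewrite leNgt; apply/negP => wz0.
have t0 : 0 < z0.2 by rewrite ltNge; apply/negP => /w0; rewrite leNgt wz0.
pose L := sigma ^+ 2 + (r - q - sigma ^+ 2 / 2) ^+ 2 / r.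
have L0 : 0 <= L by rewrite addr_ge0 ?sqr_ge0// divr_ge0 ?sqr_ge0// ltW.
pose B z : R := 1 + z.1 ^+ 2 + L * z.2.
have B0 z : 0 <= z.2 -> 0 < B z.
  by move=> hz; rewrite /B -addrA ltr_pwDl// addr_ge0 ?sqr_ge0// mulr_ge0.
have Bz0 := B0 _ (ltW t0).
(* Makes [eta * B z0] half of [w z0], so that the difference stays positive at [z0]. *)
pose eta := w z0 / (2 * B z0); have eta0 : 0 < eta by rewrite divr_gt0// mulr_gt0.
have Bc : continuous (fun z => eta * B z).
  move=> z; apply: cvgMr; apply: cvgD; last by apply: cvgMr; exact: cvg_snd.
  apply: cvgD; first exact: cvg_cst.
  by under eq_fun do rewrite expr2; apply: cvgM; exact: cvg_fst.
have Mw0 : 0 <= Mw by exact: le_trans (normr_ge0 _) (wM z0).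
(* Since [|x| <= 1 + x^2 <= B], the barrier exceeds the bound on [w] far out, which confines the
   maximum to a bounded set. *)
have BX z : 0 <= z.2 -> eta * B z <= Mw -> `|z.1| <= Mw / eta.
  move=> z2; rewrite mulrC -ler_pdivlMr// => h; apply: le_trans h; rewrite /B.
  have h1 := mulr_ge0 L0 z2; have := sqr_ge0 (`|z.1| - 1); rewrite -(real_normK (num_real z.1)).
  move: (`|z.1|) (L * z.2) h1 (normr_ge0 z.1) => x y; rewrite !expr2; clear; lra.
have Bw : eta * B z0 < w z0.
  have -> : eta * B z0 = w z0 / 2 by rewrite /eta; field; rewrite gt_eqF.
  by rewrite ltr_pdivrMr// ltr_pMr// ltr1n.
have [c [phi [kap [de [[tphi p0 kap0 de0 c20] [h1 h2 h3]]]]]] :=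
  mollified_maximum wc wM w0 Bc (fun z hz => ltW (mulr_gt0 eta0 (B0 z hz))) BX Bw t0 z0T.
have := H phi tphi p0; apply/negP; rewrite -ltNge.
apply: (@adjoint_integral_gt0 _ _ _ Mw sigma r q (kap * eta) L de c tphi (continuous_measurable2 wc) wM r0 _ de0 c20 erefl).
- exact: mulr_gt0.
- by rewrite -mulrA.
- move=> y hy; apply: (le_trans (h2 y hy)); rewrite add_dir_x /B /=.
  by rewrite le_eqVlt; apply/orP; left; apply/eqP; ring.
- move=> y y0 hy; apply: (le_trans (h3 y y0 hy)); rewrite add_dir_t /B /=.
  by rewrite le_eqVlt; apply/orP; left; apply/eqP; ring.
Qed.

End maximum_principle.

(** * Weak derivatives against test functions *)

Section weak_derivatives.
Context {R : realType}.
Implicit Types (O : set (R * R)) (u phi : R * R -> R) (z : R * R).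

Lemma locally_integrable2Z O (c : R) u : locally_integrable2 O u ->
  locally_integrable2 O (fun z => c * u z).
Proof.
move=> [mu oO H]; split=> //; first by apply: measurable_funM => //; exact: measurable_cst.
move=> K cK KO; have mK : measurable (K : set (plane R)) by exact: measurable_compact2.
exact (integrableZl mK c (H K cK KO)).
Qed.

Lemma locally_integrable2D O u1 u2 : locally_integrable2 O u1 -> locally_integrable2 O u2 ->
  locally_integrable2 O (fun z => u1 z + u2 z).
Proof.
move=> [m1 oO H1] [m2 _ H2]; split=> //; first exact: measurable_funD.
move=> K cK KO; have mK : measurable (K : set (plane R)) by exact: measurable_compact2.
exact (integrableD mK (H1 K cK KO) (H2 K cK KO)).
Qed.

Lemma locally_integrable2S O O' u : open O' -> O' `<=` O -> locally_integrable2 O u ->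
  locally_integrable2 O' u.
Proof.
move=> oO' OO [mu oO H]; split=> //; last by move=> K cK KO; apply: H => //; exact: subset_trans OO.
by apply: measurable_funS mu => //; exact: open_measurable2.
Qed.

Lemma test_functionS O O' phi : O' `<=` O -> test_function O' phi -> test_function O phi.
Proof. by move=> OO [h1 h2 h3]; split=> //; exact: subset_trans OO. Qed.

Lemma integrable_test O u phi : locally_integrable2 O u -> test_function O phi ->
  (lebesgue2 R).-integrable O (fun z => (u z * phi z)%:E).
Proof.
move=> [mu oO H] t0; have [_ cK KO] := t0; set K := closure _ in cK KO.
have mO : measurable (O : set (plane R)) by exact: open_measurable2.
have mK : measurable (K : set (plane R)) by exact: measurable_compact2.
have [C C0 HC] := test_bounded t0.
have iK : (lebesgue2 R).-integrable K (fun z => (C * u z)%:E).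
  exact (integrableZl mK C (H K cK KO)).
have iK' : (lebesgue2 R).-integrable K (fun z => (u z * phi z)%:E).
  apply: le_integrable iK => //.
    apply/measurable_EFinP; apply: measurable_funM; first by apply: measurable_funS mu.
    by apply: measurable_funTS; exact: measurable_test t0.
  by move=> z _; rewrite /= lee_fin !normrM mulrC ler_wpM2r// (ger0_norm C0).
apply/(integrable_mkcond _ mO); move/(integrable_mkcond _ mK): iK'.
congr (_.-integrable _ _); apply/funext => z; rewrite !patchE.
case: ifPn => zK; first by rewrite mem_set//; apply: KO; rewrite inE in zK.
case: ifPn => // _; rewrite (_ : phi z = 0) ?mulr0//.
by apply: contrapT => /eqP h; move/negP: zK; apply; rewrite inE; exact: subset_closure.
Qed.

Lemma Rintegral_lin4 O (f0 f1 f2 f3 : R * R -> R) (c0 c1 c2 c3 : R) :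
  measurable (O : set (plane R)) ->
  (lebesgue2 R).-integrable O (fun z => (f0 z)%:E) -> (lebesgue2 R).-integrable O (fun z => (f1 z)%:E) ->
  (lebesgue2 R).-integrable O (fun z => (f2 z)%:E) -> (lebesgue2 R).-integrable O (fun z => (f3 z)%:E) ->
  \int[lebesgue2 R]_(z in O) (c0 * f0 z + c1 * f1 z + c2 * f2 z + c3 * f3 z) =
  c0 * \int[lebesgue2 R]_(z in O) f0 z + c1 * \int[lebesgue2 R]_(z in O) f1 z +
  c2 * \int[lebesgue2 R]_(z in O) f2 z + c3 * \int[lebesgue2 R]_(z in O) f3 z.
Proof.
move=> mO i0 i1 i2 i3.
have j0 : (lebesgue2 R).-integrable O (fun z => (c0 * f0 z)%:E) by exact (integrableZl mO c0 i0).
have j1 : (lebesgue2 R).-integrable O (fun z => (c1 * f1 z)%:E) by exact (integrableZl mO c1 i1).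
have j2 : (lebesgue2 R).-integrable O (fun z => (c2 * f2 z)%:E) by exact (integrableZl mO c2 i2).
have j3 : (lebesgue2 R).-integrable O (fun z => (c3 * f3 z)%:E) by exact (integrableZl mO c3 i3).
have j01 : (lebesgue2 R).-integrable O (fun z => (c0 * f0 z + c1 * f1 z)%:E) by exact (integrableD mO j0 j1).
have j012 : (lebesgue2 R).-integrable O (fun z => (c0 * f0 z + c1 * f1 z + c2 * f2 z)%:E) by exact (integrableD mO j01 j2).
apply: (etrans (RintegralD mO j012 j3)); congr (_ + _); last exact (RintegralZl c3 mO i3).
apply: (etrans (RintegralD mO j01 j2)); congr (_ + _); last exact (RintegralZl c2 mO i2).
apply: (etrans (RintegralD mO j0 j1)); congr (_ + _); last exact (RintegralZl c1 mO i1).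
exact (RintegralZl c0 mO i0).
Qed.

Lemma Rintegral_ae_ge0 O (g : R * R -> R) : measurable O -> measurable_fun O g ->
  {ae lebesgue2 R, forall z, O z -> 0 <= g z} -> 0 <= \int[lebesgue2 R]_(z in O) g z.
Proof.
move=> mO mg H.
have -> : \int[lebesgue2 R]_(z in O) g z = \int[lebesgue2 R]_(z in O) `|g z|.
  rewrite /Rintegral; congr fine; apply: ae_eq_integral => //.
  - exact/measurable_EFinP.
  - by apply/measurable_EFinP; exact: measurableT_comp.
  - by apply: negligibleS H => z /= h1 h2; apply: h1 => Oz; rewrite ger0_norm ?h2.
by apply: Rintegral_ge0.
Qed.

(** Both candidates have the same integral against each test function, the power of -1 cancelling,
    so the sign criterion applies to their difference in either order. This carries the bounds from
    the constructed derivatives over to arbitrary ones. *)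
Lemma weak_derivative_unique O s u w1 w2 : weak_derivative O s u w1 -> weak_derivative O s u w2 ->
  {ae lebesgue2 R, forall z, O z -> w1 z = w2 z}.
Proof.
have half v1 v2 : weak_derivative O s u v1 -> weak_derivative O s u v2 ->
    {ae lebesgue2 R, forall z, O z -> 0 <= v1 z + -1 * v2 z}.
  move=> [_ l1 h1] [_ l2 h2]; have [_ oO _] := l1.
  apply: ae_ge0_of_test => //; first by apply: locally_integrable2D => //; exact: locally_integrable2Z.
  move=> phi t0 p0; have mO : measurable (O : set (plane R)) by exact: open_measurable2.
  have i1 := integrable_test l1 t0; have i2 := integrable_test l2 t0.
  have E : \int[lebesgue2 R]_(z in O) (v1 z * phi z) = \int[lebesgue2 R]_(z in O) (v2 z * phi z).
    by have := h1 _ t0; rewrite (h2 _ t0) => /(can_inj (signrMK _)).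
  have -> : \int[lebesgue2 R]_(z in O) ((v1 z + -1 * v2 z) * phi z) =
      \int[lebesgue2 R]_(z in O) (v1 z * phi z - v2 z * phi z).
    by apply: eq_Rintegral => z _; ring.
  have := RintegralB mO i1 i2; rewrite /= => ->.
  by rewrite [X in _ <= X - _]E subrr.
move=> d1 d2; apply: ae2S (ae2_and (half _ _ d1 d2) (half _ _ d2 d1)) => z [h1 h2] Oz.
by move: (h1 Oz) (h2 Oz); rewrite !mulN1r => ? ?; apply/eqP; rewrite eq_le; apply/andP; split; lra.
Qed.

Section operator.
Context (sigma r q k1 T : R) (u ux uxx ut : R * R -> R).
Context (dx : is_weak_dx k1 T u ux) (dxx : is_weak_dxx k1 T u uxx) (dt : is_weak_dt k1 T u ut).

Lemma locally_integrable2_Lop :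
  locally_integrable2 (Qopen k1 T) (fun z => ut z - Lop sigma r q u ux uxx z).
Proof.
have [l0 lx _] := dx; have [_ lxx _] := dxx; have [_ lt _] := dt.
have -> : (fun z => ut z - Lop sigma r q u ux uxx z) =
    (fun z => ut z + ((- (sigma ^+ 2 / 2)) * uxx z + ((- (r - q - sigma ^+ 2 / 2)) * ux z + r * u z))).
  by apply/funext => z; rewrite /Lop; ring.
by do 3 (apply: locally_integrable2D => //; first try exact: locally_integrable2Z);
  exact: locally_integrable2Z.
Qed.

Lemma Rintegral_Lop phi : test_function (Qopen k1 T) phi ->
  \int[lebesgue2 R]_(z in Qopen k1 T) ((ut z - Lop sigma r q u ux uxx z) * phi z) =
  \int[lebesgue2 R]_(z in Qopen k1 T) (u z * adjoint_op sigma r q phi z).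
Proof.
move=> t0; have [l0 lx hx] := dx; have [_ lxx hxx] := dxx; have [_ lt ht] := dt.
have mQ : measurable (Qopen k1 T : set (plane R)) by apply: open_measurable2; exact: open_Qopen.
set b := r - q - sigma ^+ 2 / 2.
have i0 := integrable_test l0 t0; have ix := integrable_test lx t0.
have ixx := integrable_test lxx t0; have it := integrable_test lt t0.
have jx := integrable_test l0 (test_iter_derive [:: dir_x R] t0).
have jt := integrable_test l0 (test_iter_derive [:: dir_t R] t0).
have jxx := integrable_test l0 (test_iter_derive [:: dir_x R; dir_x R] t0).
have := hx _ t0; have := hxx _ t0; have := ht _ t0.
rewrite /= expr1 expr2 !mulN1r opprK mul1r => et exx ex.
transitivity (\int[lebesgue2 R]_(z in Qopen k1 T) (1 * (ut z * phi z) + (- (sigma ^+ 2 / 2)) * (uxx z * phi z)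
   + (- b) * (ux z * phi z) + r * (u z * phi z))).
  by apply: eq_Rintegral => z _; rewrite /Lop -/b; ring.
rewrite (Rintegral_lin4 1 (- (sigma ^+ 2 / 2)) (- b) r mQ it ixx ix i0).
transitivity (\int[lebesgue2 R]_(z in Qopen k1 T) ((- 1) * (u z * 'D_(dir_t R) phi z) +
   (- (sigma ^+ 2 / 2)) * (u z * 'D_(dir_x R) ('D_(dir_x R) phi) z) + b * (u z * 'D_(dir_x R) phi z) + r * (u z * phi z))).
  rewrite (Rintegral_lin4 (- 1) (- (sigma ^+ 2 / 2)) b r mQ jt jxx jx i0) /= et exx ex.
  by rewrite !mulrN !mulNr opprK !mul1r.
by apply: eq_Rintegral => z _; rewrite /adjoint_op -/b; ring.
Qed.

End operator.
End weak_derivatives.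

(** * Comparison of strong solutions *)

Section comparison.
Context {R : realType} (p sigma r q K1 k1 K2 T : R).
Context (r0 : 0 < r) (T0 : 0 < T).
Let l := ln k1.
(** Projection onto the closed domain. Composed with it, the difference of two solutions is
    continuous on the plane, vanishes for [x >= ln k1] and for [t <= 0], and is constant in time
    beyond [T]. *)
Let clamp (z : R * R) : R * R := (Num.min z.1 l, Num.max 0 (Num.min z.2 T)).

Let clampQ z : Qclosed k1 T (clamp z).
Proof. by split; rewrite /clamp /= ?ge_min ?lexx ?orbT// le_max lexx/= ge_max (ltW T0) ge_min lexx orbT. Qed.

Let clamp_id z : Qclosed k1 T z -> clamp z = z.
Proof.
case: z => x t [/= h1 /andP[h2 h3]]; rewrite /clamp /= (min_idPl h1); congr pair.
by rewrite (min_idPl h3) (max_idPr h2).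
Qed.

Let clamp_continuous (u : R * R -> R) : {within Qclosed k1 T, continuous u} -> continuous (u \o clamp).
Proof.
move=> /subspace_continuousP H z; apply: (cvg_comp clamp u); last exact: H (clampQ z).
move=> B; rewrite /within /= => /nbhs_ballP[e /= e0 He].
have : nbhs z (ball z e) by exact: nbhsx_ballx.
apply: filterS => z' [b1 b2]; apply: He => //; rewrite /ball/= in b1 b2.
move: b1 b2; rewrite !ltr_norml => /andP[x1 x2] /andP[t1 t2].
split; rewrite /ball/= ltr_norml; apply/andP.
- by case: (leP z.1 l) => ?; case: (leP z'.1 l) => ?; split; lra.
- have : - e < Num.min z.2 T - Num.min z'.2 T < e.
    by apply/andP; case: (leP z.2 T) => ?; case: (leP z'.2 T) => ?; split; lra.
  move: (Num.min z.2 T) (Num.min z'.2 T) => y y' /andP[? ?].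
  by case: (leP 0 y) => ?; case: (leP 0 y') => ?; split; lra.
Qed.

Lemma strong_solution_le (Y1 Y2 : R * R -> R) :
  bounded_strong_solution p sigma r q K1 k1 K2 T Y1 ->
  bounded_strong_solution p sigma r q K1 k1 K2 T Y2 ->
  forall z, Qclosed k1 T z -> Y1 z <= Y2 z.
Proof.
move=> [[X1 [XX1 [D1 [[c1 dx1 dxx1 dt1 _] lb1 ge1 eq1 [init1 bd1]]]]] [M1 HM1]].
move=> [[X2 [XX2 [D2 [[c2 dx2 dxx2 dt2 _] lb2 ge2 eq2 [init2 bd2]]]]] [M2 HM2]].
pose w z := Y1 (clamp z) - Y2 (clamp z).
have wc : continuous w.
  by move=> z; apply: cvgB; [exact: (clamp_continuous c1)|exact: (clamp_continuous c2)].
have wM z : `|w z| <= M1 + M2.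
  by apply: (le_trans (ler_normB _ _)); apply: lerD; [exact: HM1|exact: HM2].
have cl2 z : 0 <= (clamp z).2 <= T by have [_] := clampQ z.
have wl z : l <= z.1 -> w z = 0.
  move=> zl; rewrite /w; have -> : clamp z = (l, (clamp z).2) by rewrite /clamp (min_idPr zl).
  by rewrite bd1 ?bd2 ?cl2// subrr.
have w0 z : z.2 <= 0 -> w z = 0.
  move=> z2; have [zl|zl] := leP l z.1; first exact: wl.
  rewrite /w; have -> : clamp z = (z.1, 0).
    by rewrite /clamp (min_idPl (ltW zl)) (min_idPl (le_trans z2 (ltW T0))) (max_idPl z2).
  by rewrite init1// init2// subrr.
(* The initial and lateral conditions push the positivity set into the open domain, so functions
   tested on it are admissible for the weak derivatives. *)
have UQ z : 0 < w z -> z.2 < T -> Qopen k1 T z /\ Y2 z < Y1 z.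
  move=> wz zT; have z1 : z.1 < l by rewrite ltNge; apply/negP => /wl h; rewrite h ltxx in wz.
  have z2 : 0 < z.2 by rewrite ltNge; apply/negP => /w0 h; rewrite h ltxx in wz.
  split; first by split=> //; rewrite z2.
  rewrite -subr_gt0; move: wz; rewrite /w clamp_id//; split; first exact: ltW.
  by rewrite !ltW.
have mQ : measurable (Qopen k1 T : set (plane R)) by apply: open_measurable2; exact: open_Qopen.
have key phi : test_function [set z | 0 < w z /\ z.2 < T] phi -> (forall z, 0 <= phi z) ->
    \int[lebesgue2 R]_z (w z * adjoint_op sigma r q phi z) <= 0.
  move=> t0 p0; have tQ : test_function (Qopen k1 T) phi.
    by apply: test_functionS t0 => z [h1 h2]; have [] := UQ z h1 h2.
  have l1 := locally_integrable2_Lop sigma r q dx1 dxx1 dt1.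
  have l2 := locally_integrable2_Lop sigma r q dx2 dxx2 dt2.
  have i1 := integrable_test l1 tQ; have i2 := integrable_test l2 tQ.
  have E1 := Rintegral_Lop sigma r q dx1 dxx1 dt1 tQ.
  have E2 := Rintegral_Lop sigma r q dx2 dxx2 dt2 tQ.
  have adj_out z : ~ Qopen k1 T z -> adjoint_op sigma r q phi z = 0.
    move=> hz; rewrite /adjoint_op (test_out tQ hz).
    rewrite (test_out (test_iter_derive [:: dir_t R] tQ) hz : 'D_(dir_t R) phi z = 0).
    rewrite (test_out (test_iter_derive [:: dir_x R] tQ) hz : 'D_(dir_x R) phi z = 0).
    rewrite (test_out (test_iter_derive [:: dir_x R; dir_x R] tQ) hz : 'D_(dir_x R) ('D_(dir_x R) phi) z = 0).
    by rewrite !mulr0 !subr0 addr0.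
  have iY (u v1 v2 v3 : R * R -> R) : is_weak_dx k1 T u v1 ->
      (lebesgue2 R).-integrable (Qopen k1 T) (fun z => (u z * adjoint_op sigma r q phi z)%:E).
    move=> [lu _ _]; have j0 := integrable_test lu tQ.
    have jx := integrable_test lu (test_iter_derive [:: dir_x R] tQ).
    have jt := integrable_test lu (test_iter_derive [:: dir_t R] tQ).
    have jxx := integrable_test lu (test_iter_derive [:: dir_x R; dir_x R] tQ).
    have k0 := integrableZl mQ r j0.
    have kx := integrableZl mQ (r - q - sigma ^+ 2 / 2) jx.
    have kxx := integrableZl mQ (sigma ^+ 2 / 2) jxx.
    have := integrableB mQ (integrableD mQ (integrableB mQ k0 jt) kx) kxx.
    congr (_.-integrable _ _); apply/funext => z /=.
    transitivity ((r * (u z * phi z) - u z * 'D_(dir_t R) phi z +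
      (r - q - sigma ^+ 2 / 2) * (u z * 'D_(dir_x R) phi z) -
      sigma ^+ 2 / 2 * (u z * 'D_(dir_x R) ('D_(dir_x R) phi) z))%:E); first by [].
    by congr EFin; rewrite /adjoint_op; ring.
  have j1 := iY Y1 X1 X1 X1 dx1; have j2 := iY Y2 X2 X2 X2 dx2.
  have -> : \int[lebesgue2 R]_z (w z * adjoint_op sigma r q phi z) =
     - \int[lebesgue2 R]_(z in Qopen k1 T) ((D2 z - Lop sigma r q Y2 X2 XX2 z) * phi z -
         (D1 z - Lop sigma r q Y1 X1 XX1 z) * phi z).
    have -> : \int[lebesgue2 R]_z (w z * adjoint_op sigma r q phi z) =
        \int[lebesgue2 R]_(z in Qopen k1 T) (Y1 z * adjoint_op sigma r q phi z - Y2 z * adjoint_op sigma r q phi z).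
      rewrite [RHS]Rintegral_mkcond; apply: eq_Rintegral => z _; rewrite patchE.
      case: ifPn; rewrite ?inE ?notin_setE => hz; last by rewrite adj_out// mulr0.
      have [h1 /andP[h2 h3]] := hz.
      by rewrite /w clamp_id -?mulrBl//; split; rewrite ?ltW.
    apply: (etrans (RintegralB mQ j1 j2)).
    rewrite -[LHS]opprB; congr (- _); apply: (etrans _ (esym (RintegralB mQ i2 i1))).
    by rewrite /= E1 E2.
  rewrite oppr_le0; apply: Rintegral_ae_ge0 => //.
    have [m1 _ _] := l1; have [m2 _ _] := l2; have mp := measurable_test tQ.
    by apply: measurable_funB; apply: measurable_funM => //; exact: measurable_funTS.
  apply: ae2S (ae2_and ge2 eq1) => z [h2 h1] Qz.
  have QQ : Qset k1 T z by have [a1 /andP[a2 a3]] := Qz; split=> //; rewrite a2 ltW.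
  rewrite -mulrBl; have [Uz|Uz] := pselect (0 < w z /\ z.2 < T); last first.
    by rewrite (test_out t0 Uz) mulr0.
  have [_ h3] := UQ _ Uz.1 Uz.2.
  rewrite (h1 QQ) ?subr0; first by rewrite mulr_ge0// h2.
  by apply: le_lt_trans h3; exact: lb2.
have wneg z : z.2 < T -> w z <= 0.
  apply: (weak_maximum_principle r0 wc wM _ key) => z' hz'.
  by rewrite w0.
move=> z Qz; rewrite -subr_le0; have -> : Y1 z - Y2 z = w z by rewrite /w clamp_id.
(* The maximum principle covers [t < T]; the final time is reached by continuity from below. *)
have cv : w (z + - @step_x R n *: dir_t R) @[n --> \oo] --> w z.
  apply: (cvg_comp (fun n => z + - @step_x R n *: dir_t R) w); last exact: wc.
  suff : z + - @step_x R n *: dir_t R @[n --> \oo] --> z + 0 *: dir_t R by rewrite scale0r addr0.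
  apply: cvgD; first exact: cvg_cst.
  by apply: cvgZl; rewrite -oppr0; apply: cvgN; exact: step_x_cvg0.
apply: (cvgn_le (m0:=0%N) cv) => n _; apply: wneg; rewrite add_dir_t /=.
have [_ /andP[_ zT]] := Qz; have := @step_x_gt0 R n; move: zT.
by move: (step_x n) => x; lra.
Qed.

End comparison.

(** * Existence, uniqueness and bounds *)

Theorem theorem3p3 (R : realType) (K1 k1 k2 K2 sigma r q T p : R)
    (hK1 : 0 < K1) (hK1k1 : K1 < k1) (hk1k2 : k1 < k2) (hk2K2 : k2 < K2)
    (hsigma : 0 < sigma) (hr : 0 < r) (hq : 0 <= q) (hT : 0 < T)
    (hp : 1 < p) :
  exists Y : R * R -> R,
    [/\ bounded_strong_solution p sigma r q K1 k1 K2 T Y,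
        forall Y' : R * R -> R,
          bounded_strong_solution p sigma r q K1 k1 K2 T Y' ->
          forall z, Qclosed k1 T z -> Y' z = Y z,
        forall x t, Qclosed k1 T (x, t) ->
          psi1 K1 k1 K2 x <= Y (x, t) <= K2 - K1,
        forall Yt : R * R -> R, is_weak_dt k1 T Y Yt ->
          {ae lebesgue2 R, forall z, Qset k1 T z -> 0 <= Yt z} &
        forall Yx : R * R -> R, is_weak_dx k1 T Y Yx ->
          {ae lebesgue2 R, forall z, Qset k1 T z ->
            0 <= Yx z <= expR z.1}].
Proof.
have [Y [s [sm sY Yc]]] := value_function_exists hK1 hK1k1 hk1k2 hk2K2 hsigma hr hq.
have bounds := value_bounds hK1k1 hk1k2 hk2K2 hsigma hr sY.
have gl := obstacle_left hK1 hK1k1 hk1k2 hk2K2.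
have gr := obstacle_right hK1 hK1k1 hk1k2 hk2K2.
have k10 : 0 < k1 by lra.
have YM z : `|Y z| <= K2 - K1.
  have /andP[h1 h2] := bounds z; rewrite ger0_norm//.
  exact: le_trans (obstacle_ge0 hK1 hK1k1 hk1k2 hk2K2 _) h1.
have [Dx [Dxx [Dt [WW Dt0 Dx0]]]] := value_Wp k10 Yc YM (value_homo_t hsigma sY)
  (value_incr_x hK1 hK1k1 hk1k2 hk2K2 hsigma hq sY) (value_lip_x hK1 hK1k1 hk1k2 hk2K2 hsigma hr hq sY)
  (value_local_lip hK1 hK1k1 hk1k2 hk2K2 hsigma hr hq sm sY)
  (value_second_diff_lo hK1 hK1k1 hk1k2 hk2K2 hsigma hr hq sm sY)
  (value_second_diff_up hK1 hK1k1 hk1k2 hk2K2 hsigma hr hq sm sY) T hp.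
have [_ dx dxx dt _] := WW.
have oQ := @open_Qopen R k1 T.
have lf := locally_integrable2_Lop sigma r q dx dxx dt.
have adj phi : test_function (Qopen k1 T) phi ->
    \int[lebesgue2 R]_(z in Qopen k1 T) ((Dt z - Lop sigma r q Y Dx Dxx z) * phi z) =
    \int[lebesgue2 R]_z (Y z * adjoint_op sigma r q phi z).
  move=> t0; rewrite (Rintegral_Lop sigma r q dx dxx dt t0) Rintegral_mkcond.
  apply: eq_Rintegral => z _; rewrite patchE; case: ifPn => //; rewrite notin_setE => hz.
  rewrite /adjoint_op (test_out t0 hz).
  rewrite (test_out (test_iter_derive [:: dir_t R] t0) hz : 'D_(dir_t R) phi z = 0).
  rewrite (test_out (test_iter_derive [:: dir_x R] t0) hz : 'D_(dir_x R) phi z = 0).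
  rewrite (test_out (test_iter_derive [:: dir_x R; dir_x R] t0) hz : 'D_(dir_x R) ('D_(dir_x R) phi) z = 0).
  by rewrite !mulr0 !subr0 addr0 mulr0.
have super : {ae lebesgue2 R, forall z, Qset k1 T z -> 0 <= Dt z - Lop sigma r q Y Dx Dxx z}.
  apply: ae_Qset; apply: ae_ge0_of_test => // phi t0 p0; rewrite adj//.
  apply: (value_weak_supersolution hK1 hK1k1 hk1k2 hk2K2 hsigma hr hq Yc sm sY t0) => // z [_ /andP[h _]].
  exact: ltW.
(* The non-contact set, with the obstacle written as [Y (z.1, 0)] so that openness follows from the
   continuity of [Y] and its Lipschitz bound in [x]. *)
pose O : set (R * R) := Qopen k1 T `&` [set z | 0 < Y z - Y (z.1, 0)].
have gE z : obstacle K1 k1 K2 z.1 = Y (z.1, 0) by rewrite (value_init hsigma sY).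
have oO : open O.
  apply: openI => //.
  apply: (open_comp (f:=fun z : R * R => Y z - Y (z.1, 0)) (D:=[set x : R | 0 < x])); last exact: open_gt.
  move=> z _; apply: cvgB; first exact: Yc.
  have c1 : z'.1 @[z' --> z] --> z.1 by exact: cvg_fst.
  apply/cvgrPdist_le => e e0; have e0' : 0 < e / k1 by rewrite divr_gt0.
  have /cvgrPdist_le/(_ _ e0') := c1; apply: filterS => z' hz'.
  apply: (le_trans (value_lip_x hK1 hK1k1 hk1k2 hk2K2 hsigma hr hq sY _ _ _)).
  by rewrite mulrC -ler_pdivlMr.
have OQ : O `<=` Qopen k1 T by move=> z [].
have zero phi : test_function O phi ->
    \int[lebesgue2 R]_(z in O) ((Dt z - Lop sigma r q Y Dx Dxx z) * phi z) = 0.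
  move=> t0; have tQ := test_functionS OQ t0.
  rewrite (Rintegral_test _ t0) -(Rintegral_test _ tQ) adj//.
  apply: (value_weak_solution hK1 hK1k1 hk1k2 hk2K2 hsigma hr hq Yc sm sY t0) => z [[_ /andP[h _]] h2].
  by rewrite ltW// gE -subr_gt0.
have lO := locally_integrable2S oO OQ lf.
have eq0 : {ae lebesgue2 R, forall z, Qset k1 T z -> psi1 K1 k1 K2 z.1 < Y z ->
    Dt z - Lop sigma r q Y Dx Dxx z = 0}.
  (* Zero integrals against all test functions on [O] allow the sign criterion to be applied to the
     residual and to its opposite. *)
  have h1 : {ae lebesgue2 R, forall z, O z -> 0 <= Dt z - Lop sigma r q Y Dx Dxx z}.
    by apply: ae_ge0_of_test => // phi t0 _; rewrite zero.
  have h2 : {ae lebesgue2 R, forall z, O z -> 0 <= -1 * (Dt z - Lop sigma r q Y Dx Dxx z)}.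
    apply: ae_ge0_of_test => //; first exact: locally_integrable2Z.
    move=> phi t0 _; have -> : \int[lebesgue2 R]_(z in O) (-1 * (Dt z - Lop sigma r q Y Dx Dxx z) * phi z) =
      \int[lebesgue2 R]_(z in O) (-1 * ((Dt z - Lop sigma r q Y Dx Dxx z) * phi z)).
      by apply: eq_Rintegral => z _; rewrite mulrA.
    have mO : measurable (O : set (plane R)) by exact: open_measurable2.
    have := RintegralZl (-1) mO (integrable_test lO t0); rewrite /= => ->.
    by rewrite [X in -1 * X](zero _ t0) mulr0.
  apply: ae_Qset; apply: ae2S (ae2_and h1 h2) => z [a1 a2] Qz pz.
  have Oz : O z by split=> //; rewrite /= subr_gt0 -gE gl//; have [/ltW] := Qz.
  by apply/eqP; rewrite eq_le a1// andbT -oppr_ge0 -mulN1r a2.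
have sol : bounded_strong_solution p sigma r q K1 k1 K2 T Y.
  split; last by exists (K2 - K1).
  exists Dx, Dxx, Dt; split=> //.
  - by move=> z [/ltW zl _]; rewrite -gl//; have /andP[] := bounds z.
  (* At [x = ln k1] the truncated obstacle already equals the upper bound [K2 - K1], which pins the
     value. *)
  - split=> [x xl|t _]; first by rewrite (value_init hsigma sY)// gl// ltW.
    by apply/eqP; rewrite eq_le; have /andP[] := bounds (ln k1, t); rewrite /= gr// => -> ->.
exists Y; split=> //.
- move=> Y' sol' z Qz; apply/eqP; rewrite eq_le.
  by rewrite (strong_solution_le hr hT sol' sol Qz) (strong_solution_le hr hT sol sol' Qz).
- by move=> x t [xl _]; rewrite -(gl x xl); exact: (bounds (x, t)).
- move=> Yt dt'; apply: ae_Qset.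
  by apply: ae2S (weak_derivative_unique dt dt') => z h Qz; rewrite -h.
- move=> Yx dx'; apply: ae_Qset.
  by apply: ae2S (weak_derivative_unique dx dx') => z h Qz; rewrite -h.
Qed.
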